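(* Let $\kappa:\mathbb R\to(0,\infty)$ be continuously differentiable with $c_1e^{-a_1|t|}\le\kappa(t)$, $\kappa(t)\le c_2e^{a_2|t|}$ and $|\kappa'(t)|\le c_2e^{a_2|t|}$ for all $t\in\mathbb R$, for some $c_1,c_2,a_1,a_2>0$. Then the solution $(u_0^N,\dots,u_J^N)$ of the Galerkin system converges in probability in $L^2(\mathbb T^d;\mathbb R^{J+1})$, as $N\to\infty$, to the weak solution $(u_0,\dots,u_J)$ of the SPDE system (driven by the same white noises).
   Context: Let $d\in\{1,2,3\}$, $\mathbb T^d=\mathbb R^d/\mathbb Z^d$, $L^2=L^2(\mathbb T^d)$ with inner product $\langle\cdot,\cdot\rangle$. $\{\phi_p\}_{p\in\mathbb Z}$ is the orthonormal Fourier basis $\{e^{2\pi i\mathbf k\cdot\mathbf x}\}_{\mathbf k\in\mathbb Z^d}$ enumerated so that for each $n\ge0$, with $N=((2n+1)^d-1)/2$, $\phi_{-N},\dots,\phi_N$ are those with $\mathbf k\in\{-n,\dots,n\}^d$; $H_N=\mathrm{span}\{\phi_{-N},\dots,\phi_N\}$; $N\to\infty$ along these values. Fix $\nu>0$, an integer $J\ge0$, and a real constant $u_{-1}$. $\kappa(v)=\kappa\circ v$, $\kappa^a(v)=(\kappa\circ v)^a$. White noises $w_i=\sum_p\widehat w_i(p)\phi_p$, $i=0,\dots,J$, with independent standard Gaussian coefficients (conjugate-symmetric so $w_i$ is real); $w_i^N=\sum_{p=-N}^N\widehat w_i(p)\phi_p$. SPDE system: almost surely bounded $u_0,\dots,u_J$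 with $-\langle u_i,\Delta\phi\rangle+\langle\kappa^2(u_{i-1})u_i,\phi\rangle=\sum_p\widehat w_i(p)\langle\kappa^\nu(u_{i-1})\phi_p,\phi\rangle$ for all $\phi\in C^2(\mathbb T^d)$, $i=0,\dots,J$. Galerkin system: $u_{-1}^N:=u_{-1}$ and $u_i^N\in H_N$ with $\langle\nabla u_i^N,\nabla\phi\rangle+\langle\kappa^2(u_{i-1}^N)u_i^N,\phi\rangle=\langle\kappa^\nu(u_{i-1}^N)w_i^N,\phi\rangle$ for all $\phi\in H_N$, $i=0,\dots,J$. *)

(* Defs.v *)
From HB Require Import structures.
From mathcomp Require Import all_boot all_order all_algebra.
From mathcomp Require Import all_classical all_reals all_analysis.
Set Implicit Arguments. Unset Strict Implicit. Unset Printing Implicit Defensive.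
Import Order.TTheory GRing.Theory Num.Theory.
Import numFieldNormedType.Exports.
Local Open Scope classical_set_scope.
Local Open Scope ring_scope.

Fixpoint cube_int {R : realType} (n : nat) : (n.-tuple R -> \bar R) -> \bar R :=
  match n return (n.-tuple R -> \bar R) -> \bar R with
  | 0 => fun f => f [tuple]
  | n'.+1 => fun f =>
      (\int[@lebesgue_measure R]_(t in `[0%R, 1%R]) cube_int (fun x => f (cons_tuple t x)))%E
  end.

Fixpoint pos_lex (k : seq int) : bool :=
  match k with
  | [::] => false
  | a :: t => if a == 0 then pos_lex t else 0 < a
  end.

Section torus.
Context {R : realType} {d : nat}.

(* Points of R^d; functions on the torus T^d = R^d/Z^d are the Z^d-periodic
   functions 'rV[R]_d -> R. *)
Definition fromT (x : d.-tuple R) : 'rV[R]_d := \row_j tnth x j.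

Definition tint (f : 'rV[R]_d -> \bar R) : \bar R := cube_int (f \o fromT).

Definition inner (f g : 'rV[R]_d -> R) : R := fine (tint (fun x => (f x * g x)%:E)).

Definition periodic (f : 'rV[R]_d -> R) := forall x (j : 'I_d), f (x + 'e_j) = f x.

Definition dpart (j : 'I_d) (f : 'rV[R]_d -> R) : 'rV[R]_d -> R :=
  fun x => 'D_('e_j) f x.

Definition lap (f : 'rV[R]_d -> R) : 'rV[R]_d -> R :=
  fun x => \sum_(j < d) dpart j (dpart j f) x.

Definition grad_inner (u v : 'rV[R]_d -> R) : R :=
  \sum_(j < d) inner (dpart j u) (dpart j v).

Definition C2_torus (f : 'rV[R]_d -> R) : Prop :=
  [/\ periodic f, continuous f,
      (forall (j : 'I_d) x, derivable f x 'e_j) /\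
      (forall j, continuous (dpart j f)),
      (forall (j k : 'I_d) x, derivable (dpart k f) x 'e_j) &
      (forall j k, continuous (dpart j (dpart k f)))].

Definition kdot (k : d.-tuple int) (x : 'rV[R]_d) : R :=
  \sum_(j < d) (tnth k j)%:~R * x 0 j.

(* real orthonormal Fourier basis of L^2(T^d): 1, sqrt2 cos(2 pi k.x) for
   lexicographically positive k, sqrt2 sin(2 pi k.x) for negative k *)
Definition fourier (k : d.-tuple int) (x : 'rV[R]_d) : R :=
  if all (fun z => z == 0) k then 1
  else if pos_lex k then Num.sqrt 2 * cos (2 * pi * kdot k x)
  else Num.sqrt 2 * sin (2 * pi * kdot k x).

Definition cubek (n : nat) (t : d.-tuple 'I_(2 * n).+1) : d.-tuple int :=
  [tuple (tnth t j)%:Z - n%:Z | j < d].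

(* real elements of H_N, N = ((2n+1)^d - 1)/2 *)
Definition in_H (n : nat) (v : 'rV[R]_d -> R) : Prop :=
  exists c : d.-tuple 'I_(2 * n).+1 -> R,
    v = fun x => \sum_(t : d.-tuple 'I_(2 * n).+1) c t * fourier (cubek t) x.

End torus.

Section model.
Context {R : realType} {d : nat} {dO : measure_display} {Omega : measurableType dO}.
Variable P : probability Omega R.

(* zeta i k : coefficient of the i-th white noise on the k-th real basis
   function *)
Definition white_noises (J : nat) (zeta : nat -> d.-tuple int -> Omega -> R) : Prop :=
  [/\ (forall i k, (i <= J)%N -> measurable_fun setT (zeta i k)),
      (forall i k, (i <= J)%N -> forall A : set R, measurable A ->
          P (zeta i k @^-1` A) = normal_prob 0 1 A) &
      (forall s : seq (nat * d.-tuple int), uniq s -> all (fun a => (a.1 <= J)%N) s ->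
        forall B : nat * d.-tuple int -> set R, (forall a, measurable (B a)) ->
          P (\bigcap_(a in [set` s]) (zeta a.1 a.2 @^-1` B a)) =
          (\prod_(a <- s) P (zeta a.1 a.2 @^-1` B a))%E)].

Definition noiseN (zeta : nat -> d.-tuple int -> Omega -> R) (i n : nat)
    (w : Omega) (x : 'rV[R]_d) : R :=
  \sum_(t : d.-tuple 'I_(2 * n).+1) zeta i (cubek t) w * fourier (cubek t) x.

Definition prevf (um1 : R) (u : nat -> 'rV[R]_d -> R) (i : nat) : 'rV[R]_d -> R :=
  if i is i'.+1 then u i' else fun _ => um1.

Definition spde_solution (kappa : R -> R) (nu um1 : R) (J : nat)
    (zeta : nat -> d.-tuple int -> Omega -> R) (U : nat -> Omega -> 'rV[R]_d -> R) : Prop :=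
  (forall i, (i <= J)%N -> {ae P, forall w,
      [/\ measurable_fun setT (U i w \o fromT), periodic (U i w) &
          exists M : R, forall x, `|U i w x| <= M]}) /\
  (forall i, (i <= J)%N -> forall phi, C2_torus phi -> {ae P, forall w,
      let v := prevf um1 (fun j => U j w) i in
      (fun n : nat => \sum_(t : d.-tuple 'I_(2 * n).+1)
          zeta i (cubek t) w *
          inner (fun x => kappa (v x) `^ nu * fourier (cubek t) x) phi)
      @ \oo --> (- inner (U i w) (lap phi) + inner (fun x => kappa (v x) ^+ 2 * U i w x) phi)}).

Definition galerkin_solution (kappa : R -> R) (nu um1 : R) (J : nat)
    (zeta : nat -> d.-tuple int -> Omega -> R)
    (UN : nat -> nat -> Omega -> 'rV[R]_d -> R) : Prop :=
  forall n, {ae P, forall w, forall i, (i <= J)%N ->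
    let v := prevf um1 (fun j => UN n j w) i in
    in_H n (UN n i w) /\
    forall phi, in_H n phi ->
      grad_inner (UN n i w) phi + inner (fun x => kappa (v x) ^+ 2 * UN n i w x) phi =
      inner (fun x => kappa (v x) `^ nu * noiseN zeta i n w x) phi}.

Definition L2dist2 (J : nat) (V W : nat -> 'rV[R]_d -> R) : \bar R :=
  (\sum_(i < J.+1) tint (fun x => ((V i x - W i x) ^+ 2)%:E))%E.

(* convergence in (outer) probability in L^2(T^d; R^{J+1}) *)
Definition cvg_in_prob_L2 (J : nat) (UN : nat -> nat -> Omega -> 'rV[R]_d -> R)
    (U : nat -> Omega -> 'rV[R]_d -> R) : Prop :=
  forall eps : R, 0 < eps -> exists A : nat -> set Omega,
    [/\ forall n, measurable (A n),
        forall n, [set w | ((eps ^+ 2)%:E < L2dist2 J (fun i => UN n i w) (fun i => U i w))%E]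
                  `<=` A n &
        (fun n => P (A n)) @ \oo --> 0%E].

End model.

(* Main.v *)
(* Bessel's inequality and the coercivity of kappa^2(v) make the Galerkin
   equation stable: the error u_N - u in L^2 is bounded by the L^2 error of
   kappa^2 at the previous level, the projection error of u, and the gap between
   the data, measured in coefficients weighted by (1 + lambda_k)^{-1}, where
   lambda_k is the k-th eigenvalue of - Delta; for d <= 3 the weights
   (1 + lambda_k)^{-2} are summable.  Conditionally on the earlier noises the
   data gap is Gaussian, with a variance that tends to 0 by Parseval; divided by
   this variance it is bounded in mean, so it tends to 0 almost surely along a
   subsequence.

   To pass to the next level one needs kappa^s(u_N) -> kappa^s(u) in L^2 for
   every s > 0.  As kappa grows at most exponentially, this follows from
   u_N -> u and a bound on the exponential moments of u_N over the torus.
   Conditionally u_N(x) is Gaussian with variance at most |m G_x|^2, where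
   m = kappa^nu(v_N) and G_x is the discrete Green function, whose coefficients
   are O((1 + lambda_k)^{-1}); summing over dyadic frequency blocks bounds this
   variance uniformly in x and N.  All convergences are almost sure along
   subsequences of arbitrary subsequences, which amounts to convergence in
   probability. *)
Require Import Defs.
From HB Require Import structures.
From mathcomp Require Import all_boot all_order all_algebra.
From mathcomp Require Import all_classical all_reals all_analysis.
From mathcomp Require Import measurable_realfun zify ring lra.
Set Implicit Arguments. Unset Strict Implicit. Unset Printing Implicit Defensive.
Import Order.TTheory GRing.Theory Num.Theory.
Import numFieldNormedType.Exports.
Local Open Scope classical_set_scope.
Local Open Scope ring_scope.

(** * Bounded measurable functions and their means *)

(** The obstacle is that the data of the limit equation are known only as limits of random series,
    and that neither solution is assumed measurable or adapted in the sample point. Hence every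
    random quantity that is conditioned on or integrated is built from discrete objects: the
    Galerkin solution is rewritten with an explicit inverse matrix, and what depends on the limit is
    replaced by limits of discrete quantities along a subsequence. Conditioning is expressed by
    product measures: the joint law of the earlier noises and one new coefficient is a product, and
    Tonelli's theorem integrates that coefficient out. The weights (1 + lambda_k)^{-2} are forced:
    for d >= 2 white noise is not in H^{-1}, so no energy estimate holds for the whole error. All
    powers of kappa are carried through the induction because one step consumes the exponents 2 (the
    coefficient), nu (the noise factor m) and 4 nu (the eighth moment of m). *)

Section bounded_measurable.
Context {R : realType} {dT : measure_display} {T : measurableType dT}.
Implicit Types f g : T -> R.

(** Everything integrated over the torus at a fixed sample point is of this kind: trigonometric
    polynomials, a bounded solution, continuous functions of them. The class is closed under
    products and continuous composition, so integrability on the torus is automatic. *)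
Definition bm f : Prop :=
  measurable_fun setT f /\ exists M : R, forall x, `|f x| <= M.

Lemma bm_cst (c : R) : bm (fun=> c).
Proof. by split; [exact: measurable_cst | exists `|c|]. Qed.

Lemma bmD f g : bm f -> bm g -> bm (fun x => f x + g x).
Proof.
move=> [mf [M hM]] [mg [N hN]]; split; first exact: measurable_realfun.measurable_funD.
by exists (M + N) => x; rewrite (le_trans (ler_normD _ _))// lerD.
Qed.

Lemma bmN f : bm f -> bm (fun x => - f x).
Proof.
move=> [mf [M hM]]; split; first exact: measurableT_comp.
by exists M => x; rewrite normrN.
Qed.

Lemma bmM f g : bm f -> bm g -> bm (fun x => f x * g x).
Proof.
move=> [mf [M hM]] [mg [N hN]]; split; first exact: measurable_funM.
by exists (M * N) => x; rewrite normrM ler_pM.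
Qed.

Lemma bmX f n : bm f -> bm (fun x => f x ^+ n).
Proof.
move=> [mf [M hM]]; split; first exact: measurable_funX.
by exists (M ^+ n) => x; rewrite normrX lerXn2r// nnegrE// (le_trans _ (hM x)).
Qed.

Lemma bm_norm f : bm f -> bm (fun x => `|f x|).
Proof.
move=> [mf [M hM]]; split; first exact: measurableT_comp.
by exists M => x; rewrite normr_id.
Qed.

Lemma bm_sum (I : Type) (s : seq I) (Q : pred I) (F : I -> T -> R) :
  (forall i, bm (F i)) -> bm (fun x => \sum_(i <- s | Q i) F i x).
Proof.
move=> hF; elim: s => [|i s IH].
  by under eq_fun do rewrite big_nil; exact: bm_cst.
under eq_fun do rewrite big_cons.
by case: (Q i) => //; apply: bmD.
Qed.

Lemma bm_comp (k : R -> R) f : continuous k -> bm f -> bm (fun x => k (f x)).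
Proof.
move=> ck [mf [M hM]]; split.
  by apply: measurableT_comp => //; exact: continuous_measurable_fun.
have [||c _ hc] := @EVT_max _ (fun t => `|k t|) (- `|M|) `|M|.
- by rewrite ge0_cp.
- apply: continuous_subspaceT => t.
  by apply: continuous_comp; [exact: ck | exact: norm_continuous].
exists `|k c| => x; apply: hc.
by rewrite in_itv /= -ler_norml (le_trans (hM x))// ler_norm.
Qed.

Lemma bm_indic (A : set T) : measurable A -> bm (\1_A : T -> R).
Proof.
move=> mA; split; first exact: measurable_indic.
by exists 1 => x; rewrite indicE; case: (_ \in _); rewrite ?normr1 ?normr0.
Qed.

End bounded_measurable.

Ltac bm_tac := repeat first
  [ assumption | apply: bm_cst | apply: bmD | apply: bmN | apply: bmX | apply: bmM
  | apply: bm_norm | (apply: bm_sum => ?) | progress intros | solve [eauto] ].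

Section expectation.
Context {R : realType} {dT : measure_display} {T : measurableType dT}.
Variable mu : probability T R.
Implicit Types f g h : T -> R.

Definition EE f : R := \int[mu]_x f x.

Lemma bm_integrable f : bm f -> mu.-integrable setT (EFin \o f).
Proof.
move=> [mf [M hM]]; apply: measurable_bounded_integrable => //.
  by rewrite (le_lt_trans (probability_le1 mu measurableT))// ltry.
exists M; split; first exact: num_real.
by move=> N /ltW MN x _; exact: le_trans (hM x) MN.
Qed.

Lemma EE_EFin f : bm f -> (\int[mu]_x (f x)%:E)%E = (EE f)%:E.
Proof.
by move=> hf; rewrite /EE /Rintegral fineK// integrable_fin_num//; exact: bm_integrable.
Qed.

Lemma EE_ext f g : f =1 g -> EE f = EE g.
Proof. by move=> /funext ->. Qed.

Lemma EE_cst (c : R) : EE (fun=> c) = c.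
Proof. by rewrite /EE Rintegral_cst//= probability_setT mulr1. Qed.

Lemma EED f g : bm f -> bm g -> EE (fun x => f x + g x) = EE f + EE g.
Proof. by move=> hf hg; rewrite /EE RintegralD//; exact: bm_integrable. Qed.

Lemma EEB f g : bm f -> bm g -> EE (fun x => f x - g x) = EE f - EE g.
Proof. by move=> hf hg; rewrite /EE RintegralB//; exact: bm_integrable. Qed.

Lemma EEZ (c : R) f : bm f -> EE (fun x => c * f x) = c * EE f.
Proof. by move=> hf; rewrite /EE RintegralZl//; exact: bm_integrable. Qed.

Lemma EE_sum (I : Type) (s : seq I) (Q : pred I) (F : I -> T -> R) :
  (forall i, bm (F i)) ->
  EE (fun x => \sum_(i <- s | Q i) F i x) = \sum_(i <- s | Q i) EE (F i).
Proof.
move=> hF; elim: s => [|i s IH].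
  by rewrite big_nil -[RHS](EE_cst 0); apply: EE_ext => x; rewrite big_nil.
rewrite big_cons -IH; case: ifP => Qi; last first.
  by apply: EE_ext => x; rewrite big_cons Qi.
rewrite -EED//; last exact: bm_sum.
by apply: EE_ext => x; rewrite big_cons Qi.
Qed.

Lemma EE_ge0 f : (forall x, 0 <= f x) -> 0 <= EE f.
Proof. by move=> h; apply: Rintegral_ge0. Qed.

Lemma EE_le f g : bm f -> bm g -> (forall x, f x <= g x) -> EE f <= EE g.
Proof. by move=> hf hg h; apply: le_Rintegral => //; exact: bm_integrable. Qed.

Lemma EE_sqr_ge0 f : 0 <= EE (fun x => f x ^+ 2).
Proof. by apply: EE_ge0 => x; exact: sqr_ge0. Qed.

Lemma EE_CS f g : bm f -> bm g ->
  EE (fun x => f x * g x) ^+ 2 <= EE (fun x => f x ^+ 2) * EE (fun x => g x ^+ 2).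
Proof.
move=> hf hg.
set a := EE (fun x => f x ^+ 2); set b := EE (fun x => f x * g x).
set c := EE (fun x => g x ^+ 2).
have H s t : 0 <= s ^+ 2 * a + 2 * s * t * b + t ^+ 2 * c.
  have -> : s ^+ 2 * a + 2 * s * t * b + t ^+ 2 * c
            = EE (fun x => (s * f x + t * g x) ^+ 2).
    rewrite -!EEZ; try bm_tac.
    rewrite -!EED; try bm_tac.
    by apply: EE_ext => x; ring.
  exact: EE_sqr_ge0.
have a0 : 0 <= a by exact: EE_sqr_ge0.
have c0 : 0 <= c by exact: EE_sqr_ge0.
have [c00|cn0] := eqVneq c 0.
  rewrite c00 mulr0.
  have [b0|bn0] := eqVneq b 0; first by rewrite b0 expr0n.
  (* With [c = 0] the quadratic form is affine in [t]; this [t] gives it the value - 1. *)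
  have := H 1 (- (a + 1) / (2 * b)).
  rewrite c00 mulr0 addr0 expr1n mul1r mulr1.
  rewrite (_ : 2 * (- (a + 1) / (2 * b)) * b = - (a + 1)); last by field.
  by move=> ?; exfalso; lra.
have cp : 0 < c by rewrite lt_def cn0.
have := H c (- b).
have -> : c ^+ 2 * a + 2 * c * (- b) * b + (- b) ^+ 2 * c = c * (a * c - b ^+ 2) by ring.
by rewrite pmulr_rge0// subr_ge0.
Qed.

Lemma EE_sqrD f g : bm f -> bm g ->
  EE (fun x => (f x + g x) ^+ 2)
    <= 2 * EE (fun x => f x ^+ 2) + 2 * EE (fun x => g x ^+ 2).
Proof.
move=> hf hg; rewrite -!EEZ; try bm_tac.
rewrite -EED; try bm_tac.
apply: EE_le; try bm_tac.
by have := sqr_ge0 (f x - g x); lra.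
Qed.

Lemma EE_dct_ae (F : nat -> T -> R) (f : T -> R) (M : R) :
  (forall n, bm (F n)) -> (forall n x, `|F n x| <= M) -> bm f ->
  {ae mu, forall x, F ^~ x @ \oo --> f x} ->
  (fun n => EE (F n)) @ \oo --> EE f.
Proof.
move=> bF hM bf cF; have [mf _] := bf.
apply: fine_cvg; rewrite -EE_EFin//.
have [| | |_ _] := @dominated_convergence _ _ _ mu setT measurableT
  (fun n => EFin \o F n) (EFin \o f) (fun=> M%:E)
  (fun n => (measurable_EFinP _ _).2 (bF n).1) ((measurable_EFinP _ _).2 mf).
- by apply: filterS cF => x cx _; apply: cvg_EFin; [exact: nearW | exact: cx].
- exact: (bm_integrable (bm_cst M)).
- by apply: aeW => x n _ /=; rewrite lee_fin.
- exact.
Qed.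

Lemma EE_dct (F : nat -> T -> R) (f : T -> R) (M : R) :
  (forall n, bm (F n)) -> (forall n x, `|F n x| <= M) ->
  measurable_fun setT f ->
  (forall x, F ^~ x @ \oo --> f x) ->
  (fun n => EE (F n)) @ \oo --> EE f.
Proof.
move=> bF hM mf cF; apply: (EE_dct_ae bF hM); last exact: aeW.
split=> //; exists M => x.
have cn : (fun n => `|F n x|) @ \oo --> `|f x|.
  by apply: cvg_norm; exact: cF.
rewrite -(cvg_lim (@Rhausdorff R) cn); apply: limr_le; first by apply/cvg_ex; exists `|f x|.
by apply: nearW => n; exact: hM.
Qed.

End expectation.

(** * Galerkin systems over a finite orthonormal family *)

Section galerkin.
Context {R : realType} {dT : measure_display} {T : measurableType dT}.
Variable mu : probability T R.
Variables (I : finType) (e : I -> T -> R) (lam : I -> R) (S : R).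
Hypothesis be : forall t, bm (e t).
Hypothesis e2 : forall t x, e t x ^+ 2 <= 2.
Hypothesis eo : forall s t, EE mu (fun x => e s x * e t x) = (s == t)%:R.
Hypothesis lam0 : forall t, 0 <= lam t.
Hypothesis S0 : 0 <= S.
Hypothesis hS : \sum_t (1 + lam t) ^- 2 <= S.
Local Notation E := (EE mu).
Local Notation n2 f := (EE mu (fun x => f x ^+ 2)).

Definition comb (c : I -> R) (x : T) : R := \sum_t c t * e t x.

Lemma bm_comb c : bm (comb c).
Proof. by apply: bm_sum => t; bm_tac. Qed.

Lemma E_comb (h : T -> R) c : bm h ->
  E (fun x => h x * comb c x) = \sum_t c t * E (fun x => h x * e t x).
Proof.
move=> bh.
rewrite (EE_ext _ (g := fun x => \sum_t c t * (h x * e t x))); last first.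
  by move=> x; rewrite mulr_sumr; apply: eq_bigr => t _; ring.
rewrite EE_sum; last by move=> t; bm_tac.
by apply: eq_bigr => t _; rewrite EEZ//; bm_tac.
Qed.

Lemma comb_coef c t : E (fun x => comb c x * e t x) = c t.
Proof.
rewrite (EE_ext _ (g := fun x => e t x * comb c x)); last by move=> x; rewrite mulrC.
rewrite E_comb// (bigD1 t)//= eo eqxx mulr1 big1 ?addr0// => s /negPf st.
by rewrite eo eq_sym st mulr0.
Qed.

Lemma comb_sqr c : n2 (comb c) = \sum_t c t ^+ 2.
Proof.
rewrite (EE_ext _ (g := fun x => comb c x * comb c x)); last by move=> x; rewrite expr2.
rewrite E_comb; last exact: bm_comb.
by apply: eq_bigr => t _; rewrite comb_coef expr2.
Qed.

(** Best approximation in quantitative form. It splits the error of a Galerkin solution into the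
    projection error of the limit and the coefficient error that the stability estimates control. *)
Lemma pythagoras (f : T -> R) c : bm f ->
  n2 (fun x => f x - comb c x) =
  n2 (fun x => f x - comb (fun t => E (fun y => f y * e t y)) x)
  + \sum_t (E (fun y => f y * e t y) - c t) ^+ 2.
Proof.
move=> bf; have bc := bm_comb.
have key b : n2 (fun x => f x - comb b x) =
    n2 f - 2 * (\sum_t b t * E (fun y => f y * e t y)) + \sum_t b t ^+ 2.
  rewrite -comb_sqr -E_comb// -EEZ; last by bm_tac.
  rewrite -EEB; try bm_tac.
  rewrite -EED; try bm_tac.
  by apply: EE_ext => x; ring.
have sq (u v : I -> R) : \sum_t (u t - v t) ^+ 2 =
    \sum_t u t ^+ 2 - 2 * (\sum_t v t * u t) + \sum_t v t ^+ 2.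
  rewrite mulr_sumr -sumrN -!big_split /=.
  by apply: eq_bigr => t _; ring.
pose h t := E (fun y => f y * e t y).
have hh : \sum_t h t * h t = \sum_t h t ^+ 2 by apply: eq_bigr => t _; rewrite expr2.
by rewrite !key sq -/h hh; ring.
Qed.

Lemma bessel_eq (f : T -> R) : bm f ->
  n2 (fun x => f x - comb (fun t => E (fun y => f y * e t y)) x) =
  n2 f - \sum_t E (fun y => f y * e t y) ^+ 2.
Proof.
move=> bf; have := pythagoras (fun=> 0) bf.
have -> : n2 (fun x => f x - comb (fun=> 0) x) = n2 f.
  apply: EE_ext => x; rewrite /comb big1 ?subr0// => t _.
  by rewrite mul0r.
under eq_bigr do rewrite subr0.
by move=> ->; rewrite addrK.
Qed.

Lemma bessel (f : T -> R) : bm f ->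
  \sum_t E (fun y => f y * e t y) ^+ 2 <= n2 f.
Proof.
by move=> bf; rewrite -subr_ge0 -bessel_eq//; exact: EE_sqr_ge0.
Qed.

Lemma lam1 t : 0 < 1 + lam t.
Proof. by rewrite ltr_wpDr. Qed.

(** The rough part of the solution is removed explicitly: [p] solves the equation with coefficient
    1, and [q = c - p] solves the original one with the right-hand side [(1 - A) * comb p], which is
    in L^2. Energy is used for [q] only, so [r] enters through the L^2 norm of [p], that is, through
    its H^{-2} norm. *)
Lemma stab_const (A : T -> R) (dl K : R) (c r : I -> R) :
  bm A -> 0 < dl -> (forall x, dl <= A x) -> (forall x, `|1 - A x| <= K) ->
  (forall t, lam t * c t + E (fun x => A x * comb c x * e t x) = r t) ->
  \sum_t c t ^+ 2 <= 2 * (1 + (K / dl) ^+ 2) * \sum_t r t ^+ 2 / (1 + lam t) ^+ 2.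
Proof.
move=> bA dl0 hA hK hc; have bc := bm_comb.
pose p t := r t / (1 + lam t); pose q t := c t - p t.
have lamp t := lam1 t.
have combE x : comb c x = comb p x + comb q x.
  by rewrite /comb -big_split; apply: eq_bigr => t _ /=; rewrite /q; ring.
have pE t : (1 + lam t) * p t = r t.
  by rewrite /p; field; rewrite gt_eqF.
have h1 t : lam t * q t + E (fun x => A x * comb q x * e t x)
    = E (fun x => (1 - A x) * comb p x * e t x).
  have -> : lam t * q t = (1 + lam t) * c t - r t - q t.
    by rewrite -pE /q; ring.
  rewrite -(comb_coef q t) -(hc t) -{1}(mul1r (c t)) mulrDl mul1r.
  rewrite -{1}(comb_coef c t).
  transitivity (E (fun x => comb c x * e t x) - E (fun x => A x * comb c x * e t x)
     - E (fun x => comb q x * e t x) + E (fun x => A x * comb q x * e t x)); first by ring.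
  rewrite -!EEB; try bm_tac.
  rewrite -EED; try bm_tac.
  by apply: EE_ext => x; rewrite combE; ring.
have h2 : \sum_t lam t * q t ^+ 2 + E (fun x => A x * comb q x * comb q x) =
          E (fun x => (1 - A x) * comb p x * comb q x).
  rewrite !E_comb; try bm_tac.
  rewrite -big_split /=; apply: eq_bigr => t _.
  by rewrite -h1; ring.
have q0 : 0 <= \sum_t lam t * q t ^+ 2.
  by apply: sumr_ge0 => t _; rewrite mulr_ge0// sqr_ge0.
have h3 : dl * n2 (comb q) <= E (fun x => A x * comb q x * comb q x).
  rewrite -EEZ; try bm_tac.
  apply: EE_le; try bm_tac.
  by have := ler_wpM2r (sqr_ge0 (comb q x)) (hA x); rewrite !expr2 [in X in _ <= X -> _]mulrA.
(* Young's inequality with weight [dl]: half of the coercive term of [h3] absorbs the part with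
   [comb q]. *)
have h4 : E (fun x => (1 - A x) * comb p x * comb q x) <=
     (2 * dl)^-1 * K ^+ 2 * n2 (comb p) + dl / 2 * n2 (comb q).
  rewrite -!EEZ; try bm_tac.
  rewrite -EED; try bm_tac.
  apply: EE_le; try bm_tac.
  set a := (1 - A x) * comb p x; set b := comb q x.
  have ha : a ^+ 2 <= K ^+ 2 * comb p x ^+ 2.
    rewrite /a exprMn ler_wpM2r ?sqr_ge0//.
    by rewrite -real_normK ?num_real// lerXn2r ?nnegrE// (le_trans _ (hK x)).
  have hab : a * b <= (2 * dl)^-1 * a ^+ 2 + dl / 2 * b ^+ 2.
    have -> : (2 * dl)^-1 * a ^+ 2 + dl / 2 * b ^+ 2 = a * b + (2 * dl)^-1 * (a - dl * b) ^+ 2.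
      by field; rewrite gt_eqF.
    by rewrite lerDl mulr_ge0 ?sqr_ge0// invr_ge0 mulr_ge0// ltW.
  apply: (le_trans hab); rewrite lerD2r -mulrA ler_wpM2l//.
  by rewrite invr_ge0 mulr_ge0// ltW.
have h5 : n2 (comb q) <= (K / dl) ^+ 2 * n2 (comb p).
  have h6 : dl / 2 * n2 (comb q) <= (2 * dl)^-1 * K ^+ 2 * n2 (comb p) by lra.
  have : (2 / dl) * (dl / 2 * n2 (comb q)) <= (2 / dl) * ((2 * dl)^-1 * K ^+ 2 * n2 (comb p)).
    by rewrite ler_wpM2l// divr_ge0// ltW.
  have -> : (2 / dl) * (dl / 2 * n2 (comb q)) = n2 (comb q) by field; rewrite gt_eqF.
  by have -> : (2 / dl) * ((2 * dl)^-1 * K ^+ 2 * n2 (comb p)) = (K / dl) ^+ 2 * n2 (comb p)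
    by field; rewrite gt_eqF.
have h7 : \sum_t r t ^+ 2 / (1 + lam t) ^+ 2 = n2 (comb p).
  by rewrite comb_sqr; apply: eq_bigr => t _; rewrite /p expr_div_n.
rewrite h7 -(comb_sqr c).
have -> : n2 (comb c) = n2 (fun x => comb p x + comb q x).
  by apply: EE_ext => x; rewrite combE.
by apply: (le_trans (EE_sqrD mu (bc p) (bc q))); lra.
Qed.

Lemma l1_coef (f g : T -> R) t : bm f -> bm g ->
  E (fun x => f x * g x * e t x) ^+ 2 <= 2 * n2 f * n2 g.
Proof.
move=> bf bg.
rewrite (EE_ext _ (g := fun x => f x * (g x * e t x))); last by move=> x; ring.
apply: (le_trans (EE_CS mu bf (bmM bg (be t)))).
rewrite mulrAC mulrC ler_wpM2r ?EE_sqr_ge0//.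
rewrite -EEZ; try bm_tac.
apply: EE_le; try bm_tac.
by rewrite exprMn mulrC ler_wpM2r// sqr_ge0.
Qed.

(** The embedding of L^1 into H^{-2} on the frequency side: coefficients of a product of two L^2
    functions are merely bounded, and [S] sums the weights. On the torus this is where the dimension
    restriction enters the deterministic estimates. *)
Lemma l1_sum (f g : T -> R) : bm f -> bm g ->
  \sum_t E (fun x => f x * g x * e t x) ^+ 2 / (1 + lam t) ^+ 2 <= 2 * S * n2 f * n2 g.
Proof.
move=> bf bg.
apply: (@le_trans _ _ (\sum_t (2 * n2 f * n2 g) * (1 + lam t) ^- 2)).
  apply: ler_sum => t _; rewrite ler_wpM2r ?l1_coef//.
  by rewrite invr_ge0 exprn_ge0// ltW// lam1.
rewrite -mulr_sumr mulrC.
have -> : 2 * S * n2 f * n2 g = S * (2 * n2 f * n2 g) by ring.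
by rewrite ler_wpM2r// !mulr_ge0// EE_sqr_ge0.
Qed.

(* Constants of the limit equation: [dl <= A] and [|1 - A| <= K]. *)
Variables (A : T -> R) (dl K : R).
Hypothesis bA : bm A.
Hypothesis dl0 : 0 < dl.
Hypothesis hA : forall x, dl <= A x.
Hypothesis hK : forall x, `|1 - A x| <= K.
Let C := 2 * (1 + (K / dl) ^+ 2).

Lemma C_ge0 : 0 <= C.
Proof. by rewrite mulr_ge0// addr_ge0// sqr_ge0. Qed.

(* The perturbation [a - A] is only small in L^2; it is absorbed because
   products of L^2 functions have bounded Fourier coefficients. *)
Lemma stab (a : T -> R) (c r : I -> R) : bm a ->
  8 * C * S * n2 (fun x => A x - a x) <= 1 ->
  (forall t, lam t * c t + E (fun x => a x * comb c x * e t x) = r t) ->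
  \sum_t c t ^+ 2 <= 4 * C * \sum_t r t ^+ 2 / (1 + lam t) ^+ 2.
Proof.
move=> ba hsmall hc; have bc := bm_comb; have C0 := C_ge0.
have h0 := @stab_const A dl K c
  (fun t => r t + E (fun x => (A x - a x) * comb c x * e t x)) bA dl0 hA hK.
have {h0} /h0 : forall t, lam t * c t + E (fun x => A x * comb c x * e t x) =
    r t + E (fun x => (A x - a x) * comb c x * e t x).
  move=> t; rewrite -hc -addrA; congr (_ + _).
  rewrite -EED; try bm_tac.
  by apply: EE_ext => x; ring.
rewrite -/C => h1.
have h2 : \sum_t (r t + E (fun x => (A x - a x) * comb c x * e t x)) ^+ 2 / (1 + lam t) ^+ 2
  <= 2 * (\sum_t r t ^+ 2 / (1 + lam t) ^+ 2)
   + 2 * \sum_t E (fun x => (A x - a x) * comb c x * e t x) ^+ 2 / (1 + lam t) ^+ 2.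
  rewrite !mulr_sumr -big_split /=; apply: ler_sum => t _.
  rewrite !mulrA -mulrDl ler_wpM2r//.
    by rewrite invr_ge0 exprn_ge0// ltW// lam1.
  by set u := E _; have := sqr_ge0 (r t - u); lra.
have h3 := @l1_sum (fun x => A x - a x) (comb c) (bmD bA (bmN ba)) (bc c).
rewrite comb_sqr in h3.
set X := \sum_t c t ^+ 2 in h1 h3 *.
set Y := \sum_t r t ^+ 2 / _ in h2 *.
set Z := \sum_t E _ ^+ 2 / _ in h2 h3.
set W := \sum_t _ in h1 h2.
have X0 : 0 <= X by apply: sumr_ge0 => t _; exact: sqr_ge0.
have h4 : C * W <= C * (2 * Y + 2 * Z) by rewrite ler_wpM2l.
have h5 : 2 * C * Z <= 2 * C * (2 * S * n2 (fun x => A x - a x) * X) by rewrite ler_wpM2l// mulr_ge0.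
have h6 : 8 * C * S * n2 (fun x => A x - a x) * X <= 1 * X by rewrite ler_wpM2r.
(* By the smallness assumption this is at most [X / 2], absorbed on the left; hence the constant
   [4 * C] in place of [2 * C]. *)
have : 2 * C * (2 * S * n2 (fun x => A x - a x) * X)
   = 2^-1 * (8 * C * S * n2 (fun x => A x - a x) * X) by field.
move=> h7; lra.
Qed.

(** The coefficient error [hU - c] solves the discrete equation with coefficient [a] and three
    right-hand sides: the data gap [b - F], the coefficient gap [(A - a) * U], and the truncation
    [a * (U - comb hU)]. Stability applies to their sum, and 12 is 4 times the 3 from squaring
    it. *)
Lemma galerkin_error (a U : T -> R) (c F : I -> R) : bm a -> bm U ->
  let hU t := E (fun x => U x * e t x) in
  let b t := lam t * hU t + E (fun x => A x * U x * e t x) in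
  8 * C * S * n2 (fun x => A x - a x) <= 1 ->
  (forall t, lam t * c t + E (fun x => a x * comb c x * e t x) = F t) ->
  \sum_t (hU t - c t) ^+ 2 <=
  12 * C * (\sum_t (b t - F t) ^+ 2 / (1 + lam t) ^+ 2
    + 2 * S * n2 (fun x => A x - a x) * n2 U
    + 2 * S * n2 a * n2 (fun x => U x - comb hU x)).
Proof.
move=> ba bU hU b hsmall hc; have bc := bm_comb; have C0 := C_ge0.
pose r t := b t - F t - E (fun x => (A x - a x) * U x * e t x)
  - E (fun x => a x * (U x - comb hU x) * e t x).
have combB x : comb (fun t => hU t - c t) x = comb hU x - comb c x.
  by rewrite /comb -sumrB; apply: eq_bigr => t _; ring.
have := @stab a (fun t => hU t - c t) r ba hsmall.
have /[swap] /[apply] : forall t, lam t * (hU t - c t) +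
   E (fun x => a x * comb (fun t => hU t - c t) x * e t x) = r t.
  move=> t; rewrite /r /b -hc.
  have -> : E (fun x => a x * comb (fun t => hU t - c t) x * e t x) =
     E (fun x => A x * U x * e t x) - E (fun x => a x * comb c x * e t x)
     - E (fun x => (A x - a x) * U x * e t x) - E (fun x => a x * (U x - comb hU x) * e t x).
    rewrite -!EEB; try bm_tac.
    by apply: EE_ext => x; rewrite combB; ring.
  by ring.
move=> /le_trans; apply.
have l1 := @l1_sum (fun x => A x - a x) U (bmD bA (bmN ba)) bU.
have l2 := @l1_sum a (fun x => U x - comb hU x) ba (bmD bU (bmN (bc hU))).
rewrite (_ : 12 * C = 4 * C * 3); last by ring.
rewrite -[X in _ <= X]mulrA; apply: ler_wpM2l; first by rewrite mulr_ge0.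
apply: (@le_trans _ _ (3 * (\sum_t (b t - F t) ^+ 2 / (1 + lam t) ^+ 2 +
  \sum_t E (fun x => (A x - a x) * U x * e t x) ^+ 2 / (1 + lam t) ^+ 2 +
  \sum_t E (fun x => a x * (U x - comb hU x) * e t x) ^+ 2 / (1 + lam t) ^+ 2))).
  rewrite -!big_split /= mulr_sumr; apply: ler_sum => t _.
  rewrite -!mulrDl mulrA ler_wpM2r//.
    by rewrite invr_ge0 exprn_ge0// ltW// lam1.
  rewrite /r; set u := E _; set v := E _; set w := b t - F t.
  have := sqr_ge0 (w + u); have := sqr_ge0 (w + v); have := sqr_ge0 (u - v).
  lra.
by rewrite ler_wpM2l//; lra.
Qed.

(** A bootstrap for the discrete Green function with pole [x]. Stability bounds [g] in l^2; moving
    the coefficient to the right, [(1 + lam t) * g t] is [e t x] plus a Fourier coefficient of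
    [(1 - a) * comb g], and both are bounded. *)
Lemma green_coef (a : T -> R) (g : I -> R) (x : T) : bm a ->
  8 * C * S * n2 (fun x => A x - a x) <= 1 ->
  (forall t, lam t * g t + E (fun y => a y * comb g y * e t y) = e t x) ->
  forall t, g t ^+ 2 <= 4 * (1 + n2 (fun y => 1 - a y) * (8 * C * S)) / (1 + lam t) ^+ 2.
Proof.
move=> ba hsmall hg t; have bc := bm_comb; have C0 := C_ge0.
have h1 : \sum_t g t ^+ 2 <= 8 * C * S.
  apply: (le_trans (stab ba hsmall hg)).
  have -> : 8 * C * S = 4 * C * (2 * S) by ring.
  apply: ler_wpM2l; first by rewrite mulr_ge0.
  apply: (@le_trans _ _ (2 * \sum_t (1 + lam t) ^- 2)); last by rewrite ler_wpM2l.
  rewrite mulr_sumr; apply: ler_sum => s _.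
  by rewrite ler_wpM2r// invr_ge0 exprn_ge0// ltW// lam1.
have h2 : (1 + lam t) * g t = e t x + E (fun y => (1 - a y) * comb g y * e t y).
  rewrite -hg mulrDl mul1r -{1}(comb_coef g t).
  transitivity (lam t * g t + (E (fun y => a y * comb g y * e t y) +
      (E (fun x => comb g x * e t x) - E (fun y => a y * comb g y * e t y)))); first by ring.
  rewrite -addrA; congr (_ + (_ + _)).
  rewrite -EEB; try bm_tac.
  by apply: EE_ext => y; ring.
have h3 := @l1_coef (fun y => 1 - a y) (comb g) t (bmD (bm_cst 1) (bmN ba)) (bc g).
rewrite comb_sqr in h3.
rewrite ler_pdivlMr ?exprn_gt0 ?lam1// mulrC -exprMn h2.
set u := E _ in h3 *.
have h4 : n2 (fun y => 1 - a y) * (\sum_t g t ^+ 2) <= n2 (fun y => 1 - a y) * (8 * C * S).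
  by rewrite ler_wpM2l// EE_sqr_ge0.
have := e2 t x; have := sqr_ge0 (e t x - u); lra.
Qed.


(* Frequency blocks of dyadic size: the sup norm of a block of [g] grows like
   [2 ^ j] and its L^2 norm decays like [2 ^ (- j / 2)], so that the
   interpolation [interp4] leaves a summable series. *)
Section blocks.
Variables (nb : nat) (lev : I -> nat) (m : T -> R) (G : R) (g : I -> R).
Hypothesis lev_lam : forall t, 4 ^+ lev t <= 1 + lam t.
Hypothesis lev_card : forall j : nat, (#|[pred t | lev t == j]| <= nb * 8 ^ j)%N.
Hypothesis bm_m : bm m.
Hypothesis g_bound : forall t, g t ^+ 2 <= G / (1 + lam t) ^+ 2.
Hypothesis G0 : 0 <= G.

Let blk (j : nat) t : R := if lev t == j then g t else 0.

Lemma g_level t : g t ^+ 2 <= G / 16 ^+ lev t.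
Proof.
apply: (le_trans (g_bound t)); rewrite ler_wpM2l//.
rewrite lef_pV2 ?posrE ?exprn_gt0 ?lam1//.
have -> : 16 = (4 ^+ 2 : R) by rewrite expr2 -natrM.
by rewrite -exprM mulnC exprM lerXn2r ?nnegrE ?exprn_ge0// ltW// lam1.
Qed.

Lemma blk_n2 j : n2 (comb (blk j)) <= nb%:R * G / 2 ^+ j.
Proof.
rewrite comb_sqr (bigID (fun t => lev t == j))/= [X in _ + X]big1 ?addr0; last first.
  by move=> t /negPf ht; rewrite /blk ht expr0n.
apply: (@le_trans _ _ (\sum_(t | lev t == j) G / 16 ^+ j)).
  by apply: ler_sum => t tj; rewrite /blk tj; have := g_level t; rewrite (eqP tj).
rewrite sumr_const -[X in X <= _]mulr_natl.
have -> : nb%:R * G / 2 ^+ j = (nb%:R * 8 ^+ j) * (G / 16 ^+ j).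
  have -> : 16 ^+ j = 8 ^+ j * 2 ^+ j :> R by rewrite -exprMn -natrM.
  by field; rewrite !expf_neq0.
apply: ler_wpM2r; first by rewrite divr_ge0// exprn_ge0.
by rewrite -natrX -natrM ler_nat lev_card.
Qed.

(** Cauchy-Schwarz over the frequencies of the block ([h] is that inequality for a filtered sum):
    their number enters twice, giving 64^j, against coefficients of square at most [G / 16 ^+ j]. *)
Lemma blk_sup j x : comb (blk j) x ^+ 2 <= 2 * nb%:R ^+ 2 * G * 4 ^+ j.
Proof.
have h (s : seq I) (Q : pred I) (F : I -> R) :
    (\sum_(i <- s | Q i) F i) ^+ 2 <= (count Q s)%:R * \sum_(i <- s | Q i) F i ^+ 2.
  elim: s => [|i s IH]; first by rewrite !big_nil expr0n mul0r.
  rewrite !big_cons /=; case: (Q i) => /=; rewrite ?add0n// natrD.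
  set A1 := \sum_(j <- s | Q j) F j in IH *.
  set B1 := \sum_(j <- s | Q j) F j ^+ 2 in IH *.
  set N := (count Q s)%:R in IH *.
  have N0 : 0 <= N :> R by [].
  have [N00|Nn] := eqVneq N 0.
    have A10 : A1 ^+ 2 <= 0 by rewrite N00 mul0r in IH.
    have A1E : A1 = 0 by apply/eqP; rewrite -sqrf_eq0 eq_le A10 sqr_ge0.
    rewrite N00 A1E !addr0 mul1r lerDl; apply: sumr_ge0 => *; exact: sqr_ge0.
  have Np : 0 < N by rewrite lt_def Nn.
  have B1N : A1 ^+ 2 / N <= B1 by rewrite ler_pdivrMr// mulrC.
  have : 2 * F i * A1 <= N * F i ^+ 2 + A1 ^+ 2 / N.
    have -> : N * F i ^+ 2 + A1 ^+ 2 / N = 2 * F i * A1 + (N * F i - A1) ^+ 2 / N.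
      by field.
    by rewrite lerDl divr_ge0// sqr_ge0.
  lra.
rewrite /comb (bigID (fun t => lev t == j))/= [X in _ + X]big1 ?addr0; last first.
  by move=> t /negPf ht; rewrite /blk ht mul0r.
apply: (le_trans (h _ _ _)).
apply: (@le_trans _ _ ((nb%:R * 8 ^+ j) * \sum_(t | lev t == j) (2 * (G / 16 ^+ j)))).
  apply: ler_pM => //.
  - by apply: sumr_ge0 => t _; exact: sqr_ge0.
  - rewrite -natrX -natrM ler_nat; apply: leq_trans (lev_card j).
    by rewrite -sum1_card -sum1_count.
  - apply: ler_sum => t tj; rewrite exprMn /blk tj mulrC.
    by apply: ler_pM; rewrite ?sqr_ge0//; have := g_level t; rewrite (eqP tj).
rewrite sumr_const -[X in _ * X <= _]mulr_natl.
have -> : 2 * nb%:R ^+ 2 * G * 4 ^+ j = (nb%:R * 8 ^+ j) * (nb%:R * 8 ^+ j) * (2 * (G / 16 ^+ j)).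
  have -> : 16 ^+ j = 4 ^+ j * 2 ^+ j * 2 ^+ j :> R by rewrite -!exprMn -!natrM.
  have -> : 8 ^+ j = 4 ^+ j * 2 ^+ j :> R by rewrite -exprMn -natrM.
  by field; rewrite !expf_neq0.
rewrite -!mulrA; apply: ler_wpM2l => //; apply: ler_wpM2l; first by rewrite exprn_ge0.
rewrite [X in _ <= X]mulrA; apply: ler_wpM2r; first by rewrite mulr_ge0// divr_ge0// exprn_ge0.
by rewrite -natrX -natrM ler_nat lev_card.
Qed.

(* Interpolating the factor f between L^2 and L^oo costs only a quarter
   power of the sup norm. *)
Lemma interp4 (f : T -> R) (B : R) : bm f -> (forall x, f x ^+ 2 <= B) ->
  n2 (fun x => m x * f x) ^+ 4 <= E (fun x => m x ^+ 8) * B * n2 f ^+ 3.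
Proof.
move=> bf hB.
have h1 : n2 (fun x => m x * f x) ^+ 2 <= E (fun x => m x ^+ 4 * f x ^+ 2) * n2 f.
  have := EE_CS mu (bmM (bmX 2 bm_m) bf) bf.
  rewrite (EE_ext _ (g := fun x => (m x * f x) ^+ 2)); last by move=> x; ring.
  by rewrite [X in _ <= X * _](EE_ext _ (g := fun x => m x ^+ 4 * f x ^+ 2))// => x; ring.
have h2 : E (fun x => m x ^+ 4 * f x ^+ 2) ^+ 2 <= E (fun x => m x ^+ 8) * (B * n2 f).
  have := EE_CS mu (bmX 4 bm_m) (bmX 2 bf).
  move=> /le_trans; apply.
  rewrite [X in X * _](EE_ext _ (g := fun x => m x ^+ 8)); last by move=> x; rewrite -exprM.
  apply: ler_wpM2l; first by apply: EE_ge0 => x; rewrite (_ : 8 = 4 * 2)%N// exprM sqr_ge0.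
  rewrite -EEZ; last by bm_tac.
  apply: EE_le; try bm_tac.
  by rewrite expr2 ler_wpM2r// sqr_ge0.
have f0 := EE_sqr_ge0 mu f.
rewrite (_ : 4 = 2 * 2)%N// exprM.
apply: (@le_trans _ _ ((E (fun x => m x ^+ 4 * f x ^+ 2) * n2 f) ^+ 2)).
  rewrite lerXn2r// ?nnegrE ?sqr_ge0// mulr_ge0//.
  by apply: EE_ge0 => x; rewrite (_ : 4 = 2 * 2)%N// exprM mulr_ge0 ?sqr_ge0.
rewrite exprMn.
have -> : E (fun x => m x ^+ 8) * B * n2 f ^+ 3 = E (fun x => m x ^+ 8) * (B * n2 f) * n2 f ^+ 2 by ring.
by rewrite ler_wpM2r// sqr_ge0.
Qed.

(** The eighth root of 1/2. By [interp4] the fourth power of the squared L^2 norm of [m] times block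
    [j] is of order 4^j 8^{-j} = 2^{-j}, so the squared norm decays like [th ^+ (2 * j)]; one factor
    [th ^+ j] pays for the weights in [green_mul], the other sums. *)
Let th : R := Num.sqrt (Num.sqrt (Num.sqrt (1 / 2))).

Lemma th_bound : 0 < th < 1.
Proof.
rewrite !sqrtr_gt0 divr_gt0//=.
have h (x : R) : 0 < x -> x < 1 -> Num.sqrt x < 1.
  by move=> x0 x1; rewrite -(sqrtr1 R) ltr_sqrt.
have a1 : 0 < 1 / 2 :> R by lra.
have b1 := h _ a1 ltac:(lra); have a2 := a1; rewrite -sqrtr_gt0 in a2.
have b2 := h _ a2 b1; have a3 := a2; rewrite -sqrtr_gt0 in a3.
exact: h _ a3 b2.
Qed.

Lemma th8 : th ^+ 8 = 1 / 2.
Proof.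
rewrite (_ : 8 = 2 * (2 * 2))%N// !exprM.
by rewrite !sqr_sqrtr// ?sqrtr_ge0 ?divr_ge0.
Qed.

Let Kc (X : R) : R := Num.sqrt (Num.sqrt (2 * nb%:R ^+ 5 * G ^+ 4 * X)).

Lemma blk_mul j (X : R) : E (fun x => m x ^+ 8) <= X ->
  n2 (fun x => m x * comb (blk j) x) <= Kc X * (th ^+ 2) ^+ j.
Proof.
move=> mX.
have X0 : 0 <= X by apply: le_trans mX; apply: EE_ge0 => x; rewrite (_ : 8 = 4 * 2)%N// exprM sqr_ge0.
have bb := bm_comb (blk j).
have h := interp4 bb (blk_sup j).
have th0 : 0 <= th by have /andP[/ltW] := th_bound.
have h2 : E (fun x => m x ^+ 8) * (2 * nb%:R ^+ 2 * G * 4 ^+ j) * n2 (comb (blk j)) ^+ 3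
    <= X * (2 * nb%:R ^+ 2 * G * 4 ^+ j) * (nb%:R * G / 2 ^+ j) ^+ 3.
  have p0 : 0 <= 2 * nb%:R ^+ 2 * G * 4 ^+ j by rewrite !mulr_ge0// exprn_ge0.
  apply: ler_pM.
  - rewrite mulr_ge0//; apply: EE_ge0 => x; by rewrite (_ : 8 = 4 * 2)%N// exprM sqr_ge0.
  - by rewrite exprn_ge0// EE_sqr_ge0.
  - by rewrite ler_wpM2r.
  - by rewrite lerXn2r// ?nnegrE ?EE_sqr_ge0 ?blk_n2// divr_ge0 ?mulr_ge0// exprn_ge0.
have K0 : 0 <= Kc X * (th ^+ 2) ^+ j by rewrite mulr_ge0 ?sqrtr_ge0// exprn_ge0// sqr_ge0.
rewrite -(@ler_pXn2r _ 4)// ?nnegrE ?EE_sqr_ge0//.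
apply: (le_trans h); apply: (le_trans h2).
have K4 : Kc X ^+ 4 = 2 * nb%:R ^+ 5 * G ^+ 4 * X.
  rewrite (_ : 4 = 2 * 2)%N// exprM !sqr_sqrtr// ?sqrtr_ge0//.
  by rewrite mulr_ge0// mulr_ge0// ?mulr_ge0 ?exprn_ge0.
have T4 : ((th ^+ 2) ^+ j) ^+ 4 = (2 ^+ j)^-1.
  rewrite -!exprM (_ : (2 * (j * 4))%N = (8 * j)%N); last by rewrite mulnCA mulnC.
  by rewrite exprM th8 div1r exprVn.
rewrite [X in _ <= X]exprMn K4 T4.
have -> : 4 ^+ j = 2 ^+ j * 2 ^+ j :> R by rewrite -exprMn -natrM.
rewrite le_eqVlt; apply/orP; left; apply/eqP; field.
by rewrite expf_neq0.
Qed.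

(** Cauchy-Schwarz over the blocks with weights [th ^+ j] ([wcs]) leaves two geometric sums of ratio
    [th], hence the square of [1 - th]. The number of blocks does not enter, which makes the bound
    uniform in the discretisation. *)
Lemma green_mul (X : R) : E (fun x => m x ^+ 8) <= X ->
  n2 (fun x => m x * comb g x) <= Kc X / (1 - th) ^+ 2.
Proof.
move=> mX.
have /andP[th0 th1] := th_bound.
have K0 : 0 <= Kc X by rewrite sqrtr_ge0.
pose L := (\max_t lev t).+1.
have combE x : comb g x = \sum_(j < L) comb (blk j) x.
  rewrite /comb exchange_big /=; apply: eq_bigr => t _.
  rewrite -mulr_suml; congr (_ * _).
  have tL : (lev t < L)%N by rewrite ltnS (leq_bigmax t).
  rewrite (bigD1 (Ordinal tL))//= /blk eqxx big1 ?addr0// => i /eqP it.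
  by case: eqP => // ti; case: it; exact: val_inj.
have geo n : \sum_(j < n) th ^+ j <= (1 - th)^-1.
  rewrite -[X in _ <= X]mul1r ler_pdivlMr ?subr_gt0// -[X in X <= _]opprK -mulrN opprB.
  by rewrite mulrC -subrX1 opprB gerBl exprn_ge0// ltW.
have wcs n (F : nat -> R) : (\sum_(j < n) F j) ^+ 2 <=
   (\sum_(j < n) th ^+ j) * (\sum_(j < n) (th ^+ j)^-1 * F j ^+ 2).
  elim: n => [|n IH]; first by rewrite !big_ord0 expr0n mul0r.
  rewrite !big_ord_recr /=.
  set A1 := \sum_(j < n) F j in IH *; set B1 := \sum_(j < n) (th ^+ j)^-1 * _ in IH *.
  set t := th ^+ n; set N := \sum_(j < n) _ in IH *.
  have t0 : 0 < t by rewrite exprn_gt0.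
  have N0 : 0 <= N by apply: sumr_ge0 => j _; rewrite exprn_ge0// ltW.
  have B0 : 0 <= B1 by apply: sumr_ge0 => j _; rewrite mulr_ge0 ?sqr_ge0// invr_ge0 exprn_ge0// ltW.
  have [N00|Nn] := eqVneq N 0.
    have A10 : A1 ^+ 2 <= 0 by rewrite N00 mul0r in IH.
    have A1E : A1 = 0 by apply/eqP; rewrite -sqrf_eq0 eq_le A10 sqr_ge0.
    rewrite N00 A1E !add0r mulrDr mulrA divff ?gt_eqF// mul1r lerDr.
    by rewrite mulr_ge0// ltW.
  have Np : 0 < N by rewrite lt_def Nn.
  have B1N : t * (A1 ^+ 2 / N) <= t * B1.
    by rewrite ler_wpM2l ?(ltW t0)// ler_pdivrMr// mulrC.
  have : 2 * F n * A1 <= N * (t^-1 * F n ^+ 2) + t * (A1 ^+ 2 / N).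
    have -> : N * (t^-1 * F n ^+ 2) + t * (A1 ^+ 2 / N) =
       2 * F n * A1 + (N * F n - t * A1) ^+ 2 / (N * t).
      by field; rewrite Nn gt_eqF.
    by rewrite lerDl divr_ge0 ?sqr_ge0// mulr_ge0// ltW.
  have : t * (t^-1 * F n ^+ 2) = F n ^+ 2 by rewrite mulrA divff ?gt_eqF// mul1r.
  lra.
have bb j := bm_comb (blk j).
apply: (@le_trans _ _ ((1 - th)^-1 * \sum_(j < L) (th ^+ j)^-1 * n2 (fun x => m x * comb (blk j) x))).
  rewrite (eq_bigr (fun j : 'I_L => E (fun x => (th ^+ j)^-1 * (m x * comb (blk j) x) ^+ 2)));
    last by move=> j _; rewrite EEZ//; have := bb j; bm_tac.
  rewrite -EE_sum; last by move=> j; have := bb j; bm_tac.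
  rewrite -EEZ; last by apply: bm_sum => j; have := bb j; bm_tac.
  apply: EE_le; try bm_tac.
  rewrite combE mulr_sumr.
  apply: (le_trans (wcs L (fun j => m x * comb (blk j) x))).
  by rewrite ler_wpM2r// sumr_ge0// => j _; rewrite mulr_ge0 ?sqr_ge0// invr_ge0 exprn_ge0// ltW.
rewrite expr2 invfM mulrA [X in _ <= X]mulrC.
apply: ler_wpM2l; first by rewrite invr_ge0 subr_ge0 ltW.
apply: (@le_trans _ _ (\sum_(j < L) Kc X * th ^+ j)).
  apply: ler_sum => j _; rewrite mulrC ler_pdivrMr ?exprn_gt0//.
  apply: (le_trans (blk_mul j mX)).
  by rewrite -mulrA ler_wpM2l// -exprM mulnC exprM expr2.
by rewrite -mulr_sumr ler_wpM2l.
Qed.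

End blocks.

End galerkin.

(** * The cube measure and the Fourier basis *)

Section cube_measure.
Context {R : realType}.

Definition cons_pair n (p : R * n.-tuple R) : n.+1.-tuple R := cons_tuple p.1 p.2.

Lemma measurable_cons_pair n : measurable_fun setT (@cons_pair n).
Proof.
have := @measurable_cons _ _ (R * n.-tuple R)%type R fst n snd
  measurable_fst measurable_snd.
by apply: eq_measurable_fun => -[t x] _; apply: val_inj.
Qed.

HB.instance Definition _ n :=
  isMeasurableFun.Build _ _ _ _ (@cons_pair n) (@measurable_cons_pair n).

(* [R] carries two convertible measurable structures with different displays;
   [idR] transports the library distributions to the canonical one. *)
Definition idR : measurableTypeR R -> R := fun x => x.

Lemma measurable_idR : measurable_fun setT idR.
Proof. by move=> _ Y mY; rewrite setTI. Qed.

HB.instance Definition _ := isMeasurableFun.Build _ _ _ _ idR measurable_idR.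

Definition unitP : probability R R :=
  distribution (uniform_prob (@ltr01 R) : probability (measurableTypeR R) R) idR.

(** The iterated integral [cube_int] of bounded measurable functions is integration against this
    measure ([cube_intE]); a genuine product probability gives access to Cauchy-Schwarz, dominated
    convergence and Fubini. *)
Fixpoint cubeP n : probability (n.-tuple R) R :=
  match n with
  | 0 => dirac [tuple]
  | n'.+1 => distribution (unitP \x cubeP n')%E (@cons_pair n')
  end.

Lemma unitP_int (F : R -> R) : bm F ->
  (\int[@lebesgue_measure R]_(t in `[0%R, 1%R]) (F t)%:E)%E = (EE unitP F)%:E.
Proof.
move=> [mF [M hM]].
have bF : bm F by split => //; exists M.
have lfin : (@lebesgue_measure R `[0%R, 1%R]%classic < +oo)%E.
  by rewrite lebesgue_measure_itv/= lte01 oppr0 adde0 ltry.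
have iF : (@lebesgue_measure R).-integrable `[0%R, 1%R] (EFin \o F).
  apply: measurable_bounded_integrable => //.
  - exact: measurable_funTS.
  - by exists M; split; [exact: num_real | move=> N /ltW MN x _; exact: le_trans (hM x) MN].
have iM : (@lebesgue_measure R).-integrable `[0%R, 1%R] (EFin \o (fun=> M)).
  apply: measurable_bounded_integrable => //.
  - by exists `|M|; split; [exact: num_real | move=> N /ltW MN x _].
(* Transfer of integrals to the uniform law is for nonnegative functions: [F + M] is nonnegative,
   and the constant [M] is cancelled afterwards. *)
have := @integral_uniform R 0 1 ltr01 (EFin \o (fun x => F x + M)).
rewrite subr0 invr1 mul1e => h.
have {h} : (\int[unitP]_x (F x + M)%:E = \int[@lebesgue_measure R]_(x in `[0%R, 1%R]) (F x + M)%:E)%E.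
  have mFM : measurable_fun setT (EFin \o (fun x : R => F x + M)).
    by apply/measurable_EFinP; apply: measurable_funD.
  have FM0 x : (0 <= (F x + M)%:E)%E.
    rewrite lee_fin -[M]opprK subr_ge0.
    by have := hM x; rewrite ler_norml => /andP[].
  by rewrite ge0_integral_distribution//; exact: h.
have bM := @bm_cst R _ R M.
rewrite EE_EFin; last exact: bmD.
rewrite EED// EE_cst.
under [X in _ = X -> _]eq_integral do rewrite EFinD.
rewrite integralD//=.
have -> : (\int[@lebesgue_measure R]_(x in `[0%R, 1%R]) M%:E = M%:E)%E.
  by rewrite integral_cst//= lebesgue_measure_itv/= lte01 oppr0 adde0 mule1.
have : (\int[@lebesgue_measure R]_(x in `[0%R, 1%R]) (F x)%:E)%E \is a fin_num.
  by apply: integrable_fin_num => //; exact: iF.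
case: (\int[_]_(_ in _) _)%E => // r _ [] /addIr ->.
by [].
Qed.

Lemma bm_cons n (f : n.+1.-tuple R -> R) t : bm f -> bm (fun x => f (cons_tuple t x)).
Proof.
move=> [mf [M hM]]; split; last by exists M => x.
have mc : measurable_fun setT (fun x : n.-tuple R => cons_pair (t, x)).
  by apply: (measurableT_comp (@measurable_cons_pair n)); exact: measurable_fun_pair.
exact: (measurableT_comp mf mc).
Qed.

Lemma bm_slice d1 d2 (T1 : measurableType d1) (T2 : measurableType d2)
    (P1 : probability T1 R) (P2 : probability T2 R) (g : T1 * T2 -> R) : bm g ->
  bm (fun t => EE P2 (fun x => g (t, x))) /\
  EE (P1 \x P2)%E g = EE P1 (fun t => EE P2 (fun x => g (t, x))).
Proof.
move=> [mg [M hM]].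
have bg : bm g by split => //; exists M.
have bgs t : bm (fun x => g (t, x)).
  split; last by exists M => x.
  by apply: (measurableT_comp mg); exact: measurable_fun_pair.
have ig := bm_integrable (P1 \x P2)%E bg.
have mF := measurable_fubini_F ig.
have bF : bm (fun t => EE P2 (fun x => g (t, x))).
  split.
    have := measurableT_comp (fine_measurable measurableT) mF.
    by apply: eq_measurable_fun.
  exists M => t.
  have -> : EE P2 (fun x => g (t, x)) = EE P2 (fun x => g (t, x)) - 0 by rewrite subr0.
  rewrite subr0 ler_norml; apply/andP; split.
    rewrite -[X in X <= _](EE_cst P2); apply: EE_le => //; first exact: bm_cst.
    by move=> x; have := hM (t, x); rewrite ler_norml => /andP[].
  rewrite -[X in _ <= X](EE_cst P2); apply: EE_le => //; first exact: bm_cst.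
  by move=> x; have := hM (t, x); rewrite ler_norml => /andP[].
split => //.
apply: EFin_inj; rewrite -!EE_EFin// -(integral12_prod_meas1 ig).
by apply: eq_integral => t _ /=; rewrite -EE_EFin.
Qed.

Lemma EE_cons n (f : n.+1.-tuple R -> R) : bm f ->
  bm (fun t => EE (cubeP n) (fun x => f (cons_tuple t x))) /\
  EE (cubeP n.+1) f = EE unitP (fun t => EE (cubeP n) (fun x => f (cons_tuple t x))).
Proof.
move=> bf; have [mf [M hM]] := bf.
have bg : bm (f \o @cons_pair n).
  split; last by exists M => x; exact: hM.
  by apply: measurableT_comp => //; exact: measurable_cons_pair.
have [h1 h2] := bm_slice unitP (cubeP n) bg; split => //.
rewrite -h2; congr fine => /=.
rewrite [LHS]integral_pushforward ?preimage_setT//=.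
- exact/measurable_EFinP.
- by have := bm_integrable (unitP \x cubeP n)%E bg.
Qed.

Lemma cube_intE n (f : n.-tuple R -> R) : bm f ->
  cube_int (fun x => (f x)%:E) = (EE (cubeP n) f)%:E.
Proof.
elim: n f => [|n IH] f bf /=.
  rewrite -EE_EFin//= integral_dirac//; last by apply/measurable_EFinP; case: bf.
  by rewrite diracT mul1e.
have [h1 h2] := EE_cons bf.
rewrite -[in RHS]/(cubeP n.+1) h2 -unitP_int//.
by apply: eq_integral => t _; apply: IH; exact: bm_cons.
Qed.

End cube_measure.

(** * Shifted cosines and orthonormality of the basis *)

Section trig.
Context {R : realType}.

Lemma trig_int (x : R) (z : int) :
  cos (x + 2 * pi * z%:~R) = cos x /\ sin (x + 2 * pi * z%:~R) = sin x.
Proof.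
have h (n : nat) y : cos (y + 2 * pi * n%:R) = cos y /\ sin (y + 2 * pi * n%:R) = sin y :> R.
  have -> : 2 * pi * n%:R = (pi *+ 2) *+ n :> R.
    by rewrite -[RHS]mulr_natr -[pi *+ 2]mulr_natr; ring.
  by rewrite (periodicn (@cosD2pi R)) (periodicn (@sinD2pi R)).
case: z => n; first exact: h.
rewrite NegzE mulrNz mulrN.
have [h1 h2] := h n.+1 (x - 2 * pi * n.+1%:R).
by rewrite subrK in h1 h2.
Qed.

Definition freq d (m : 'I_d -> int) (x : d.-tuple R) : R :=
  \sum_(j < d) (m j)%:~R * tnth x j.

(** With a free phase one family contains all sines and cosines, and by [tcosM] products stay in its
    span. *)
Definition tcos d (m : 'I_d -> int) (th : R) (x : d.-tuple R) : R :=
  cos (2 * pi * freq m x + th).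

Lemma measurable_freq d (m : 'I_d -> int) : measurable_fun setT (freq m).
Proof.
apply: measurable_sum => j; apply: measurable_funM => //.
exact: measurable_tnth.
Qed.

Lemma bm_tcos d (m : 'I_d -> int) th : bm (tcos m th).
Proof.
split; last by exists 1 => x; exact: cos_max.
apply: measurableT_comp; first by apply: continuous_measurable_fun; exact: continuous_cos.
apply: measurable_funD => //; apply: measurable_funM => //.
exact: measurable_freq.
Qed.

Lemma EE_unit_cos (a : int) (th : R) :
  EE unitP (fun t : R => cos (2 * pi * (a%:~R * t) + th)) = if a == 0 then cos th else 0.
Proof.
case: eqP => [->|/eqP a0].
  rewrite -[RHS](EE_cst (@unitP R)); apply: EE_ext => t.
  by rewrite mul0r mulr0 add0r.
have b0 : 2 * pi * a%:~R != 0 :> R.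
  by rewrite !mulf_neq0// ?intr_eq0// gt_eqF// pi_gt0.
set b := 2 * pi * a%:~R in b0 *.
pose F (t : R) := b^-1 * sin (b * t + th).
have dF t : is_derive (t : R) (1 : R) F (cos (b * t + th)).
  have d1 : is_derive (t : R) (1 : R) (fun t : R => b * t + th) b.
    apply: is_derive_eq; by rewrite addr0 scaler1.
  have d2 := @is_derive1_comp R sin (fun t : R => b * t + th) t _ _ (is_derive_sin (b * t + th)) d1.
  have := is_deriveZ b^-1 d2.
  by move=> /is_derive_eq; apply; rewrite /GRing.scale/= mulrCA mulVf// mulr1.
have bf : bm (fun t : R => cos (2 * pi * (a%:~R * t) + th)).
  split; last by exists 1 => x; exact: cos_max.
  apply: measurableT_comp; first by apply: continuous_measurable_fun; exact: continuous_cos.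
  apply: measurable_funD => //; apply: measurable_funM => //.
apply: EFin_inj; rewrite -unitP_int//.
rewrite (@continuous_FTC2 _ _ F)//.
- rewrite /F mulr0 add0r mulr1.
  have [_ h] := trig_int th a.
  by rewrite (addrC b) /b h -EFinB subrr.
- apply: continuous_subspaceT => t.
  apply: continuous_comp; last exact: continuous_cos.
  apply: cvgD; last exact: cvg_cst.
  apply: cvgM; first exact: cvg_cst.
  by apply: cvgM; [exact: cvg_cst | exact: cvg_id].
- have cF : continuous F.
    by move=> t; apply/differentiable_continuous/derivable1_diffP; case: (dF t).
  split.
  + by move=> t _; case: (dF t).
  + by apply: cvg_at_right_filter; exact: cF.
  + by apply: cvg_at_left_filter; exact: cF.
- by move=> t _; rewrite derive1E; case: (dF t) => _ ->; rewrite /b mulrA.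
Qed.

(** Induction on the dimension: for a fixed first coordinate its contribution is absorbed into the
    phase, and the induction hypothesis integrates the others. *)
Lemma EE_tcos d (m : 'I_d -> int) (th : R) :
  EE (cubeP d) (tcos m th) = if [forall j, m j == 0] then cos th else 0.
Proof.
elim: d m th => [|d IH] m th.
  have -> : [forall j, m j == 0] by apply/forallP => -[].
  rewrite -[RHS](EE_cst (cubeP 0)); apply: EE_ext => x.
  by rewrite /tcos /freq big_ord0 mulr0 add0r.
rewrite (EE_cons (bm_tcos m th)).2.
have h t : EE (cubeP d) (fun x => tcos m th (cons_tuple t x)) =
    if [forall j, m (lift ord0 j) == 0] then cos (2 * pi * ((m ord0)%:~R * t) + th) else 0.
  rewrite -IH; apply: EE_ext => x; rewrite /tcos /freq big_ord_recl/= tnth0.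
  have -> : \sum_(i < d) (m (lift ord0 i))%:~R * tnth (cons_tuple t x) (lift ord0 i) =
      \sum_(j < d) (m (lift ord0 j))%:~R * tnth x j.
    by apply: eq_bigr => j _; rewrite tnthS.
  by congr cos; ring.
rewrite (EE_ext _ h).
have -> : [forall j, m j == 0] = (m ord0 == 0) && [forall j, m (lift ord0 j) == 0].
  apply/forallP/andP => [H|[H0 /forallP H] j]; first by split => //; apply/forallP.
  by case: (unliftP ord0 j) => [k ->|->].
case: forallP => H; last by rewrite andbF EE_cst.
by rewrite andbT EE_unit_cos.
Qed.

Lemma tcosM d (m m' : 'I_d -> int) th th' (x : d.-tuple R) :
  tcos m th x * tcos m' th' x =
  2^-1 * (tcos (fun j => m j + m' j) (th + th') x + tcos (fun j => m j - m' j) (th - th') x).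
Proof.
have fD : freq (fun j => m j + m' j) x = freq m x + freq m' x.
  by rewrite /freq -big_split; apply: eq_bigr => j _; rewrite intrD mulrDl.
have fB : freq (fun j => m j - m' j) x = freq m x - freq m' x.
  by rewrite /freq -sumrB; apply: eq_bigr => j _; rewrite intrB mulrBl.
rewrite /tcos fD fB.
have -> : 2 * pi * (freq m x + freq m' x) + (th + th') =
  (2 * pi * freq m x + th) + (2 * pi * freq m' x + th') by ring.
have -> : 2 * pi * (freq m x - freq m' x) + (th - th') =
  (2 * pi * freq m x + th) - (2 * pi * freq m' x + th') by ring.
by rewrite (cosD (_ + _)) (cosB (_ + _)); field.
Qed.

Section fourier_basis.
Variable d : nat.
Implicit Types k l : d.-tuple int.

Definition kzero k : bool := all (fun z => z == 0) k.

Lemma kzeroP k : reflect (forall j, tnth k j = 0) (kzero k).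
Proof.
apply: (iffP allP) => [h j|h z /tnthP[j ->]]; last by rewrite h.
by apply/eqP/h/mem_tnth.
Qed.

Definition kneg k : d.-tuple int := [tuple - tnth k j | j < d].

(** For nonzero k exactly one of k and - k is lexicographically positive, so each such pair carries
    one cosine and one sine. *)
Lemma pos_lexN (s s' : seq int) : size s = size s' ->
  (forall j, nth 0 s j = - nth 0 s' j) -> ~~ all (fun z => z == 0) s ->
  pos_lex s' = ~~ pos_lex s.
Proof.
elim: s s' => [|a s IH] [|b s']//= [ss] h.
have := h 0%N; rewrite /= => ->; rewrite oppr_eq0.
have [b0|b0] := eqVneq b 0.
  by move=> /= hs; apply: IH => // j; exact: (h j.+1).
by move=> _; rewrite oppr_gt0 -leNgt le_eqVlt eq_sym (negbTE b0).
Qed.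

Definition Fe k (x : d.-tuple R) : R := fourier k (fromT x).

(** Since sin y = cos (y - pi/2), an amplitude and a phase turn the three cases of [fourier] into
    one shifted cosine. *)
Definition Fphase k : R := if kzero k || pos_lex k then 0 else - (pi / 2).
Definition Famp k : R := if kzero k then 1 else Num.sqrt 2.

Lemma kdot_fromT k x : kdot k (fromT x) = freq (tnth k) x :> R.
Proof. by apply: eq_bigr => j _; rewrite mxE. Qed.

Lemma FeE k x : Fe k x = Famp k * tcos (tnth k) (Fphase k) x.
Proof.
rewrite /Fe /fourier /Famp /Fphase /tcos -kdot_fromT -/(kzero k).
case: kzeroP => [h|h]/=.
  rewrite addr0 kdot_fromT /freq big1 ?mulr0 ?cos0 ?mulr1// => j _.
  by rewrite h mul0r.
by case: ifP => _; rewrite ?addr0//; rewrite cosBpihalf.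
Qed.

Lemma bm_Fe k : bm (Fe k).
Proof.
rewrite (_ : Fe k = fun x => Famp k * tcos (tnth k) (Fphase k) x).
  by apply: bmM; [exact: bm_cst | exact: bm_tcos].
by apply/funext => x; exact: FeE.
Qed.

Lemma Famp2 k : Famp k ^+ 2 = if kzero k then 1 else 2.
Proof. by rewrite /Famp; case: ifP => _; rewrite ?expr1n// sqr_sqrtr. Qed.

Lemma Fe2 k x : Fe k x ^+ 2 <= 2.
Proof.
rewrite FeE exprMn Famp2.
have : tcos (tnth k) (Fphase k) x ^+ 2 <= 1.
  by rewrite -real_normK ?num_real// expr_le1// cos_max.
by have := sqr_ge0 (tcos (tnth k) (Fphase k) x); case: ifP => _; lra.
Qed.

(** Product-to-sum leaves the frequencies k + l and k - l. The second vanishes on the diagonal only.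
    If k + l = 0 with k nonzero, one factor is a cosine and the other a sine, and the phases
    contribute cos (- pi/2) = 0. *)
Lemma Fe_ortho k l : EE (cubeP d) (fun x => Fe k x * Fe l x) = (k == l)%:R.
Proof.
pose t1 := tcos (fun j => tnth k j + tnth l j) (Fphase k + Fphase l).
pose t2 := tcos (fun j => tnth k j - tnth l j) (Fphase k - Fphase l).
have -> : EE (cubeP d) (fun x => Fe k x * Fe l x) =
    (Famp k * Famp l / 2) * (EE (cubeP d) t1 + EE (cubeP d) t2).
  have b1 : bm t1 by exact: bm_tcos.
  have b2 : bm t2 by exact: bm_tcos.
  rewrite -EED// -EEZ; last exact: bmD.
  by apply: EE_ext => x; rewrite !FeE mulrACA tcosM mulrA.
rewrite !EE_tcos.
have e2 : [forall j, tnth k j - tnth l j == 0] = (k == l).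
  apply/forallP/eqP => [h|-> j]; last by rewrite subrr.
  by apply: eq_from_tnth => j; apply/eqP; rewrite -subr_eq0.
rewrite e2; case: forallP => h1; last first.
  rewrite add0r; case: eqP => [kl|_]; last by rewrite mulr0.
  rewrite kl subrr cos0 mulr1 -expr2 Famp2; case: kzeroP => [hl|_]; last by rewrite divff.
  by exfalso; apply: h1 => j; rewrite kl hl addr0.
have kl j : tnth k j = - tnth l j by apply/eqP; rewrite -addr_eq0.
case: (boolP (kzero k)) => [/kzeroP k0|k0].
  have l0 j : tnth l j = 0 by rewrite -[LHS]opprK -kl k0 oppr0.
  have -> : (k == l) by apply/eqP/eq_from_tnth => j; rewrite k0 l0.
  have zk : kzero k by apply/kzeroP.
  have zl : kzero l by apply/kzeroP.
  by rewrite /Fphase /Famp zk zl/= subr0 addr0 cos0; field.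
have nl : kzero l = false.
  apply/negP => /kzeroP hl; move/negP: k0; apply; apply/kzeroP => j.
  by rewrite kl hl oppr0.
have pl : pos_lex l = ~~ pos_lex k.
  apply: pos_lexN; rewrite ?size_tuple// => j.
  have [jd|dj] := ltnP j d.
    by have := kl (Ordinal jd); rewrite !(tnth_nth 0).
  by rewrite !nth_default ?size_tuple// oppr0.
have -> : (k == l) = false by apply/negP => /eqP klE; rewrite klE in pl; case: pos_lex pl.
rewrite addr0 /Fphase (negbTE k0) nl/= pl; case: pos_lex => /=.
  by rewrite add0r cosN cos_pihalf mulr0.
by rewrite addr0 cosN cos_pihalf mulr0.
Qed.

End fourier_basis.
End trig.

Section continuity.
Context {R : realType} {V : topologicalType}.
Implicit Types f g : V -> R.

Lemma continuous_add f g : continuous f -> continuous g -> continuous (fun x => f x + g x).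
Proof. by move=> cf cg x; apply: cvgD; [exact: cf | exact: cg]. Qed.

Lemma continuous_scale (c : R) f : continuous f -> continuous (fun x => c * f x).
Proof. by move=> cf x; apply: cvgM; [exact: cvg_cst | exact: cf]. Qed.

End continuity.

(** * Derivatives of the basis functions, and inner products as means over the cube *)

Section fourier_calculus.
Context {R : realType} {d : nat}.
Implicit Types (k l : d.-tuple int) (x : 'rV[R]_d).

Lemma knegK k : kneg (kneg k) = k.
Proof. by apply: eq_from_tnth => j; rewrite !tnth_mktuple opprK. Qed.

Lemma tnth_kneg k j : tnth (kneg k) j = - tnth k j.
Proof. by rewrite tnth_mktuple. Qed.

Lemma kdot_shift k x j (h : R) : kdot k (h *: 'e_j + x) = kdot k x + h * (tnth k j)%:~R.
Proof.
rewrite /kdot addrC (bigD1 j)//= [in RHS](bigD1 j)//= !mxE !eqxx mulr1.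
rewrite -addrA [in LHS](eq_bigr (fun i => (tnth k i)%:~R * x 0 i)); last first.
  by move=> i /negPf ij; rewrite !mxE eqxx ij/= mulr0 addr0.
by rewrite mulrDr; ring.
Qed.

(** Along the direction ['e_j] the phase is affine, so the difference quotient is that of the
    one-variable function [phi] at 0 (equation [E]). *)
Lemma dir_derive (g : R -> R) k x (j : 'I_d) (dg : R) :
  is_derive (2 * pi * kdot k x) (1 : R) g dg ->
  is_derive x 'e_j (fun y => g (2 * pi * kdot k y)) (2 * pi * (tnth k j)%:~R * dg).
Proof.
move=> hg.
pose b : R := 2 * pi * (tnth k j)%:~R.
pose phi (h : R) := g (b * h + 2 * pi * kdot k x).
have d1 : is_derive (0 : R) (1 : R) (fun h : R => b * h + 2 * pi * kdot k x) b.
  by apply: is_derive_eq; rewrite addr0 scaler1.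
have hg' : is_derive ((fun h : R => b * h + 2 * pi * kdot k x) 0) 1 g dg.
  by rewrite /= mulr0 add0r.
have [p1 p2] := @is_derive1_comp R g (fun h : R => b * h + 2 * pi * kdot k x) 0 _ _ hg' d1.
have E : (fun h => h^-1 *: (((fun y => g (2 * pi * kdot k y)) \o shift x) (h *: 'e_j)
            - g (2 * pi * kdot k x))) =
         (fun h => h^-1 *: ((phi \o shift 0) (h *: 1) - phi 0)).
  apply/funext => h /=; congr (_ *: (g _ - g _)).
    by rewrite kdot_shift addr0 /b /GRing.scale/= mulr1; ring.
  by rewrite mulr0 add0r.
split; first by rewrite /derivable E.
by rewrite /derive E mulrC; exact: p2.
Qed.

Lemma fourierE k x :
  fourier k x = Famp k * cos (2 * pi * kdot k x + Fphase k) :> R.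
Proof.
rewrite /fourier /Famp /Fphase -/(kzero k).
case: kzeroP => [h|h]/=.
  rewrite addr0 /kdot big1 ?mulr0 ?cos0 ?mulr1// => j _.
  by rewrite h mul0r.
by case: ifP => _; rewrite ?addr0//; rewrite cosBpihalf.
Qed.

Lemma kzeroN k : kzero (kneg k) = kzero k.
Proof.
apply/kzeroP/kzeroP => h j; last by rewrite tnth_kneg h oppr0.
by have := h j; rewrite tnth_kneg => /eqP; rewrite oppr_eq0 => /eqP.
Qed.

(** Differentiation exchanges cosine and sine at the same frequency, which in this enumeration is
    the passage from [k] to [kneg k]. The minus sign from the cosine is absorbed by the oddness of
    the sine at [kneg k], so one formula covers both cases. *)
Lemma is_derive_fourier k x (j : 'I_d) :
  is_derive x 'e_j (fourier k) (2 * pi * (tnth k j)%:~R * fourier (kneg k) x : R).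
Proof.
have -> : fourier k = (fun y => (fun s => Famp k * cos (s + Fphase k)) (2 * pi * kdot k y)) :> ('rV[R]_d -> R).
  by apply/funext => y; rewrite fourierE.
set s := 2 * pi * kdot k x.
have d1 : is_derive (s : R) (1 : R) (fun t : R => t + Fphase k) 1.
  by apply: is_derive_eq; rewrite addr0.
have d2 := @is_derive1_comp R cos (fun t : R => t + Fphase k) s _ _
  (is_derive_cos (s + Fphase k)) d1.
have d3 := is_deriveZ (Famp k) d2.
have /(dir_derive j) d4 : is_derive s (1 : R) (fun s => Famp k * cos (s + Fphase k))
    (- Famp k * sin (s + Fphase k)).
  by move: d3 => /is_derive_eq; apply; rewrite /GRing.scale/=; ring.
move: d4 => /is_derive_eq; apply.
rewrite fourierE.
have -> : kdot (kneg k) x = - kdot k x.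
  by rewrite /kdot -sumrN; apply: eq_bigr => i _; rewrite tnth_kneg mulrNz mulNr.
rewrite mulrN -/s /Famp /Fphase kzeroN.
case: (boolP (kzero k)) => [/kzeroP ->|k0]/=; first by rewrite mulr0z mulr0 !mul0r.
have -> : pos_lex (kneg k) = ~~ pos_lex k.
  apply: pos_lexN; rewrite ?size_tuple// => i.
  have [id|di] := ltnP i d; last by rewrite !nth_default ?size_tuple// oppr0.
  by rewrite -[i]/(val (Ordinal id)) -!tnth_nth tnth_kneg opprK.
case: (pos_lex k) => /=.
  by rewrite addr0 -opprD cosN cosDpihalf; ring.
by rewrite addr0 cosN sinBpihalf; ring.
Qed.

Lemma dpart_fourier k (j : 'I_d) :
  dpart j (fourier k) = (fun x => 2 * pi * (tnth k j)%:~R * fourier (kneg k) x : R).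
Proof. by apply/funext => x; have [_] := is_derive_fourier k x j. Qed.

Lemma is_derive_fourierZ (c : R) k x (j : 'I_d) :
  is_derive x 'e_j (fun y => c * fourier k y) (c * (2 * pi * (tnth k j)%:~R * fourier (kneg k) x)).
Proof. exact: is_deriveZ (is_derive_fourier k x j). Qed.

Lemma is_derive_fourier_sum (I : Type) (s : seq I) (c : I -> R) (K : I -> d.-tuple int) x (j : 'I_d) :
  is_derive x 'e_j (fun y => \sum_(i <- s) c i * fourier (K i) y)
   (\sum_(i <- s) c i * (2 * pi * (tnth (K i) j)%:~R * fourier (kneg (K i)) x)).
Proof.
elim: s => [|i s IH].
  rewrite big_nil.
  rewrite (_ : (fun y => _) = cst 0); first exact: is_derive_cst.
  by apply/funext => y; rewrite big_nil.
rewrite big_cons.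
rewrite (_ : (fun y => _) = (fun y => c i * fourier (K i) y) \+
    (fun y => \sum_(i <- s) c i * fourier (K i) y)); last first.
  by apply/funext => y; rewrite big_cons.
exact: is_deriveD (is_derive_fourierZ _ _ _ _) IH.
Qed.

Lemma continuous_fourier k : continuous (fourier k : 'rV[R]_d -> R).
Proof.
rewrite (_ : fourier k = fun x => Famp k * cos (2 * pi * kdot k x + Fphase k)); last first.
  by apply/funext => x; exact: fourierE.
have ck : continuous (kdot k : 'rV[R]_d -> R).
  rewrite (_ : kdot k = fun x => \sum_(j < d) (tnth k j)%:~R * x 0 j)//.
  elim: (index_enum _) => [|j s IH].
    rewrite (_ : (fun x => _) = fun=> 0); first exact: cst_continuous.
    by apply/funext => x; rewrite big_nil.
  rewrite (_ : (fun x => _) = fun x : 'rV[R]_d =>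
      (tnth k j)%:~R * x 0 j + \sum_(j <- s) (tnth k j)%:~R * x 0 j); last first.
    by apply/funext => x; rewrite big_cons.
  apply: continuous_add => //; apply: continuous_scale => x.
  exact: coord_continuous.
apply: continuous_scale => x.
apply: (@continuous_comp _ _ _ (fun x => 2 * pi * kdot k x + Fphase k) cos); last exact: continuous_cos.
apply: (continuous_add (continuous_scale ck)).
exact: cst_continuous.
Qed.

Lemma continuous_fourierZ c k : continuous ((fun x => c * fourier k x) : 'rV[R]_d -> R).
Proof.
by apply: continuous_scale; exact: continuous_fourier.
Qed.

Definition lamk k : R := 4 * pi ^+ 2 * \sum_(j < d) (tnth k j)%:~R ^+ 2.

Lemma lamk_ge0 k : 0 <= lamk k.
Proof. apply: mulr_ge0; first by rewrite mulr_ge0// sqr_ge0.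
by apply: sumr_ge0 => j _; exact: sqr_ge0. Qed.

Lemma dpart_dpart k (i j : 'I_d) : dpart i (dpart j (fourier k)) =
  (fun x => - (4 * pi ^+ 2 * (tnth k j)%:~R * (tnth k i)%:~R * fourier k x) : R).
Proof.
apply/funext => x; rewrite dpart_fourier.
have [_ h] := is_derive_fourierZ (2 * pi * (tnth k j)%:~R) (kneg k) x i.
by rewrite /dpart; apply: (etrans h); rewrite knegK tnth_kneg mulrNz; ring.
Qed.

Lemma lap_fourier k : lap (fourier k) = (fun x => - lamk k * fourier k x : R).
Proof.
apply/funext => x; rewrite /lap /lamk mulr_sumr -sumrN mulr_suml.
by apply: eq_bigr => j _; rewrite dpart_dpart; ring.
Qed.

Lemma C2_fourier k : C2_torus (fourier k : 'rV[R]_d -> R).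
Proof.
split.
- move=> x j; rewrite !fourierE -[x + _]addrC -['e_j]scale1r kdot_shift mul1r.
  have -> : 2 * pi * (kdot k x + (tnth k j)%:~R) + Fphase k =
     2 * pi * kdot k x + Fphase k + 2 * pi * (tnth k j)%:~R by ring.
  by have [-> _] := trig_int (2 * pi * kdot k x + Fphase k) (tnth k j).
- exact: continuous_fourier.
- split => [j x|j]; first by case: (is_derive_fourier k x j).
  by rewrite dpart_fourier; exact: continuous_fourierZ.
- move=> j i x; rewrite dpart_fourier.
  by case: (is_derive_fourierZ (2 * pi * (tnth k i)%:~R) (kneg k) x j).
- move=> j i; rewrite dpart_dpart.
  rewrite (_ : (fun x => _) = fun x =>
     (- (4 * pi ^+ 2 * (tnth k i)%:~R * (tnth k j)%:~R)) * fourier k x); last first.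
    by apply/funext => x; rewrite mulNr.
  exact: continuous_fourierZ.
Qed.

Local Notation E := (EE (cubeP d)).

Lemma innerE (f g : 'rV[R]_d -> R) : bm (f \o fromT) -> bm (g \o fromT) ->
  inner f g = E (fun x : d.-tuple R => f (fromT x) * g (fromT x)).
Proof.
move=> bf bg; rewrite /inner /tint.
by rewrite (cube_intE (f := fun x : d.-tuple R => f (fromT x) * g (fromT x)))//; exact: bmM bf bg.
Qed.

Lemma inner_sumr (I : Type) (s : seq I) (c : I -> R) (f : 'rV[R]_d -> R) (G : I -> 'rV[R]_d -> R) :
  bm (f \o fromT) -> (forall i, bm (G i \o fromT)) ->
  inner f (fun x => \sum_(i <- s) c i * G i x) = \sum_(i <- s) c i * inner f (G i).
Proof.
move=> bf bG.
have b i : bm (fun x : d.-tuple R => G i (fromT x)) by exact: bG.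
rewrite innerE//; last by apply: bm_sum => i; apply: bmM; [exact: bm_cst | exact: b].
have b2 i : bm (fun x : d.-tuple R => c i * (f (fromT x) * G i (fromT x))).
  by apply: bmM; [exact: bm_cst | exact: bmM].
rewrite (EE_ext _ (g := fun x : d.-tuple R => \sum_(i <- s) c i * (f (fromT x) * G i (fromT x)))); last first.
  by move=> x; rewrite mulr_sumr; apply: eq_bigr => i _; ring.
rewrite EE_sum//; apply: eq_bigr => i _.
by rewrite EEZ ?innerE//; exact: bmM.
Qed.

(** A partial derivative sends basis functions to multiples of basis functions with frequencies
    [kneg (K i)], still pairwise distinct; only the term [i0] survives, and the squares of its
    components add up to the eigenvalue. *)
Lemma grad_inner_fourier (I : finType) (c : I -> R) (K : I -> d.-tuple int) (i0 : I) :
  injective K ->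
  grad_inner (fun x => \sum_i c i * fourier (K i) x) (fourier (K i0)) = lamk (K i0) * c i0.
Proof.
move=> injK; rewrite /grad_inner /lamk mulr_sumr mulr_suml; apply: eq_bigr => j _.
have -> : dpart j (fun x => \sum_i c i * fourier (K i) x) =
    (fun x => \sum_i (c i * (2 * pi * (tnth (K i) j)%:~R)) * fourier (kneg (K i)) x).
  apply/funext => x; have [_ h] := is_derive_fourier_sum (index_enum I) c K x j.
  by rewrite /dpart; apply: (etrans h); apply: eq_bigr => i _; rewrite mulrA.
rewrite dpart_fourier.
set b := 2 * pi * (tnth (K i0) j)%:~R.
have bF k : bm ((fourier k : 'rV[R]_d -> R) \o fromT) by exact: bm_Fe.
have -> : inner (fun x => \sum_i (c i * (2 * pi * (tnth (K i) j)%:~R)) * fourier (kneg (K i)) x)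
    (fun x => b * fourier (kneg (K i0)) x) =
    \sum_i (c i * (2 * pi * (tnth (K i) j)%:~R)) *
      inner (fun x => b * fourier (kneg (K i0)) x) (fourier (kneg (K i))).
  rewrite -inner_sumr//; last by apply: bmM; [exact: bm_cst | exact: bF].
  by rewrite /inner; congr fine; congr tint; apply/funext => x; rewrite mulrC.
have h i : inner (fun x => b * fourier (kneg (K i0)) x) (fourier (kneg (K i)))
    = b * (i0 == i)%:R.
  rewrite innerE//; last by apply: bmM; [exact: bm_cst | exact: bF].
  rewrite (EE_ext _ (g := fun x : d.-tuple R => b * (Fe (kneg (K i0)) x * Fe (kneg (K i)) x))); last first.
    by move=> x; rewrite /= mulrA.
  rewrite EEZ; last by apply: bmM; exact: bm_Fe.
  rewrite Fe_ortho; congr (b * _%:R).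
  by rewrite (can_eq knegK) (inj_eq injK).
rewrite (bigD1 i0)//= h eqxx mulr1 big1 ?addr0; first by rewrite /b; ring.
by move=> i /negPf ii0; rewrite h eq_sym ii0 !mulr0.
Qed.

End fourier_calculus.

(** * Frequency cubes, dyadic levels and summability of the weights *)

Section cubes.
Context {R : realType} {d : nat}.
Implicit Types (k : d.-tuple int).

Definition cubeI n : finType := d.-tuple 'I_(2 * n).+1.

Lemma tnth_cubek n (t : cubeI n) j : tnth (cubek t) j = (tnth t j)%:Z - n%:Z.
Proof. by rewrite tnth_mktuple. Qed.

Lemma cubek_inj n : injective (@cubek d n).
Proof.
move=> s t st; apply: eq_from_tnth => j; apply: val_inj.
have := congr1 (fun k => tnth k j) st; rewrite !tnth_cubek => /addIr.
by case.
Qed.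

(** The index types [cubeI n] are unrelated for different [n]; these lists of integer vectors are
    nested, as tails and limits of series require. *)
Definition cubes n : seq (d.-tuple int) := [seq cubek t | t : cubeI n].

Lemma cubes_uniq n : uniq (cubes n).
Proof. by rewrite map_inj_uniq ?enum_uniq//; exact: cubek_inj. Qed.

Lemma size_cubes n : size (cubes n) = ((2 * n).+1 ^ d)%N.
Proof. by rewrite size_map -cardE card_tuple card_ord. Qed.

Lemma mem_cubes n k : (k \in cubes n) = [forall j, (`|tnth k j| <= n)%N].
Proof.
apply/mapP/forallP => [[t _ ->] j|h].
  by rewrite tnth_cubek; have := ltn_ord (tnth t j); lia.
have hb j : (`|(tnth k j + n%:Z)%R| < (2 * n).+1)%N by have := h j; lia.
exists [tuple Ordinal (hb j) | j < d]; first by rewrite mem_enum.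
apply: eq_from_tnth => j; rewrite tnth_cubek tnth_mktuple /=.
by have := h j; lia.
Qed.

Lemma cubes_mono n m k : (n <= m)%N -> k \in cubes n -> k \in cubes m.
Proof.
move=> nm; rewrite !mem_cubes => /forallP h; apply/forallP => j.
exact: leq_trans (h j) nm.
Qed.

Definition kmax k : nat := \max_(j < d) `|tnth k j|%N.

Lemma mem_cubes_kmax n k : (k \in cubes n) = (kmax k <= n)%N.
Proof.
rewrite mem_cubes; apply/forallP/bigmax_leqP => [h j _|h j]; first exact: h.
exact: h.
Qed.

Lemma sum_cubes (V : nmodType) n (F : d.-tuple int -> V) :
  \sum_(t : cubeI n) F (cubek t) = \sum_(k <- cubes n) F k.
Proof. by rewrite big_map big_enum. Qed.

Lemma sum_cubes_split (V : nmodType) n m (F : d.-tuple int -> V) : (n <= m)%N ->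
  \sum_(k <- cubes m) F k =
  \sum_(k <- cubes n) F k + \sum_(k <- cubes m | k \notin cubes n) F k.
Proof.
move=> nm; rewrite (bigID (fun k => k \in cubes n))/=; congr (_ + _).
rewrite -big_filter; apply: perm_big; apply: uniq_perm.
- by rewrite filter_uniq// cubes_uniq.
- exact: cubes_uniq.
move=> k; rewrite mem_filter andb_idr//; exact: cubes_mono.
Qed.

(** Dyadic level in the max norm; frequencies of max norm 0 and 1 share level 0. *)
Definition lev k : nat := trunc_log 2 (kmax k).

Lemma lev_lam k : 4 ^+ lev k <= 1 + lamk k :> R.
Proof.
have h2 : 2 ^+ 2 = 4 :> R by rewrite expr2 -natrM.
have [k0|k0] := posnP (kmax k).
  by rewrite /lev k0 trunc_log0 expr0 lerDl lamk_ge0.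
have [j kj] : exists j, kmax k = `|tnth k j|%N.
  have d0 : (0 < #|'I_d|)%N.
    rewrite card_ord lt0n; apply/eqP => d0; move: k0; rewrite /kmax.
    by rewrite big1// => -[i hi]; exfalso; rewrite d0 in hi.
  by have [j hj] := @bigop.eq_bigmax _ (fun j => `|tnth k j|%N) d0; exists j.
apply: (@le_trans _ _ (lamk k)); last by rewrite lerDr.
apply: (@le_trans _ _ ((kmax k)%:R ^+ 2)).
  rewrite -h2 exprAC lerXn2r ?nnegrE ?exprn_ge0//.
  by rewrite -natrX ler_nat trunc_logP.
have kE : (kmax k)%:R ^+ 2 = (tnth k j)%:~R ^+ 2 :> R.
  rewrite kj -[RHS]real_normK ?num_real//; congr (_ ^+ 2).
  by rewrite -intr_norm -abszE.
rewrite kE /lamk (bigD1 j)//= mulrDr.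
have p0 : 1 <= 4 * pi ^+ 2 :> R.
  have p2 : 2 <= pi :> R by exact: pi_ge2.
  have : 2 ^+ 2 <= pi ^+ 2 :> R by rewrite lerXn2r// nnegrE// pi_ge0.
  by lra.
apply: ler_wpDr.
  apply: mulr_ge0; first by rewrite mulr_ge0// sqr_ge0.
  by apply: sumr_ge0 => i _; exact: sqr_ge0.
by rewrite -[X in X <= _]mul1r ler_wpM2r// sqr_ge0.
Qed.

Hypothesis d3 : (d <= 3)%N.

(** Level [j] lies in the cube of half-width 2^{j+1}, whose side has 2^{j+2} + 1 <= 2^{j+3} points;
    the third power of this is 512 * 8^j, and [d <= 3] is used here. *)
Lemma lev_card n (j : nat) : (#|[pred t : cubeI n | lev (cubek t) == j]| <= 512 * 8 ^ j)%N.
Proof.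
have h : {subset [seq cubek t | t in [pred t : cubeI n | lev (cubek t) == j]] <= cubes (2 ^ j.+1)}.
  move=> k /mapP[t]; rewrite mem_enum inE => /eqP tj ->.
  rewrite mem_cubes_kmax ltnW// -tj.
  exact: trunc_log_ltn.
have u : uniq [seq cubek t | t in [pred t : cubeI n | lev (cubek t) == j]].
  by rewrite map_inj_uniq ?enum_uniq//; exact: cubek_inj.
have := uniq_leq_size u h.
rewrite size_cubes size_map -cardE => /leq_trans; apply.
apply: (@leq_trans ((2 ^ j.+3) ^ d)).
  have [d0|d0] := posnP d; first by rewrite d0 !expn0.
  rewrite leq_exp2r//.
  by rewrite !expnS; have := expn_gt0 2 j; lia.
apply: (@leq_trans ((2 ^ j.+3) ^ 3)); first by rewrite leq_pexp2l// expn_gt0.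
by rewrite -expnM (_ : 512 = 2 ^ 9)%N// (_ : 8 = 2 ^ 3)%N// -expnM -expnD leq_exp2l//; lia.
Qed.

(** Level by level: at most 512 * 8^j frequencies of weight at most 16^{-j}, so a geometric series
    of ratio 1/2. *)
Lemma sum_weights n : \sum_(t : cubeI n) (1 + lamk (cubek t)) ^- 2 <= 512 * 2 :> R.
Proof.
pose L := (\max_(t : cubeI n) lev (cubek t)).+1.
have tL (t : cubeI n) : (lev (cubek t) < L)%N.
  by rewrite ltnS; exact: (leq_bigmax (F := fun t : cubeI n => lev (cubek t)) t).
rewrite (partition_big (fun t => Ordinal (tL t)) predT)//=.
apply: (@le_trans _ _ (\sum_(j < L) 512 * 2^-1 ^+ j)).
  apply: ler_sum => j _.
  apply: (@le_trans _ _ (\sum_(t | Ordinal (tL t) == j) (16 ^+ j)^-1)).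
    apply: ler_sum => t /eqP tj.
    have lj : lev (cubek t) = j by rewrite -tj.
    rewrite lef_pV2 ?posrE ?exprn_gt0//; last by rewrite ltr_wpDr// lamk_ge0.
    have -> : 16 ^+ j = (4 ^+ j) ^+ 2 :> R by rewrite exprAC expr2 -natrM.
    have := lev_lam (cubek t); rewrite lj => h.
    by rewrite lerXn2r// nnegrE ?exprn_ge0// addr_ge0// lamk_ge0.
  rewrite sumr_const -[X in X <= _]mulr_natl.
  have -> : 512 * 2^-1 ^+ j = 512 * 8 ^+ j * (16 ^+ j)^-1 :> R.
    have -> : 16 ^+ j = 8 ^+ j * 2 ^+ j :> R by rewrite -exprMn -natrM.
    by rewrite exprVn; field; rewrite !expf_neq0.
  rewrite ler_wpM2r ?invr_ge0 ?exprn_ge0// -natrX -natrM ler_nat.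
  apply: leq_trans (lev_card n j).
  by apply: eq_leq; apply: eq_card => t.
rewrite -mulr_sumr.
apply: ler_wpM2l; first exact: ler0n.
have h m : \sum_(j < m) 2^-1 ^+ j <= 2 :> R.
  have -> : \sum_(j < m) 2^-1 ^+ j = 2 - 2 * 2^-1 ^+ m :> R.
    elim: m => [|m IH]; first by rewrite big_ord0 expr0; lra.
    by rewrite big_ord_recr/= IH exprS; field.
  by rewrite gerBl mulr_ge0// exprn_ge0// invr_ge0.
exact: h.
Qed.

End cubes.

(** * Completeness of the Fourier basis *)

Section completeness.
Context {R : realType} {d : nat}.
Local Notation T := (d.-tuple R).
Local Notation E := (EE (cubeP d)).

Inductive trig : (T -> R) -> Prop :=
| trig_cos m th : trig (tcos m th)
| trig_add f g : trig f -> trig g -> trig (fun x => f x + g x)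
| trig_scale c f : trig f -> trig (fun x => c * f x).

Lemma trig_ext f g : f =1 g -> trig f -> trig g.
Proof. by move=> /funext ->. Qed.

Lemma trig_bm f : trig f -> bm f.
Proof.
elim=> [m th|f1 g1 _ h1 _ h2|c f1 _ h1]; first exact: bm_tcos.
- exact: bmD.
- by apply: bmM => //; exact: bm_cst.
Qed.

Lemma trig_mul f g : trig f -> trig g -> trig (fun x => f x * g x).
Proof.
move=> tf; elim: tf g => [m th|f1 f2 _ h1 _ h2|c f1 _ h1] g tg.
- elim: tg => [m' th'|g1 g2 _ h1 _ h2|c g1 _ h1].
  + apply: (@trig_ext (fun x => 2^-1 * (tcos (fun j => m j + m' j) (th + th') x +
       tcos (fun j => m j - m' j) (th - th') x))).
      by move=> x; rewrite tcosM.
    by apply: trig_scale; apply: trig_add; exact: trig_cos.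
  + by apply: trig_ext (trig_add h1 h2) => x; rewrite mulrDr.
  + by apply: trig_ext (trig_scale c h1) => x; rewrite mulrCA.
- by apply: trig_ext (trig_add (h1 _ tg) (h2 _ tg)) => x; rewrite mulrDl.
- by apply: trig_ext (trig_scale c (h1 _ tg)) => x; rewrite mulrA.
Qed.

Lemma trig_cst c : trig (fun=> c).
Proof.
apply: trig_ext (trig_scale c (trig_cos (fun=> 0) 0)) => x.
rewrite /tcos /freq big1 => [|j _]; last by rewrite mulr0z mul0r.
by rewrite mulr0 addr0 cos0 mulr1.
Qed.

Lemma sum_delta (s : seq (d.-tuple int)) k (F : d.-tuple int -> R) : uniq s -> k \in s ->
  \sum_(l <- s) (l == k)%:R * F l = F k.
Proof.
move=> us ks; rewrite (bigD1_seq k)//= eqxx mul1r big1 ?addr0// => l /negPf ->.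
by rewrite mul0r.
Qed.

(** The coefficients vanish outside one cube, so the same expansion is valid in every larger cube;
    [parseval] compares it with partial sums of arbitrarily high order. *)
Lemma trig_span f : trig f -> exists n (c : d.-tuple int -> R),
  (forall k, k \notin cubes n -> c k = 0) /\
  forall m, (n <= m)%N -> f = fun x => \sum_(k <- cubes m) c k * Fe k x.
Proof.
have ext n (c : d.-tuple int -> R) g : (forall k, k \notin cubes n -> c k = 0) ->
    (g = fun x => \sum_(k <- cubes n) c k * Fe k x) ->
    forall m, (n <= m)%N -> g = fun x => \sum_(k <- cubes m) c k * Fe k x.
  move=> c0 -> m nm; apply/funext => x; rewrite (sum_cubes_split _ nm) [X in _ + X]big1 ?addr0//.
  by move=> k /c0 ->; rewrite mul0r.
elim=> [m th|f1 f2 _ [n1 [c1' [z1 h1]]] _ [n2 [c2' [z2 h2]]]|b f1 _ [n1 [c1' [z1 h1]]]].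
- pose k := [tuple m j | j < d].
  have mk : m = tnth k by apply/funext => j; rewrite tnth_mktuple.
  have [al [be hab]] : exists al be, tcos m th = fun x => al * Fe k x + be * Fe (kneg k) x.
    have s2 : Num.sqrt 2 != 0 :> R by rewrite gt_eqF// sqrtr_gt0.
    case: (boolP (kzero k)) => [k0|k0].
      exists (cos th), 0; apply/funext => x; rewrite mul0r addr0.
      rewrite /Fe /fourier -/(kzero k) k0 mulr1 /tcos /freq big1 ?mulr0 ?add0r// => j _.
      by rewrite mk (kzeroP _ k0) mulr0z mul0r.
    have fN (x : T) : freq (tnth (kneg k)) x = - freq m x :> R.
      by rewrite /freq -sumrN mk; apply: eq_bigr => j _; rewrite tnth_kneg mulrNz mulNr.
    have pN : pos_lex (kneg k) = ~~ pos_lex k.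
      apply: pos_lexN; rewrite ?size_tuple// => i.
      have [id|di] := ltnP i d; last by rewrite !nth_default ?size_tuple// oppr0.
      by rewrite -[i]/(val (Ordinal id)) -!tnth_nth tnth_kneg opprK.
    have e1 (x : T) : Fe k x = Num.sqrt 2 * (if pos_lex k then cos (2 * pi * freq m x) else sin (2 * pi * freq m x)).
      by rewrite /Fe /fourier -/(kzero k) (negPf k0) kdot_fromT -mk; case: ifP.
    have e2 (x : T) : Fe (kneg k) x = Num.sqrt 2 * (if pos_lex k then - sin (2 * pi * freq m x) else cos (2 * pi * freq m x)).
      have kd : kdot (kneg k) (fromT x) = - freq m x by rewrite kdot_fromT fN.
      rewrite /Fe /fourier -/(kzero (kneg k)) kzeroN (negPf k0) pN kd mulrN.
      by case: (pos_lex k) => /=; rewrite ?sinN ?cosN.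
    have [pk|pk] := boolP (pos_lex k).
      exists (cos th / Num.sqrt 2), (sin th / Num.sqrt 2); apply/funext => x.
      by rewrite e1 e2 pk /tcos cosD; field.
    exists (- (sin th / Num.sqrt 2)), (cos th / Num.sqrt 2); apply/funext => x.
    by rewrite e1 e2 (negPf pk) /tcos cosD; field.
  exists (kmax k), (fun l => al * (l == k)%:R + be * (l == kneg k)%:R).
  have kn : kmax (kneg k) = kmax k.
    by apply: eq_bigr => j _; rewrite tnth_kneg abszN.
  have z l : l \notin cubes (kmax k) -> al * (l == k)%:R + be * (l == kneg k)%:R = 0.
    move=> hl; have -> : (l == k) = false.
      by apply/negP => /eqP lk; rewrite lk mem_cubes_kmax leqnn in hl.
    have -> : (l == kneg k) = false.
      by apply/negP => /eqP lk; rewrite lk mem_cubes_kmax kn leqnn in hl.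
    by rewrite !mulr0 addr0.
  split => //; apply: ext => //; rewrite hab; apply/funext => x.
  under eq_bigr do rewrite mulrDl -!mulrA.
  rewrite big_split/= -!mulr_sumr !sum_delta ?cubes_uniq//.
  + by rewrite mem_cubes_kmax kn.
  + by rewrite mem_cubes_kmax.
- exists (maxn n1 n2), (fun k => c1' k + c2' k); split.
    move=> k hk; rewrite z1 ?z2 ?addr0//; apply: contra hk; apply: cubes_mono.
    + exact: leq_maxr.
    + exact: leq_maxl.
  move=> m; rewrite geq_max => /andP[m1 m2].
  rewrite [in LHS](h1 _ m1) [in LHS](h2 _ m2); apply/funext => x /=.
  by rewrite -big_split /=; apply: eq_bigr => k _; rewrite mulrDl.
- exists n1, (fun k => b * c1' k); split => [k /z1 ->|m nm]; first by rewrite mulr0.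
  rewrite [in LHS](h1 _ nm); apply/funext => x /=.
  by rewrite mulr_sumr; apply: eq_bigr => k _; rewrite mulrA.
Qed.

Definition approx (f : T -> R) : Prop :=
  bm f /\ forall eps, 0 < eps -> exists2 p, trig p & E (fun x => (f x - p x) ^+ 2) < eps.

Lemma approx_trig f : trig f -> approx f.
Proof.
move=> tf; split; first exact: trig_bm.
move=> eps e0; exists f => //.
rewrite (EE_ext _ (g := fun=> 0)) ?EE_cst// => x.
by rewrite subrr expr0n.
Qed.

Lemma approx_closed f : bm f ->
  (forall eps, 0 < eps -> exists2 g, approx g & E (fun x => (f x - g x) ^+ 2) < eps) ->
  approx f.
Proof.
move=> bf h; split => // eps e0.
have [g [bg hg] fg] := h (eps / 4) ltac:(by rewrite divr_gt0).
have [p tp gp] := hg (eps / 4) ltac:(by rewrite divr_gt0).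
exists p => //; have bp := trig_bm tp.
have := @EE_sqrD _ _ _ (cubeP d) (fun x => f x - g x) (fun x => g x - p x)
  (bmD bf (bmN bg)) (bmD bg (bmN bp)).
rewrite (EE_ext _ (g := fun x => (f x - p x) ^+ 2)); last by move=> x; congr (_ ^+ 2); ring.
by lra.
Qed.

Lemma approxD f g : approx f -> approx g -> approx (fun x => f x + g x).
Proof.
move=> [bf hf] [bg hg]; split; first exact: bmD.
move=> eps e0.
have [p tp fp] := hf (eps / 4) ltac:(by rewrite divr_gt0).
have [q tq gq] := hg (eps / 4) ltac:(by rewrite divr_gt0).
have bp := trig_bm tp; have bq := trig_bm tq.
exists (fun x => p x + q x); first exact: trig_add.
have := @EE_sqrD _ _ _ (cubeP d) (fun x => f x - p x) (fun x => g x - q x)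
  (bmD bf (bmN bp)) (bmD bg (bmN bq)).
rewrite (EE_ext _ (g := fun x => (f x + g x - (p x + q x)) ^+ 2)); last by move=> x; congr (_ ^+ 2); ring.
by lra.
Qed.

Lemma approxM f g : approx f -> approx g -> approx (fun x => f x * g x).
Proof.
move=> [bf hf] [bg hg]; split; first exact: bmM.
move=> eps e0.
have bnd (h u : T -> R) M : bm h -> bm u -> (forall x, `|u x| <= M) ->
    E (fun x => (h x * u x) ^+ 2) <= M ^+ 2 * E (fun x => h x ^+ 2).
  move=> bh bu hM; rewrite -EEZ; last by bm_tac.
  apply: EE_le; try bm_tac.
  rewrite exprMn mulrC ler_wpM2r ?sqr_ge0//.
  by rewrite -real_normK ?num_real// lerXn2r ?nnegrE// (le_trans _ (hM x)).
have small M : 0 < eps / (4 * (M ^+ 2 + 1)).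
  by rewrite divr_gt0// mulr_gt0// ltr_wpDl// sqr_ge0.
have use M u : u < eps / (4 * (M ^+ 2 + 1)) -> 0 <= u -> M ^+ 2 * u <= eps / 4.
  have M0 := sqr_ge0 M.
  move=> hu u0; apply: (@le_trans _ _ ((M ^+ 2 + 1) * u)).
    by rewrite ler_wpM2r// lerDl.
  have : (M ^+ 2 + 1) * u <= (M ^+ 2 + 1) * (eps / (4 * (M ^+ 2 + 1))).
    by rewrite ler_wpM2l ?(ltW hu)// addr_ge0.
  have -> : (M ^+ 2 + 1) * (eps / (4 * (M ^+ 2 + 1))) = eps / 4.
    by field; rewrite gt_eqF// ltr_wpDl.
  by [].
have [_ [Mg hMg]] := bg.
have [p tp fp] := hf _ (small Mg).
have bp := trig_bm tp; have [_ [Mp hMp]] := bp.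
(* The error [g - q] is multiplied by [p], whose sup bound is known only once [p] is chosen; hence
   this order. *)
have [q tq gq] := hg _ (small Mp).
have bq := trig_bm tq.
exists (fun x => p x * q x); first exact: trig_mul.
have b1 : bm (fun x => f x - p x) by exact: bmD bf (bmN bp).
have b2 : bm (fun x => g x - q x) by exact: bmD bg (bmN bq).
have := @EE_sqrD _ _ _ (cubeP d) (fun x => (f x - p x) * g x) (fun x => (g x - q x) * p x)
  (bmM b1 bg) (bmM b2 bp).
rewrite (EE_ext _ (g := fun x => (f x * g x - p x * q x) ^+ 2)); last by move=> x; congr (_ ^+ 2); ring.
move=> /le_lt_trans; apply.
have h1 := bnd _ _ _ b1 bg hMg; have h2 := bnd _ _ _ b2 bp hMp.
have h3 := use _ _ fp (EE_sqr_ge0 _ _); have h4 := use _ _ gq (EE_sqr_ge0 _ _).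
have h5 : E (fun x => ((f x - p x) * g x) ^+ 2) <= eps / 4 by exact: le_trans h1 h3.
have h6 : E (fun x => ((g x - q x) * p x) ^+ 2) <= eps / 4 by exact: le_trans h2 h4.
(* [h5] and [h6] only give a total of at most [eps]; strictness comes from the first term. *)
have [h7|h7] := ltP (E (fun x => ((f x - p x) * g x) ^+ 2)) (eps / 4).
  by lra.
exfalso.
have := h7; have Mg0 := sqr_ge0 Mg.
have : E (fun x => ((f x - p x) * g x) ^+ 2) < eps / 4.
  apply: (le_lt_trans h1).
  have [M0|M0] := eqVneq (Mg ^+ 2) 0; first by rewrite M0 mul0r divr_gt0.
  apply: (@lt_le_trans _ _ (Mg ^+ 2 * (eps / (4 * (Mg ^+ 2 + 1))))).
    by rewrite ltr_pM2l// lt_def M0.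
  rewrite mulrA ler_pdivrMr; last by rewrite mulr_gt0// ltr_wpDl.
  have -> : eps / 4 * (4 * (Mg ^+ 2 + 1)) = Mg ^+ 2 * eps + eps by field.
  by rewrite lerDl ltW.
by move=> a b; have := lt_le_trans a b; rewrite ltxx.
Qed.

Lemma approx_lim (F : nat -> T -> R) (f : T -> R) M :
  (forall n, approx (F n)) -> (forall n x, `|F n x| <= M) ->
  measurable_fun setT f -> (forall x, F ^~ x @ \oo --> f x) -> approx f.
Proof.
move=> aF hM mf cF.
have hMf x : `|f x| <= M.
  have cn : (fun n => `|F n x|) @ \oo --> `|f x| by apply: cvg_norm; exact: cF.
  rewrite -(cvg_lim (@Rhausdorff R) cn); apply: limr_le; first by apply/cvg_ex; exists `|f x|.
  by apply: nearW => n; exact: hM.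
have bf : bm f by split => //; exists M.
apply: approx_closed => // eps e0.
have c : (fun n => E (fun x => (f x - F n x) ^+ 2)) @ \oo --> E (fun=> 0).
  apply: (@EE_dct _ _ _ _ (fun n x => (f x - F n x) ^+ 2) (fun=> 0) ((M + M) ^+ 2)).
  - by move=> n; have [bn _] := aF n; bm_tac.
  - move=> n x; rewrite ger0_norm ?sqr_ge0// -real_normK ?num_real//.
    rewrite lerXn2r ?nnegrE// ?addr_ge0// ?(le_trans _ (hMf x))//.
    by rewrite (le_trans (ler_normB _ _))// lerD.
  - exact: measurable_cst.
  - move=> x; rewrite -[X in _ --> X](_ : (f x - f x) ^+ 2 = 0); last by rewrite subrr expr0n.
    under eq_fun do rewrite expr2; rewrite expr2.
    by apply: cvgM; apply: cvgB; [exact: cvg_cst | exact: cF | exact: cvg_cst | exact: cF].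
rewrite EE_cst in c.
have /cvgr_lt /(_ eps e0) [N _ hN] := c.
by exists (F N) => //; apply: hN => /=.
Qed.

Lemma approx_cst c : approx (fun=> c).
Proof. by apply: approx_trig; exact: trig_cst. Qed.

Lemma approx_scale c f : approx f -> approx (fun x => c * f x).
Proof. by apply: approxM; exact: approx_cst. Qed.

Lemma approx_ext f g : f =1 g -> approx f -> approx g.
Proof. by move=> /funext ->. Qed.

(* On [-1, 1] the iterates converge to the sign, so indicators of half-spaces
   are limits of trigonometric polynomials. *)
Definition sgn_step (y : R) : R := (3 * y - y ^+ 3) / 2.

Lemma sgn_step_range y : `|y| <= 1 -> `|sgn_step y| <= 1.
Proof.
rewrite !ler_norml /sgn_step => /andP[h1 h2].
have e1 : 1 - (3 * y - y ^+ 3) / 2 = (1 - y) ^+ 2 * (2 + y) / 2 by field.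
have e2 : (3 * y - y ^+ 3) / 2 + 1 = (1 + y) ^+ 2 * (2 - y) / 2 by field.
have p1 : 0 <= (1 - y) ^+ 2 * (2 + y) / 2.
  by rewrite divr_ge0// mulr_ge0 ?sqr_ge0//; lra.
have p2 : 0 <= (1 + y) ^+ 2 * (2 - y) / 2.
  by rewrite divr_ge0// mulr_ge0 ?sqr_ge0//; lra.
by apply/andP; split; lra.
Qed.

Lemma sgn_iter_range n y : `|y| <= 1 -> `|iter n sgn_step y| <= 1.
Proof. by elim: n => //= n IH /IH; exact: sgn_step_range. Qed.

(** The iterates stay in [y, 1], where one step multiplies the distance 1 - z to the fixed point 1
    by (1 - z)(2 + z)/2, which is at most 1 - y/2. *)
Lemma sgn_iter_pos y : 0 < y -> y <= 1 -> (fun n => iter n sgn_step y) @ \oo --> (1 : R).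
Proof.
move=> y0 y1.
have key n : y <= iter n sgn_step y <= 1 /\ 1 - iter n sgn_step y <= (1 - y / 2) ^+ n.
  elim: n => [|n [/andP[h1 h2] h3]] /=.
    by rewrite lexx y1 expr0; split => //; lra.
  set z := iter n sgn_step y in h1 h2 h3 *.
  have z0 : 0 < z by exact: lt_le_trans y0 h1.
  have e1 : 1 - sgn_step z = (1 - z) * ((1 - z) * (2 + z) / 2) by rewrite /sgn_step; field.
  have e2 : sgn_step z - z = z * (1 - z) * (1 + z) / 2 by rewrite /sgn_step; field.
  have p2 : 0 <= z * (1 - z) * (1 + z) / 2.
    rewrite divr_ge0// mulr_ge0//; last by lra.
    by rewrite mulr_ge0//; lra.
  have p3 : (1 - z) * (2 + z) / 2 <= 1 - y / 2.
    have : (1 - z) * (2 + z) / 2 = 1 - z / 2 - z ^+ 2 / 2 by field.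
    have := sqr_ge0 z; lra.
  have p4 : 0 <= (1 - z) * (2 + z) / 2 by rewrite divr_ge0// mulr_ge0//; lra.
  have p5 : 1 - sgn_step z <= (1 - y / 2) ^+ n.+1.
    by rewrite e1 exprSr ler_pM//; lra.
  have p6 : 0 <= 1 - sgn_step z by rewrite e1 mulr_ge0//; lra.
  by split => //; apply/andP; split; lra.
have c0 : (fun n => (1 - y / 2) ^+ n) @ \oo --> (0 : R).
  by apply: cvg_expr; rewrite ger0_norm; lra.
apply/cvgrPdist_lt => eps e0.
have /cvgr_lt /(_ eps e0) := c0; apply: filterS => n h.
by have [/andP[_ h2] h3] := key n; rewrite ger0_norm; lra.
Qed.

Lemma sgn_iterN n y : iter n sgn_step (- y) = - iter n sgn_step y.
Proof. by elim: n => //= n ->; rewrite /sgn_step; field. Qed.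

Lemma sgn_iter_cvg y : `|y| <= 1 -> (fun n => iter n sgn_step y) @ \oo --> Num.sg y.
Proof.
rewrite ler_norml => /andP[h1 h2].
have [y0|y0|->] := ltrgt0P y.
- by rewrite gtr0_sg//; exact: sgn_iter_pos.
- rewrite ltr0_sg// -[y]opprK.
  rewrite (_ : (fun n => _) = fun n => - iter n sgn_step (- y)); last first.
    by apply/funext => n; rewrite sgn_iterN.
  by apply: cvgN; apply: sgn_iter_pos; lra.
- rewrite sgr0 (_ : (fun n => _) = fun=> 0); first exact: cvg_cst.
  apply/funext => n; elim: n => //= n ->; rewrite /sgn_step.
  by rewrite mulr0 expr0n subrr mul0r.
Qed.

Lemma trig_sgn_iter n f : trig f -> trig (fun x => iter n sgn_step (f x)).
Proof.
move=> tf; elim: n => //= n IH.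
apply: trig_ext (trig_add (trig_scale (3 / 2) IH)
   (trig_scale (- 2^-1) (trig_mul IH (trig_mul IH IH)))) => x.
by rewrite /sgn_step; field.
Qed.

Lemma measurable_fun_sgr : measurable_fun setT (@Num.sg R).
Proof.
rewrite (_ : Num.sg = fun x : R => \1_`]0, +oo[%classic x - \1_`]-oo, 0[%classic x).
  by apply: measurable_funB; exact: measurable_indic.
apply/funext => x; rewrite !indicE !mem_setE/= !in_itv/= andbT.
have [x0|x0|->] := ltrgt0P x.
- by rewrite gtr0_sg// ?x0 ?(lt_gtF x0) /= ?subr0.
- by rewrite ltr0_sg// ?x0 ?(lt_gtF x0) /= ?sub0r.
- by rewrite sgr0 ?ltxx /= ?subrr.
Qed.

Lemma approx_pos f : trig f -> (forall x, `|f x| <= 1) ->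
  approx (fun x => (0 < f x)%R%:R).
Proof.
move=> tf f1; have [mf _] := trig_bm tf.
have asg : approx (fun x => Num.sg (f x)).
  apply: (@approx_lim (fun n x => iter n sgn_step (f x)) _ 1).
  - by move=> n; apply: approx_trig; exact: trig_sgn_iter.
  - by move=> n x; exact: sgn_iter_range.
  - by apply: measurableT_comp => //; exact: measurable_fun_sgr.
  - by move=> x; exact: sgn_iter_cvg.
(* For s in {-1, 0, 1} the value (s^2 + s)/2 is the indicator of s = 1. *)
apply: (approx_ext _ (approx_scale 2^-1 (approxD (approxM asg asg) asg))) => x.
have [x0|x0|->] := ltrgt0P (f x).
- by rewrite gtr0_sg// ?x0 /=; lra.
- by rewrite ltr0_sg// ?(lt_gtF x0) /=; lra.
- by rewrite sgr0 ?ltxx /=; lra.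
Qed.

Lemma EE_coord n (j : 'I_n) (h : R -> R) : bm h ->
  EE (cubeP n) (fun x => h (tnth x j)) = EE unitP h.
Proof.
elim: n j => [[]//|n IH] j bh.
have bt m (i : 'I_m) : bm (fun x : m.-tuple R => h (tnth x i)).
  split; last by case: bh => _ [M hM]; exists M.
  by apply: measurableT_comp; [case: bh | exact: measurable_tnth].
rewrite (EE_cons (bt _ j)).2.
case: (unliftP ord0 j) => [i ->|->].
  rewrite (EE_ext _ (g := fun=> EE unitP h)) ?EE_cst// => t.
  by rewrite -(IH i bh); apply: EE_ext => x; rewrite tnthS.
apply: EE_ext => t; rewrite -[RHS](EE_cst (cubeP n)).
by apply: EE_ext => x; rewrite tnth0.
Qed.

Lemma EE_unit_open : EE unitP (fun t : R => (0 < t < 1)%R%:R : R) = 1.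
Proof.
have e : (fun t : R => (0 < t < 1)%R%:R : R) = \1_(`]0, 1[%classic : set R) :> (R -> R).
  by apply/funext => t; rewrite indicE mem_setE/= in_itv.
rewrite e; apply: EFin_inj; rewrite -unitP_int; last exact: bm_indic.
rewrite integral_indic//= (_ : _ `&` _ = `]0%R, 1%R[%classic).
  by rewrite lebesgue_measure_itv/= lte01 oppr0 adde0.
apply/seteqP; split => x /=; rewrite !in_itv/=; first by case.
by move=> /andP[x0 x1]; rewrite x0 x1 !ltW.
Qed.

(** The two functions may differ only where coordinate [j] is outside (0, 1), a null set of
    [cubeP d]. This reconciles periodic approximants with half-space indicators, which are not
    periodic. *)
Lemma approx_off (j : 'I_d) f g : approx f -> bm g ->
  (forall x, `|f x - g x| <= 1) -> (forall x, 0 < tnth x j < 1 -> f x = g x) -> approx g.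
Proof.
move=> af bg fg1 fg; have [bf _] := af.
apply: approx_closed => // eps e0; exists f => //.
apply: (le_lt_trans _ e0).
have bo : bm (fun t : R => (0 < t < 1)%R%:R : R).
  have e : (fun t : R => (0 < t < 1)%R%:R : R) = \1_(`]0, 1[%classic : set R) :> (R -> R).
    by apply/funext => t; rewrite indicE mem_setE/= in_itv.
  by rewrite e; exact: bm_indic.
have b2 : bm (fun x : T => (0 < tnth x j < 1)%R%:R : R).
  split; last by exists 1 => x; case: (_ && _); rewrite ?normr1 ?normr0.
  by apply: (@measurableT_comp _ _ _ _ _ _ (fun t : R => (0 < t < 1)%R%:R : R)); [case: bo | exact: measurable_tnth].
apply: (@le_trans _ _ (E (fun x => 1 - (0 < tnth x j < 1)%R%:R))).
  apply: EE_le; try bm_tac.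
  have [h|h] := boolP (0 < tnth x j < 1).
    by rewrite fg// !subrr expr0n.
  rewrite subr0 -real_normK ?num_real// expr_le1//.
  by rewrite distrC.
rewrite EEB//; last exact: bm_cst.
by rewrite EE_cst (EE_coord j bo) EE_unit_open subrr.
Qed.

(* Two half-integer frequencies multiply to a trigonometric polynomial, whose
   sign inside the cube is that of [tnth x j - c]. *)
Lemma trig_ray (j : 'I_d) (c : R) :
  trig (fun x : T => sin (pi * (tnth x j - c)) * sin (pi * (1 - tnth x j))).
Proof.
pose m (i : 'I_d) : int := (i == j)%:R.
have fm x : freq m x = tnth x j :> R.
  rewrite /freq (bigD1 j)//= /m eqxx mul1r big1 ?addr0// => i /negPf ->.
  by rewrite mul0r.
apply: trig_ext (trig_add (trig_scale 2^-1 (trig_cos m (- (pi * c) - pi)))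
  (trig_cst (- 2^-1 * cos (pi * (1 - c))))) => x.
rewrite /tcos fm.
have -> : 2 * pi * tnth x j + (- (pi * c) - pi) = pi * (tnth x j - c) - pi * (1 - tnth x j) by ring.
have -> : pi * (1 - c) = pi * (tnth x j - c) + pi * (1 - tnth x j) by ring.
by rewrite (cosB (pi * (tnth x j - c))) (cosD (pi * (tnth x j - c))); field.
Qed.

Lemma indic_ray (g : T -> R) (c : R) x : \1_(g @^-1` `]c, +oo[%classic) x = (c < g x)%R%:R :> R.
Proof.
rewrite indicE; congr (nat_of_bool _)%:R.
by apply/idP/idP => [/set_mem|h]; [|apply/mem_set]; rewrite /= in_itv/= andbT.
Qed.

Lemma approx_ray (j : 'I_d) (c : R) : approx (fun x : T => (c < tnth x j)%R%:R).
Proof.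
have bray : bm (fun x : T => (c < tnth x j)%R%:R : R).
  split; last by exists 1 => x; case: (_ < _); rewrite ?normr1 ?normr0.
  rewrite (_ : (fun x => _) = \1_(`]c, +oo[%classic : set R) \o (fun x : T => tnth x j)).
    by apply: measurableT_comp; [exact: measurable_indic | exact: measurable_tnth].
  by apply/funext => x /=; rewrite indicE mem_setE/= in_itv/= andbT.
have d01 (a b : bool) : `|a%:R - b%:R| <= 1 :> R.
  by case: a; case: b; rewrite ?subrr ?subr0 ?sub0r ?normrN ?normr0 ?normr1.
have [c0|c0] := ltP c 0.
  apply: (@approx_off j (fun=> true%:R) _ (approx_cst _) bray) => [x|x /andP[x0 _]]; first exact: d01.
  by rewrite (lt_trans c0 x0).
have [c1|c1] := leP 1 c.
  apply: (@approx_off j (fun=> false%:R) _ (approx_cst _) bray) => [x|x /andP[_ x1]]; first exact: d01.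
  by rewrite ltNge (ltW (lt_le_trans x1 c1)).
apply: (@approx_off j _ _ (approx_pos (trig_ray j c) _) bray).
- by move=> x; rewrite normrM mulr_ile1// sin_max.
- by move=> x; exact: d01.
move=> x /andP[x0 x1]; congr (nat_of_bool _)%:R.
have s1 : 0 < sin (pi * (1 - tnth x j)).
  apply: sin_gt0_pi; rewrite mulr_gt0 ?pi_gt0 ?subr_gt0//=.
  by rewrite gtr_pMr ?pi_gt0//; lra.
rewrite pmulr_lgt0//.
have [cx|cx] := ltP c (tnth x j).
  apply: sin_gt0_pi; rewrite mulr_gt0 ?pi_gt0 ?subr_gt0//=.
  by rewrite gtr_pMr ?pi_gt0//; lra.
apply/negbTE; rewrite -leNgt -[tnth x j - c]opprK mulrN sinN oppr_le0.
apply: sin_ge0_pi; rewrite mulr_ge0 ?pi_ge0//=; last by lra.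
by rewrite ger_pMr ?pi_gt0//; lra.
Qed.

Let apx_set (A : set T) : Prop := measurable A /\ approx (\1_A).

(** Unions need no disjointness: the indicator of a union is the bounded limit of 1 minus the
    product of the complementary indicators, and [approx] is stable under products and bounded
    limits. *)
Lemma apx_sigma : sigma_algebra setT apx_set.
Proof.
split.
- by split => //; apply: approx_ext (approx_cst 0) => x; rewrite indic0.
- move=> A [mA aA]; split; first exact: measurableD.
  apply: approx_ext (approxD (approx_cst 1) (approx_scale (- 1) aA)) => x.
  by rewrite setTD !indicE in_setC; case: (_ \in _) => /=; lra.
- move=> F hF; have mU : measurable (\bigcup_n F n) by apply: bigcup_measurable => n _; case: (hF n).
  split => //.
  have aprod n : approx (fun x => \prod_(i < n) (1 - \1_(F i) x)).
    elim: n => [|n IH]; first by apply: approx_ext (approx_cst 1) => x; rewrite big_ord0.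
    have [_ an] := hF n.
    apply: approx_ext (approxM IH (approxD (approx_cst 1) (approx_scale (- 1) an))) => x.
    by rewrite big_ord_recr /= mulN1r.
  apply: (@approx_lim (fun n x => 1 - \prod_(i < n) (1 - \1_(F i) x)) _ 2).
  + move=> n; apply: approx_ext (approxD (approx_cst 1) (approx_scale (- 1) (aprod n))) => x.
    by rewrite mulN1r.
  + move=> n x; rewrite (le_trans (ler_normB _ _))// normr1.
    have -> : 2 = 1 + 1 :> R by ring.
    rewrite lerD2l normr_prod prodr_ile1// => i _.
    by rewrite indicE; case: (x \in F i) => /=; rewrite ?subrr ?subr0 ?normr0 ?normr1 ?lexx ?ler01.
  + exact: measurable_indic.
  + move=> x; have [[i _ Fi]|nF] := pselect ((\bigcup_n F n) x).
      rewrite indicE mem_set; last by exists i.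
      apply: cvg_near_cst; exists i.+1 => // n /= ni.
      rewrite (bigD1 (Ordinal ni))//= indicE mem_set// subrr mul0r subr0//.
    rewrite indicE memNset//.
    apply: cvg_near_cst; apply: nearW => n.
    rewrite big1 ?subrr// => i _; rewrite indicE memNset ?subr0// => Fi.
    by apply: nF; exists i.
Qed.

(** Two generations are unfolded: coordinate preimages generate the sets of tuples, and the rays of
    [approx_ray] generate the Borel sets of each coordinate. *)
Lemma apx_all (A : set T) : measurable A -> approx (\1_A).
Proof.
move=> mA; suff : apx_set A by case.
move: A mA; apply: smallest_sub; first exact: apx_sigma.
move=> A; rewrite -bigcup_seq => -[j _ [B mB <-]].
rewrite setTI.
have hE := RGenOInfty.measurableE R.
have : (@RGenOInfty.G R).-sigma.-measurable B by rewrite -hE; exact: mB.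
move: B {mB}.
pose C := [set B : set R | apx_set ((fun x : T => tnth x j) @^-1` B)].
suff : <<s @RGenOInfty.G R >> `<=` C by apply.
have [s0 sC sU] := apx_sigma.
apply: smallest_sub.
  split.
  - exact: s0.
  - by move=> B hB; have := sC _ hB; rewrite !setTD.
  - by move=> F hF; rewrite /C /= preimage_bigcup; exact: sU.
move=> _ [c ->]; have := approx_ray j c => -[b a].
have e : \1_((fun x : T => tnth x j) @^-1` `]c, +oo[%classic) = (fun x : T => (c < tnth x j)%R%:R) :> (T -> R).
  by apply/funext => x; exact: indic_ray.
split; last by rewrite e.
by rewrite -[X in measurable X]setTI; apply: measurable_tnth => //.
Qed.

(** After rescaling to [g] with values in [0, 1], the average over [j < n] of the indicators of g >
    j/n is uniformly within 1/n of [g]; [count] is this rounding estimate. *)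
Lemma bm_approx f : bm f -> approx f.
Proof.
move=> bf; have [mf [M0 hM0]] := bf.
pose M := `|M0| + 1.
have M1 : 0 < M by rewrite /M ltr_wpDl.
have hM x : `|f x| <= M by rewrite (le_trans (hM0 x))// (le_trans (ler_norm _))// lerDl.
pose g x := (f x + M) / (2 * M).
have g01 x : 0 <= g x <= 1.
  have := hM x; rewrite ler_norml => /andP[h1 h2].
  by rewrite divr_ge0 ?ler_pdivrMr ?mulr_gt0 ?mulr_ge0//=; lra.
have mg : measurable_fun setT g.
  by apply: measurable_funM => //; exact: measurable_funD.
suff ag : approx g.
  apply: approx_ext (approxD (approx_scale (2 * M) ag) (approx_cst (- M))) => x.
  by rewrite /g; field; rewrite gt_eqF.
have bg : bm g by split => //; exists 1 => x; have /andP[h1 h2] := g01 x; rewrite ger0_norm.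
have count (n : nat) (y : R) : 0 <= y <= n%:R ->
    y <= \sum_(j < n) (j%:R < y)%R%:R <= y + 1.
  elim: n => [|n IH] /andP[y0 yn].
    have -> : y = 0 by apply/eqP; rewrite eq_le y0 yn.
    by rewrite big_ord0 lexx add0r ler01.
  rewrite big_ord_recr /=.
  have [ny|ny] := ltP n%:R y; last by rewrite addr0; apply: IH; rewrite y0.
  have -> : \sum_(j < n) (j%:R < y)%R%:R = n%:R :> R.
    rewrite (eq_bigr (fun=> 1)) ?sumr_const ?card_ord// => j _.
    by rewrite (le_lt_trans _ ny)// ler_nat ltnW.
  by rewrite natr1 yn/= -natr1 lerD2r ltW.
apply: approx_closed => // eps e0.
have [n hn] : exists n : nat, eps^-1 + 1 < n%:R.
  by exists (Num.trunc (eps^-1 + 1)).+1; rewrite truncnS_gt// addr_ge0// invr_ge0 ltW.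
have e1 : 0 < eps^-1 by rewrite invr_gt0.
have n0 : 0 < n%:R :> R by lra.
exists (fun x => n%:R^-1 * \sum_(j < n) \1_(g @^-1` `](j%:R / n%:R), +oo[%classic) x).
  apply: approx_scale.
  elim: (index_enum _) => [|j s IH].
    by apply: approx_ext (approx_cst 0) => x; rewrite big_nil.
  have aj : approx (\1_(g @^-1` `](j%:R / n%:R), +oo[%classic)).
    by apply: apx_all; rewrite -[X in measurable X]setTI; apply: mg => //; exact: measurable_itv.
  by apply: approx_ext (approxD aj IH) => x; rewrite big_cons.
have hb x : `|g x - n%:R^-1 * \sum_(j < n) \1_(g @^-1` `](j%:R / n%:R), +oo[%classic) x| <= n%:R^-1.
  have e : \sum_(j < n) \1_(g @^-1` `](j%:R / n%:R), +oo[%classic) x =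
      \sum_(j < n) (j%:R < n%:R * g x)%R%:R :> R.
    by apply: eq_bigr => j _; rewrite indic_ray ltr_pdivrMr// mulrC.
  have /andP[g0 g1] := g01 x.
  have := count n (n%:R * g x).
  rewrite mulr_ge0//= -[X in _ <= X -> _]mulr1 ler_pM2l// g1 => /(_ isT).
  rewrite e; set s := \sum_(j < n) _ => /andP[h1 h2].
  rewrite distrC -(@ler_pM2l _ n%:R)// divff ?gt_eqF// -{1}(gtr0_norm n0) -normrM.
  rewrite mulrBr mulrA divff ?gt_eqF// mul1r ger0_norm; lra.
have n1 : n%:R^-1 < eps.
  by rewrite -[eps]invrK ltf_pV2 ?posrE//; lra.
have ni0 : 0 < n%:R^-1 :> R by rewrite invr_gt0.
have ni1 : n%:R^-1 <= 1 :> R by rewrite invf_le1//; lra.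
apply: (@le_lt_trans _ _ (E (fun=> n%:R^-1))); last by rewrite EE_cst.
apply: EE_le; try bm_tac.
- apply: bm_indic; rewrite -[X in measurable X]setTI; apply: mg => //; exact: measurable_itv.
- rewrite -real_normK ?num_real//; apply: (@le_trans _ _ (n%:R^-1 ^+ 2)).
    by rewrite lerXn2r ?nnegrE// ltW.
  by rewrite expr2 ler_piMl// ltW.
Qed.

Definition Fcoef (f : T -> R) (k : d.-tuple int) : R := E (fun x => f x * Fe k x).

Definition Ft n (t : cubeI n) : T -> R := Fe (cubek t).

Lemma bm_Ft n (t : cubeI n) : bm (Ft t).
Proof. exact: bm_Fe. Qed.

Lemma Ft2 n (t : cubeI n) x : Ft t x ^+ 2 <= 2.
Proof. exact: Fe2. Qed.

Lemma Ft_ortho n (s t : cubeI n) : E (fun x => Ft s x * Ft t x) = (s == t)%:R.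
Proof. by rewrite Fe_ortho (inj_eq (@cubek_inj d n)). Qed.

(** Density gives a trigonometric polynomial close to [f]; once the cube contains its frequencies,
    the Fourier partial sum is at least as close, by [pythagoras]. *)
Lemma parseval f : bm f ->
  (fun n => E (fun x => (f x - comb (@Ft n) (fun t => Fcoef f (cubek t)) x) ^+ 2)) @ \oo --> (0 : R).
Proof.
move=> bf; have [_ af] := bm_approx bf.
apply/cvgrPdist_lt => eps e0.
have [p tp fp] := af eps e0.
have [N [c [_ hc]]] := trig_span tp.
exists N => // n /= Nn.
rewrite sub0r normrN ger0_norm; last exact: EE_sqr_ge0.
apply: le_lt_trans fp.
rewrite (hc n Nn).
have -> : (fun x : T => (f x - \sum_(k <- cubes n) c k * Fe k x) ^+ 2) =
   (fun x => (f x - comb (@Ft n) (fun t => c (cubek t)) x) ^+ 2).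
  apply/funext => x; congr (_ ^+ 2); congr (_ - _).
  by rewrite -(sum_cubes n (fun k => c k * Fe k x)).
rewrite [X in _ <= X](pythagoras (@bm_Ft n) (@Ft_ortho n) _ bf).
by rewrite lerDl sumr_ge0// => t _; exact: sqr_ge0.
Qed.

End completeness.

(** * Independent Gaussian variables *)

Section density.
Context {R : realType} {dT : measure_display} {T : measurableType dT}.
Variables (mu m : {measure set T -> \bar R}) (g : T -> R).
Hypothesis mg : measurable_fun setT g.
Hypothesis g0 : forall x, 0 <= g x.
Hypothesis mE : forall A, measurable A -> m A = (\int[mu]_(x in A) (g x)%:E)%E.
Local Open Scope ereal_scope.

Import HBNNSimple.

Let density_nnsfun (f : {nnsfun T >-> R}) :
  \int[m]_x (f x)%:E = \int[mu]_x ((f x)%:E * (g x)%:E).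
Proof.
under [LHS]eq_integral do rewrite fimfunE -fsumEFin//.
rewrite [LHS]ge0_integral_fsum//; last 2 first.
  - by move=> r; exact/measurable_EFinP/measurableT_comp.
  - by move=> n x _; rewrite EFinM nnfun_muleindic_ge0.
have eg0 x : 0 <= (g x)%:E by rewrite lee_fin.
under [RHS]eq_integral.
  move=> x xD; rewrite fimfunE -fsumEFin// muleC ge0_mule_fsumr; last first.
    by move=> r; rewrite EFinM nnfun_muleindic_ge0.
  over.
rewrite [RHS]ge0_integral_fsum//; last 2 first.
  - move=> r; apply: emeasurable_funM; first exact/measurable_EFinP.
    by apply/measurable_EFinP/measurableT_comp.
  - by move=> n x _; rewrite mule_ge0// EFinM nnfun_muleindic_ge0.
apply: eq_fsbigr => r _.
rewrite integralZl_indic_nnsfun//= integral_indic// setIT mE//.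
have [r0|r0] := leP 0%R r; last first.
  rewrite preimage_nnfun0//= integral_set0 mule0.
  under eq_integral do rewrite indic0 mulr0 mule0.
  by rewrite integral0.
rewrite [in LHS]integral_mkcond -ge0_integralZl//.
- apply: eq_integral => x _; rewrite patchE indicE.
  by case: ifPn => xr; rewrite ?mulr1 ?mulr0 ?mule0// muleC.
- by apply/(measurable_restrictT _ _).1 => //; apply/measurable_funTS/measurable_EFinP.
- by move=> x _; rewrite patchE; case: ifP.
Qed.

(** Simple functions and monotone convergence. It serves [normal_prob], which is given by its values
    on sets. *)
Lemma integral_density (f : T -> \bar R) : measurable_fun setT f -> (forall x, 0 <= f x) ->
  \int[m]_x f x = \int[mu]_x (f x * (g x)%:E).
Proof.
move=> mf f0; have eg0 x : 0 <= (g x)%:E by rewrite lee_fin.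
pose f_ := nnsfun_approx measurableT mf.
transitivity (limn (fun n => \int[m]_x (f_ n x)%:E)).
  rewrite -monotone_convergence//=.
  - apply: eq_integral => ? /[!inE] xD; apply/esym/cvg_lim => //=.
    exact: cvg_nnsfun_approx.
  - by move=> n; exact/measurable_EFinP/measurable_funTS.
  - by move=> n ? _; rewrite lee_fin.
  - by move=> ? _ ? ? mn; rewrite lee_fin; exact/lefP/nd_nnsfun_approx.
transitivity (limn (fun n => \int[mu]_x ((f_ n x)%:E * (g x)%:E))).
  by apply: congr_lim; apply/funext => n /=; exact: density_nnsfun.
rewrite -monotone_convergence//=.
- apply: eq_integral => x /[!inE] xD; apply/cvg_lim => //=.
  under eq_fun do rewrite muleC; rewrite muleC.
  by apply: cvgeZl => //; exact: cvg_nnsfun_approx.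
- by move=> n; apply: emeasurable_funM; exact/measurable_EFinP.
- by move=> n x _; rewrite mule_ge0// lee_fin.
- move=> x _ i j ij; apply: lee_pmul => //; first by rewrite lee_fin.
  by rewrite lee_fin; exact/lefP/nd_nnsfun_approx.
Qed.

End density.

Section gauss.
Context {R : realType}.

Definition gaussP : probability R R :=
  distribution (normal_prob (0 : R) 1 : probability (measurableTypeR R) R) idR.

(** Completing the square ([key]) leaves a constant times the normal density centred at [s]. *)
Lemma gauss_mgf (s : R) :
  (\int[gaussP]_y (expR (s * y))%:E = (expR (s ^+ 2 / 2))%:E)%E.
Proof.
have mexp : measurable_fun setT (fun y : R => (expR (s * y))%:E).
  by apply/measurable_EFinP; apply: measurableT_comp => //; apply: measurable_funM.
have key (t : R) : expR (s * t) * expR (- (t - 0) ^+ 2 / 2) =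
    expR (s ^+ 2 / 2) * expR (- (t - s) ^+ 2 / 2).
  by rewrite -!expRD; congr expR; field.
rewrite ge0_integral_distribution//.
rewrite (@integral_density _ _ (measurableTypeR R) lebesgue_measure (normal_prob 0 1)
  (normal_pdf 0 1) (measurable_normal_pdf 0 1) (normal_pdf_ge0 0 1) (fun _ _ => erefl))//; last first.
  by move=> x; rewrite lee_fin expR_ge0.
transitivity (\int[lebesgue_measure]_x ((expR (s ^+ 2 / 2))%:E * (normal_pdf s 1 x)%:E))%E.
  apply: eq_integral => y _; rewrite -!EFinM; congr EFin.
  rewrite !normal_pdfE// /normal_fun !expr1n /idR /=.
  rewrite !(mulrCA _ (normal_peak 1)); congr (_ * _).
  exact: key.
rewrite ge0_integralZl//=.
- by rewrite integral_normal_pdf mule1.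
- by apply/measurable_EFinP; exact: measurable_normal_pdf.
- by move=> x _; rewrite lee_fin normal_pdf_ge0.
Qed.

End gauss.

Section independence.
Context {R : realType} {dO : measure_display} {Omega : measurableType dO}.
Variable P : probability Omega R.
Variables (A : choiceType) (z : A -> Omega -> R) (L : pred A).
Hypothesis mz : forall a, L a -> measurable_fun setT (z a).
Hypothesis lawz : forall a, L a -> forall B : set R, measurable B ->
  P (z a @^-1` B) = normal_prob 0 1 B.
Hypothesis indz : forall s : seq A, uniq s -> all L s -> forall B : A -> set R,
  (forall a, measurable (B a)) ->
  P (\bigcap_(a in [set` s]) (z a @^-1` B a)) = (\prod_(a <- s) P (z a @^-1` B a))%E.

Definition zgen (I : pred A) : set (set Omega) :=
  [set S | exists a, [/\ L a, I a & exists2 B : set R, measurable B & S = z a @^-1` B]].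

(** The carrier is still [Omega], with the sigma-algebra of the variables indexed in [I]. Being a
    function of these variables thus becomes ordinary measurability, and product measures and
    Tonelli apply to it. *)
Definition zalg (I : pred A) := g_sigma_algebraType (zgen I).

Lemma zalg_measurable I S : <<s zgen I >> S -> measurable S.
Proof.
apply: smallest_sub; first exact: sigma_algebra_measurable.
move=> _ [a [La _ [B mB ->]]]; rewrite -[X in measurable X]setTI; exact: mz.
Qed.

Lemma zalg_sub I I' : {subset I <= I'} -> <<s zgen I >> `<=` <<s zgen I' >>.
Proof.
move=> II'; apply: smallest_sub; first exact: smallest_sigma_algebra.
move=> S [a [La Ia hB]]; apply: sub_sigma_algebra; exists a; split => //.
exact: II'.
Qed.

Lemma zalg_widen d' (T' : measurableType d') I I' (f : Omega -> T') : {subset I <= I'} ->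
  @measurable_fun _ _ (zalg I) T' setT f -> @measurable_fun _ _ (zalg I') T' setT f.
Proof.
move=> II' mf _ Y mY; have := mf measurableT Y mY.
by rewrite !setTI; exact: zalg_sub.
Qed.

Lemma zalg_fun d' (T' : measurableType d') I (f : Omega -> T') :
  @measurable_fun _ _ (zalg I) T' setT f -> measurable_fun setT f.
Proof.
move=> mf _ Y mY; have := mf measurableT Y mY.
by rewrite !setTI; exact: zalg_measurable.
Qed.

Lemma zalg_z (I : pred A) a : L a -> I a -> @measurable_fun _ _ (zalg I) R setT (z a).
Proof.
move=> La Ia _ Y mY; rewrite setTI; apply: sub_sigma_algebra.
by exists a; split => //; exists Y.
Qed.

Let cyl (I : pred A) : set (set Omega) :=
  [set S | exists s : seq A, exists B : A -> set R,
    [/\ uniq s, all L s, all I s, forall a, measurable (B a) &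
        S = \bigcap_(a in [set` s]) (z a @^-1` B a)]].

Lemma cyl_setI I : setI_closed (cyl I).
Proof.
move=> _ _ [s [B [us Ls Is mB ->]]] [s' [B' [us' Ls' Is' mB' ->]]].
exists (undup (s ++ s')), (fun a => (if a \in s then B a else setT) `&` (if a \in s' then B' a else setT)).
split; rewrite ?undup_uniq//.
- by rewrite all_undup all_cat Ls.
- by rewrite all_undup all_cat Is.
- by move=> a; apply: measurableI; case: ifP.
apply/seteqP; split => w.
  move=> [h1 h2] a /=; rewrite mem_undup mem_cat => _.
  by split; case: ifP => // ha; [exact: h1 | exact: h2].
move=> h; split => a /= ha; have /= := h a; rewrite mem_undup mem_cat ha ?orbT => /(_ isT).
  by case.
by case.
Qed.

Lemma cyl_gen I : <<s cyl I >> = <<s zgen I >>.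
Proof.
apply/seteqP; split; apply: smallest_sub; try exact: smallest_sigma_algebra.
  move=> _ [s [B [us Ls Is mB ->]]].
  have hs a : a \in s -> <<s zgen I >> (z a @^-1` B a).
    move=> sa; apply: sub_sigma_algebra; exists a; split.
    - exact: (allP Ls).
    - exact: (allP Is).
    - by exists (B a).
  rewrite bigcap_seq big_seq; apply: (@big_ind _ (fun S => @measurable _ (zalg I) S)).
  - exact: measurableT.
  - by move=> S S' mS mS'; exact: measurableI.
  - exact: hs.
move=> _ [a [La Ia [B mB ->]]]; apply: sub_sigma_algebra.
exists [:: a], (fun=> B); split => //=; rewrite ?andbT//.
apply/seteqP; split => w /=; first by move=> wB b /=; rewrite inE => /eqP ->.
by apply; rewrite /= inE.
Qed.

(** Dynkin's lemma starting from finite cylinders, for which adjoining the new index [a] to the list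
    is the assumed product rule. *)
Lemma indep_set (I : pred A) a S (B : set R) : L a -> ~~ I a -> <<s zgen I >> S -> measurable B ->
  P (S `&` z a @^-1` B) = (P S * normal_prob 0 1 B)%E.
Proof.
move=> La Ia mS mB.
have mzB : measurable (z a @^-1` B) by rewrite -[X in measurable X]setTI; exact: mz.
rewrite -(lawz La mB).
rewrite -cyl_gen in mS.
move: S mS; apply: (@dynkin_induction _ (zalg I) (cyl I)
  (fun S => P (S `&` z a @^-1` B) = (P S * P (z a @^-1` B))%E)).
- exact/esym/cyl_gen.
- exact: cyl_setI.
- by rewrite setTI probability_setT mul1e.
- move=> _ [s [C [us Ls Is mC ->]]].
  have sa : a \notin s by apply/negP => /(allP Is); exact/negP.
  pose C' b := if b == a then B else C b.
  have e1 : \bigcap_(b in [set` s]) z b @^-1` C b = \bigcap_(b in [set` s]) z b @^-1` C' b.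
    apply: eq_bigcapr => b /= bs; rewrite /C'; case: eqP => // ba.
    by move: sa; rewrite -ba (bs : is_true (b \in s)).
  have e2 : \bigcap_(b in [set` s]) z b @^-1` C b `&` z a @^-1` B =
     \bigcap_(b in [set` a :: s]) z b @^-1` C' b.
    rewrite e1; apply/seteqP; split => w /=.
      move=> [h1 h2] b /=; rewrite inE => /orP[/eqP ->|bs]; last exact: h1.
      by rewrite /C' eqxx.
    move=> h; split => [b bs|]; first by apply: h; rewrite /= inE [_ \in s]bs orbT.
    by have /= := h a; rewrite inE eqxx /C' eqxx; apply.
  have mC' b : measurable (C' b) by rewrite /C'; case: ifP.
  rewrite e2 indz//=; [|by rewrite sa|by rewrite La].
  by rewrite e1 indz// big_cons /C' eqxx muleC.
- move=> S mS hS; have mS' := zalg_measurable mS.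
  have fz : P (z a @^-1` B) \is a fin_num by exact: fin_num_measure.
  have fs : P S \is a fin_num by exact: fin_num_measure.
  have -> : ~` S `&` z a @^-1` B = z a @^-1` B `\` (S `&` z a @^-1` B).
    by rewrite setDIr setDv setU0 setDE setIC.
  rewrite measureD//; [|exact: measurableI|by rewrite ltey_eq fz].
  have -> : z a @^-1` B `&` (S `&` z a @^-1` B) = S `&` z a @^-1` B.
    by rewrite setIC -setIA setIid.
  have hSE : P (S `&` z a @^-1` B) = (P S * P (z a @^-1` B))%E by exact: hS.
  have hC : P (~` S) = (1%E - P S)%E by exact: probability_setC.
  have arith (x y : \bar R) : x \is a fin_num -> y \is a fin_num ->
      (x - y * x = (1%E - y) * x)%E.
    case: x y => [x| |] [y| |]// _ _.
    transitivity ((x - y * x)%:E); first by [].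
    by rewrite (_ : x - y * x = (1 - y) * x)//; ring.
  transitivity (P (z a @^-1` B) - P S * P (z a @^-1` B))%E; last first.
    by rewrite (arith _ _ fz fs) -hC.
  by rewrite -hSE.
- move=> F mF tF hF; have mF' n := zalg_measurable (mF n).
  have fz : P (z a @^-1` B) \is a fin_num by exact: fin_num_measure.
  rewrite setI_bigcupl measure_bigcup; first last.
  + exact: trivIset_setIr.
  + by move=> n _; exact: measurableI.
  rewrite (measure_bigcup P setT F (fun n _ => mF' n) tF) -(fineK fz) muleC -nneseriesZl//.
  by apply: eq_eseriesr => n _; rewrite fineK// muleC; exact: hF.
Qed.

End independence.

Section freezing.
Context {R : realType} {dO : measure_display} {Omega : measurableType dO}.
Variable P : probability Omega R.
Variables (A : choiceType) (z : A -> Omega -> R) (L : pred A).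
Hypothesis mz : forall a, L a -> measurable_fun setT (z a).
Hypothesis lawz : forall a, L a -> forall B : set R, measurable B ->
  P (z a @^-1` B) = normal_prob 0 1 B.
Hypothesis indz : forall s : seq A, uniq s -> all L s -> forall B : A -> set R,
  (forall a, measurable (B a)) ->
  P (\bigcap_(a in [set` s]) (z a @^-1` B a)) = (\prod_(a <- s) P (z a @^-1` B a))%E.
Local Notation zalg := (zalg z L).
Local Notation zmeas I := (@measurable_fun _ _ (zalg I) R setT).

Section one_variable.
Variable I : pred A.

Definition to_zalg : Omega -> zalg I := id.

Lemma measurable_to_zalg : measurable_fun setT to_zalg.
Proof. by move=> _ Y mY; rewrite setTI; exact: (zalg_measurable mz mY). Qed.

HB.instance Definition _ :=
  isMeasurableFun.Build _ _ _ _ to_zalg measurable_to_zalg.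

Definition Pz : probability (zalg I) R := distribution P to_zalg.

(** The substitute for conditional expectation. The pair of the identity into [zalg I] and [z a] has
    law [Pz] times [gaussP], because the two agree on rectangles by [indep_set]; Tonelli does the
    rest. *)
Lemma freeze a (Phi : zalg I * R -> \bar R) : L a -> ~~ I a ->
  measurable_fun setT Phi -> (forall x, 0 <= Phi x)%E ->
  (\int[P]_w Phi (w, z a w) = \int[P]_w \int[gaussP]_y Phi (w, y))%E.
Proof.
move=> La Ia mPhi Phi0.
pose h (w : Omega) : zalg I * R := (to_zalg w, z a w).
have mh : measurable_fun setT h.
  by apply: measurable_fun_pair; [exact: measurable_to_zalg | exact: mz].
have mF := @measurable_fun_fubini_tonelli_F _ _ _ _ _ gaussP Phi mPhi Phi0.
transitivity (\int[pushforward P h]_x Phi x)%E.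
  by rewrite ge0_integral_pushforward//.
transitivity (\int[Pz \x gaussP]_x Phi x)%E.
  apply: eq_measure_integral => S mS _.
  pose h_mixin := isMeasurableFun.Build _ _ _ _ h mh.
  pose h_pack : {mfun Omega >-> (zalg I * R)%type} := HB.pack h h_mixin.
  apply/esym; apply: (@product_measure_unique _ _ _ _ _ Pz gaussP (distribution P h_pack)) => //.
  move=> B C mB mC.
  have := indep_set mz lawz indz La Ia mB mC.
  exact.
rewrite fubini_tonelli1//.
rewrite [LHS]ge0_integral_distribution//.
by move=> x; apply: integral_ge0 => y _; exact: Phi0.
Qed.

End one_variable.

Lemma freeze_exp (I : pred A) a (Z s : Omega -> R) : L a -> ~~ I a ->
  zmeas I Z -> zmeas I s -> (forall w, 0 <= Z w) ->
  (\int[P]_w (Z w * expR (s w * z a w))%:E = \int[P]_w (Z w * expR (s w ^+ 2 / 2))%:E)%E.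
Proof.
move=> La Ia mZ ms Z0.
pose Phi (x : zalg I * R) : \bar R := (Z x.1 * expR (s x.1 * x.2))%:E.
have mPhi : measurable_fun setT Phi.
  apply/measurable_EFinP; apply: measurable_funM.
    exact: (measurableT_comp mZ measurable_fst).
  apply: measurableT_comp => //; apply: measurable_funM; last exact: measurable_snd.
  exact: (measurableT_comp ms measurable_fst).
have Phi0 x : (0 <= Phi x)%E by rewrite lee_fin mulr_ge0// expR_ge0.
have := freeze La Ia mPhi Phi0; rewrite /Phi /= => ->.
apply: eq_integral => w _.
under eq_integral do rewrite EFinM.
rewrite ge0_integralZl//.
- by rewrite gauss_mgf -EFinM.
- by apply/measurable_EFinP; apply: measurableT_comp => //; apply: measurable_funM.
- by rewrite lee_fin.
Qed.

(** Conditional Laplace transform of a Gaussian sum whose coefficients depend on [I] only. Variables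
    are integrated out one at a time, each leaving [expR (s a w ^+ 2 / 2)] in the weight [Z]; the
    arbitrary weight makes the induction close. *)
Lemma exp_sum (l : seq A) (I : pred A) (Z : Omega -> R) (s : A -> Omega -> R) :
  uniq l -> all L l -> all (predC I) l ->
  zmeas I Z -> (forall a, zmeas I (s a)) -> (forall w, 0 <= Z w) ->
  (\int[P]_w (Z w * expR (\sum_(a <- l) s a w * z a w))%:E =
   \int[P]_w (Z w * expR ((\sum_(a <- l) s a w ^+ 2) / 2))%:E)%E.
Proof.
elim: l Z => [|a l IH] Z /=.
  by move=> _ _ _ mZ ms Z0; apply: eq_integral => w _; rewrite !big_nil mul0r.
move=> /andP[al ul] /andP[La Ll] /andP[Ia Il] mZ ms Z0.
(* While [z a] is integrated out, the remaining variables of the list count as known. *)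
pose I' := [pred b | I b || (b \in l)].
have II' : {subset I <= I'} by move=> b Ib; rewrite inE; apply/orP; left.
have mS : zmeas I' (fun w => \sum_(b <- l) s b w * z b w).
  have mb b : b \in l -> zmeas I' (fun w => s b w * z b w).
    move=> bl; apply: measurable_funM; first exact: zalg_widen II' (ms b).
    by apply: zalg_z; [exact: (allP Ll) | rewrite inE bl orbT].
  have : {subset l <= l} by [].
  elim: {-2}l => [|b l' IHl] sub.
    rewrite (_ : (fun w => _) = fun=> 0); last by apply/funext => w; rewrite big_nil.
    exact: measurable_cst.
  rewrite (_ : (fun w => _) = fun w => s b w * z b w + \sum_(b <- l') s b w * z b w); last first.
    by apply/funext => w; rewrite big_cons.
  apply: measurable_funD; first by apply: mb; apply: sub; rewrite inE eqxx.
  by apply: IHl => c cl; apply: sub; rewrite inE cl orbT.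
have nIa : ~~ I' a by rewrite inE negb_or al andbT.
transitivity (\int[P]_w ((Z w * expR (\sum_(b <- l) s b w * z b w)) * expR (s a w * z a w))%:E)%E.
  by apply: eq_integral => w _; rewrite big_cons expRD [expR _ * _]mulrC mulrA.
have mZ' : zmeas I' (fun w => Z w * expR (\sum_(b <- l) s b w * z b w)).
  by apply: measurable_funM; [exact: zalg_widen II' mZ | exact: measurableT_comp].
have Z0' w : 0 <= Z w * expR (\sum_(b <- l) s b w * z b w) by rewrite mulr_ge0// expR_ge0.
rewrite (freeze_exp La nIa mZ' (zalg_widen II' (ms a)) Z0').
transitivity (\int[P]_w ((Z w * expR (s a w ^+ 2 / 2)) * expR (\sum_(b <- l) s b w * z b w))%:E)%E.
  by apply: eq_integral => w _; rewrite mulrAC.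
rewrite IH//.
- by apply: eq_integral => w _; rewrite big_cons mulrDl expRD mulrA.
- apply: measurable_funM => //; apply: measurableT_comp => //.
  apply: measurable_funM => //; exact: measurable_funX.
- by move=> w; rewrite mulr_ge0// expR_ge0.
Qed.

End freezing.

(** * Almost sure convergence along subsequences *)

Section subsequences.

Definition ssub (f : nat -> nat) := forall i j, (i < j)%N -> (f i < f j)%N.

Lemma ssub_id : ssub id. Proof. by []. Qed.

Lemma ssub_comp f g : ssub f -> ssub g -> ssub (f \o g).
Proof. by move=> sf sg i j ij; apply/sf/sg. Qed.

Lemma ssub_ge f n : ssub f -> (n <= f n)%N.
Proof. by move=> sf; elim: n => // n IH; apply: leq_ltn_trans IH (sf _ _ _). Qed.

Lemma ssub_cvg (X : topologicalType) (u : nat -> X) (l : X) f : ssub f ->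
  u @ \oo --> l -> (fun n => u (f n)) @ \oo --> l.
Proof.
move=> sf uc; apply: (cvg_comp f u _ uc) => A [N _ hN].
by exists N => // n /= Nn; apply: hN; apply: leq_trans Nn _; exact: ssub_ge.
Qed.

Lemma ssub_extract (Q : nat -> nat -> Prop) :
  (forall j, exists N, forall n, (N <= n)%N -> Q j n) ->
  exists f, ssub f /\ forall j, Q j (f j).
Proof.
move=> /choice [N hN].
pose f := fix f j := if j is j'.+1 then maxn (N j) (f j').+1 else N 0.
have fS j : (f j < f j.+1)%N by rewrite /= leq_max ltnSn orbT.
exists f; split.
  move=> i j; elim: j => // j IH; rewrite ltnS leq_eqVlt => /orP[/eqP->|/IH h]; first exact: fS.
  exact: ltn_trans h (fS j).
by case=> [|j]; apply: hN => //=; rewrite leq_maxl.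
Qed.

Lemma ssub_infinite (Q : nat -> Prop) : (forall N, exists2 n, (N <= n)%N & Q n) ->
  exists f, ssub f /\ forall j, Q (f j).
Proof.
move=> h; have h' N : exists n, (N <= n)%N /\ Q n by have [n] := h N; exists n.
have {h'} [c hc] := choice h'.
pose f := fix f j := if j is j'.+1 then c (f j').+1 else c 0.
have fS j : (f j < f j.+1)%N by have [] := hc (f j).+1.
exists f; split.
  move=> i j; elim: j => // j IH; rewrite ltnS leq_eqVlt => /orP[/eqP->|/IH h1]; first exact: fS.
  exact: ltn_trans h1 (fS j).
by case=> [|j] /=; [have [] := hc 0%N | have [] := hc (f j).+1].
Qed.

End subsequences.

Section measurable_limits.
Context {R : realType} {d1 : measure_display} {T1 : measurableType d1}.

(** A total limit operator that preserves measurability in parameters; by [rlimE] it is the true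
    limit wherever there is one. *)
Definition rlim (f : nat -> R) : R := fine (limn_esup (EFin \o f)).

Lemma rlimE (f : nat -> R) (l : R) : f @ \oo --> l -> rlim f = l.
Proof.
move=> fl; rewrite /rlim (_ : limn_esup _ = l%:E)//.
have := @cvg_limn_einf_sup R (EFin \o f) l%:E.
case; last by [].
by apply: cvg_EFin; [exact: nearW | exact: fl].
Qed.

Lemma measurable_rlim (f : nat -> T1 -> R) : (forall n, measurable_fun setT (f n)) ->
  measurable_fun setT (fun w => rlim (f ^~ w)).
Proof.
move=> mf; apply: measurableT_comp; first exact: fine_measurable.
by apply: measurable_fun_limn_esup => n; exact/measurable_EFinP.
Qed.

Lemma measurable_EE {d2 : measure_display} {T2 : measurableType d2} (mu : probability T2 R)
    (g : T1 -> T2 -> R) :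
  measurable_fun setT (fun p : T1 * T2 => g p.1 p.2) -> (forall w, bm (g w)) ->
  measurable_fun setT (fun w => EE mu (g w)).
Proof.
move=> mg bg.
have pos (h : T1 -> T2 -> R) : measurable_fun setT (fun p : T1 * T2 => h p.1 p.2) ->
    (forall w, bm (h w)) -> (forall w x, 0 <= h w x) -> measurable_fun setT (fun w => EE mu (h w)).
  move=> mh bh h0.
  rewrite (_ : (fun w => _) = fine \o (fubini_F mu (fun p : T1 * T2 => (h p.1 p.2)%:E))); last first.
    by [].
  apply: measurableT_comp; first exact: fine_measurable.
  apply: measurable_fun_fubini_tonelli_F; first exact/measurable_EFinP.
  by move=> p; rewrite lee_fin.
(* Tonelli's measurability is for nonnegative integrands, and both of these are nonnegative. *)
rewrite (_ : (fun w => _) = fun w => EE mu (fun x => `|g w x| + g w x) - EE mu (fun x => `|g w x|)).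
  apply: measurable_funB.
    apply: pos.
    - apply: measurable_funD => //; exact: measurableT_comp mg.
    - by move=> w; bm_tac.
    - by move=> w x; have := ler_norm (- g w x); rewrite normrN; lra.
  apply: pos => //; first exact: measurableT_comp mg.
  by move=> w; bm_tac.
by apply/funext => w; rewrite -EEB; try bm_tac; apply: EE_ext => x; ring.
Qed.

End measurable_limits.

Section ae_subsequences.
Context {R : realType} {dO : measure_display} {Omega : measurableType dO}.
Variable P : probability Omega R.

(** Convergence to 0 in probability in subsequence form. It makes sense without measurability of
    [Q], and the errors against the SPDE solution are not known to be measurable in the sample
    point. *)
Definition asub (Q : nat -> Omega -> R) : Prop := forall psi, ssub psi ->
  exists phi, ssub phi /\ {ae P, forall w, (fun j => Q (psi (phi j)) w) @ \oo --> (0 : R)}.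

Lemma ae_ssub (Q : nat -> Omega -> R) phi : ssub phi ->
  {ae P, forall w, Q ^~ w @ \oo --> (0 : R)} ->
  {ae P, forall w, (fun j => Q (phi j) w) @ \oo --> (0 : R)}.
Proof. by move=> sphi; apply: filterS => w; exact: ssub_cvg. Qed.

Lemma asub2 Q Q' psi : asub Q -> asub Q' -> ssub psi -> exists phi, [/\ ssub phi,
  {ae P, forall w, (fun j => Q (psi (phi j)) w) @ \oo --> (0 : R)} &
  {ae P, forall w, (fun j => Q' (psi (phi j)) w) @ \oo --> (0 : R)}].
Proof.
move=> hQ hQ' spsi; have [f [sf h]] := hQ _ spsi.
have [g [sg h']] := hQ' _ (ssub_comp spsi sf).
exists (f \o g); split=> //; first exact: ssub_comp.
exact: (ae_ssub (Q := fun j w => Q (psi (f j)) w) sg).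
Qed.

(* [X] is only bounded in mean; along a subsequence on which [y] is summably
   small the product still vanishes. *)
Lemma tight_product (y : nat -> Omega -> R) (X : nat -> Omega -> \bar R) (C : R) :
  (forall n, measurable_fun setT (y n)) -> (forall n, measurable_fun setT (X n)) ->
  (forall n w, 0 <= X n w)%E -> (forall n, \int[P]_w X n w <= C%:E)%E ->
  {ae P, forall w, y ^~ w @ \oo --> (0 : R)} ->
  exists phi, ssub phi /\ {ae P, forall w, (forall j, X (phi j) w \is a fin_num) /\
     (fun j => y (phi j) w * fine (X (phi j) w)) @ \oo --> (0 : R)}.
Proof.
move=> my mX X0 XC y0.
have C0 : 0 <= C by rewrite -lee_fin (le_trans _ (XC 0%N))// integral_ge0.
(* Truncation at 1 allows dominated convergence for a [y] without moments; the factor [8 ^+ j] is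
   the rate left at the end. *)
pose y' j n w : R := Num.min (8 ^+ j * `|y n w|) 1.
have y'0 j n w : 0 <= y' j n w by rewrite le_min ler01 andbT mulr_ge0.
have y'1 j n w : y' j n w <= 1 by rewrite ge_min lexx orbT.
have by' j n : bm (y' j n).
  split; last by exists 1 => w; rewrite ger0_norm.
  apply: measurable_minr => //; apply: measurable_funM => //.
  exact: measurableT_comp (my n).
have cy' j : (fun n => EE P (y' j n)) @ \oo --> (0 : R).
  rewrite -[X in _ --> X](EE_cst P 0).
  apply: (@EE_dct_ae _ _ _ P _ _ 1) => //; [by move=> n w; rewrite ger0_norm|exact: bm_cst|].
  apply: filterS y0 => w yw.
  apply: (@squeeze_cvgr _ _ _ _ (fun=> 0) (fun n => 8 ^+ j * `|y n w|)).
  - by apply: nearW => n; rewrite y'0 /= ge_min lexx.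
  - exact: cvg_cst.
  - rewrite -[X in _ --> X](mulr0 (8 ^+ j)); apply: cvgMr.
    by rewrite -[X in _ --> X](@normr0 R R); apply: cvg_norm.
have [phi [sphi hphi]] : exists phi, ssub phi /\
    forall j, EE P (y' j (phi j)) <= ((2 ^ j.+1)%:R ^+ 2)^-1.
  apply: (ssub_extract (Q := fun j n => EE P (y' j n) <= ((2 ^ j.+1)%:R ^+ 2)^-1)) => j.
  have /cvgrPdist_le/(_ _)/= := cy' j.
  have e0 : (0 : R) < ((2 ^ j.+1)%:R ^+ 2)^-1 by rewrite invr_gt0 exprn_gt0// ltr0n expn_gt0.
  move=> /(_ _ e0) [N _ hN]; exists N => n Nn.
  by have := hN n Nn; rewrite /= sub0r normrN; apply: le_trans; rewrite ler_norm.
exists phi; split=> //.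
have p2 j : (0 : R) < (2 ^ j.+1)%:R by rewrite ltr0n expn_gt0.
(* Both terms have mean of order 2^{-j}, so the series is almost surely finite. Its sum [M] bounds
   [y'] by M / 2^{j+1} and [X] by 2^{j+1} M, and the powers of 2 cancel in the product. *)
pose f j w : \bar R := (((2 ^ j.+1)%:R * y' j (phi j) w)%:E + ((2 ^ j.+1)%:R^-1)%:E * X (phi j) w)%E.
have m1 j : measurable_fun setT (fun w => ((2 ^ j.+1)%:R * y' j (phi j) w)%:E : \bar R).
  by apply/measurable_EFinP; apply: measurable_funM => //; exact: (by' _ _).1.
have m2 j : measurable_fun setT (fun w => ((2 ^ j.+1)%:R^-1)%:E * X (phi j) w)%E.
  by apply: emeasurable_funM => //; exact: measurable_cst.
have f1 j w : (0 <= ((2 ^ j.+1)%:R * y' j (phi j) w)%:E)%E by rewrite lee_fin mulr_ge0// ltW.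
have f2 j w : (0 <= ((2 ^ j.+1)%:R^-1)%:E * X (phi j) w)%E.
  by rewrite mule_ge0// lee_fin invr_ge0 ltW.
have f0 j w : (0 <= f j w)%E by rewrite adde_ge0.
have mf j : measurable_fun setT (f j) by exact: emeasurable_funD.
have intf j : (\int[P]_w f j w <= ((1 + C) / (2 ^ j.+1)%:R)%:E)%E.
  have i0 : (0 : R) <= (2 ^ j.+1)%:R^-1 by rewrite invr_ge0 ltW.
  rewrite /f ge0_integralD// ge0_integralZl_EFin//.
  rewrite EE_EFin; last by apply: bmM => //; exact: bm_cst.
  rewrite EEZ// mulrDl mul1r EFinD; apply: leeD.
    rewrite lee_fin -ler_pdivlMl// (le_trans (hphi j))//.
    by rewrite -expr2 exprVn.
  by rewrite EFinM muleC; apply: lee_wpmul2r.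
pose Z w := (\sum_(0 <= j <oo) f j w)%E.
have Z0 w : (0 <= Z w)%E by apply: nneseries_ge0.
have mZ : measurable_fun setT Z.
  rewrite (_ : Z = fun w => \sum_(0 <= j <oo | j \in xpredT) f j w)%E.
    by apply: ge0_emeasurable_sum.
  by apply/funext => w; apply: eq_eseriesl => j.
have intZ : (\int[P]_w Z w <= (1 + C)%:E)%E.
  rewrite integral_nneseries//.
  apply: (@le_trans _ _ (\sum_(0 <= j <oo) ((1 + C) / (2 ^ j.+1)%:R)%:E)%E).
    by apply: lee_nneseries => // j _ _; rewrite integral_ge0.
  by apply: epsilon_trick0; lra.
have iZ : P.-integrable setT Z.
  apply/integrableP; split => //.
  under eq_integral do rewrite gee0_abs//.
  by rewrite (le_lt_trans intZ)// ltry.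
have := integrable_ae measurableT iZ.
apply: filterS => w /(_ I) Zw.
have fZ j : (f j w <= Z w)%E.
  apply: (le_trans _ (@nneseries_lim_ge _ (f ^~ w) xpredT 0 j.+1 _)) => //.
  by rewrite big_nat_recr//= leeDr// sume_ge0.
pose M := fine (Z w).
have fM j : (f j w <= M%:E)%E by rewrite fineK.
have M0 : 0 <= M by rewrite fine_ge0.
have XM j : (X (phi j) w <= ((2 ^ j.+1)%:R * M)%:E)%E.
  have := le_trans (leeDr _ (f1 j w)) (fM j).
  by rewrite lee_pdivrMl.
have yM j : (2 ^ j.+1)%:R * y' j (phi j) w <= M.
  by rewrite -lee_fin (le_trans _ (fM j))// leeDl.
have finX j : X (phi j) w \is a fin_num.
  by rewrite ge0_fin_numE// (le_lt_trans (XM j))// ltry.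
split => //.
apply: (@squeeze_cvgr _ _ _ _ (fun j => - (M ^+ 2 * (1 / 8) ^+ j)) (fun j => M ^+ 2 * (1 / 8) ^+ j)).
- have [K MK] : exists K : nat, M < K%:R.
    by exists (Num.bound M); exact: archi_boundP.
  exists K => // j /= Kj; rewrite -ler_norml normrM.
  have jM : M < (2 ^ j.+1)%:R.
    rewrite (lt_le_trans MK)// ler_nat (leq_trans Kj)// (leq_trans (leqnSn j))//.
    exact: ltnW (ltn_expl _ _).
  (* Once 2^{j+1} exceeds [M] the truncation is inactive. *)
  have y1 : y' j (phi j) w < 1.
    rewrite ltNge; apply/negP => y1.
    have := le_lt_trans (yM j) jM; rewrite ltNge => /negP; apply.
    by rewrite ler_peMr// ltW.
  have yE : y' j (phi j) w = 8 ^+ j * `|y (phi j) w|.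
    by move: y1; rewrite /y' /Num.min; case: ifP; rewrite ?ltxx.
  have XM' : `|fine (X (phi j) w)| <= (2 ^ j.+1)%:R * M.
    by rewrite ger0_norm ?fine_ge0// -lee_fin fineK.
  have e8 : (0 : R) < 8 ^+ j by rewrite exprn_gt0.
  have -> : M ^+ 2 * (1 / 8) ^+ j = (M / ((2 ^ j.+1)%:R * 8 ^+ j)) * ((2 ^ j.+1)%:R * M).
    by rewrite exprMn expr1n mul1r exprVn; field; rewrite !gt_eqF.
  apply: ler_pM => //.
  by rewrite ler_pdivlMr ?mulr_gt0//; have := yM j; rewrite yE; lra.
- rewrite -[X in _ --> X]oppr0; apply: cvgN.
  rewrite -[X in _ --> X](mulr0 (M ^+ 2)); apply: cvgMr; apply: cvg_expr.
  by rewrite ger0_norm; lra.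
- rewrite -[X in _ --> X](mulr0 (M ^+ 2)); apply: cvgMr; apply: cvg_expr.
  by rewrite ger0_norm; lra.
Qed.

(** The measurable version [q] supplies the sets, enlarged by the null set where [x] and [q] differ.
    Their probability is at most the mean of min(|q|/e, 1); were these means not to vanish, a
    subsequence would stay above some [eta], against dominated convergence along an almost surely
    convergent further subsequence. *)
Lemma asub_prob (x : nat -> Omega -> R) (q : nat -> Omega -> R) (e : R) : 0 < e ->
  (forall n w, 0 <= x n w) ->
  (forall n, measurable_fun setT (q n)) -> (forall n, {ae P, forall w, x n w = q n w}) ->
  asub x -> exists A : nat -> set Omega, [/\ forall n, measurable (A n),
    forall n, [set w | e < x n w] `<=` A n & (fun n => P (A n)) @ \oo --> 0%E].
Proof.
move=> e0 x0 mq xq hx.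
have /choice [N hN] : forall n, exists N, [/\ measurable N, P N = 0%E & ~` [set w | x n w = q n w] `<=` N].
  by move=> n; have [N [mN PN sN]] := xq n; exists N; split.
pose A n := N n `|` q n @^-1` `]e, +oo[.
have mq' n : measurable (q n @^-1` `]e, +oo[) by rewrite -[X in measurable X]setTI; exact: mq.
have mA n : measurable (A n) by apply: measurableU => //; have [] := hN n.
exists A; split => //.
  move=> n w /= ew; have [xqw|xqw] := pselect (x n w = q n w).
    by right; rewrite /= in_itv /= andbT -xqw.
  by left; have [_ _] := hN n; apply.
have PA n : P (A n) = P (q n @^-1` `]e, +oo[).
  have [mN PN _] := hN n.
  apply/eqP; rewrite eq_le; apply/andP; split.
    have h : (P (N n `|` q n @^-1` `]e, +oo[) <= P (N n) + P (q n @^-1` `]e, +oo[))%E.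
      exact: measureU2.
    by apply: (le_trans h); rewrite PN add0e.
  by apply: le_measure; rewrite ?inE//; right.
pose q' n w : R := Num.min (`|q n w| / e) 1.
have q'0 n w : 0 <= q' n w by rewrite le_min ler01 andbT divr_ge0// ltW.
have q'1 n w : q' n w <= 1 by rewrite ge_min lexx orbT.
have bq' n : bm (q' n).
  split; last by exists 1 => w; rewrite ger0_norm.
  apply: measurable_minr => //; apply: measurable_funM => //.
  exact: measurableT_comp (mq n).
have PAq n : (P (A n) <= (EE P (q' n))%:E)%E.
  have bi : bm (\1_(q n @^-1` `]e, +oo[) : Omega -> R) by exact: bm_indic.
  have -> : P (A n) = (EE P (\1_(q n @^-1` `]e, +oo[)))%:E.
    by rewrite PA -EE_EFin// integral_indic// setIT.
  rewrite lee_fin; apply: EE_le => // w.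
  rewrite indicE; case: (boolP (w \in _)) => // /set_mem /=.
  rewrite in_itv /= andbT => ew; rewrite le_min lexx andbT ler_pdivlMr// mul1r.
  by rewrite (le_trans (ltW ew))// ler_norm.
suff cq : (fun n => EE P (q' n)) @ \oo --> (0 : R).
  apply: (squeeze_cvge (f := fun=> 0%E) (h := fun n => (EE P (q' n))%:E)).
  - by apply: nearW => n; rewrite measure_ge0 PAq.
  - exact: cvg_cst.
  - by apply: cvg_EFin; [exact: nearW | exact: cq].
apply: contrapT => ncq.
have [eta [eta0 heta]] : exists eta, 0 < eta /\
   forall K, exists2 n, (K <= n)%N & eta < EE P (q' n).
  apply: contrapT => hno; apply: ncq; apply/cvgrPdist_le => eta eta0.
  apply: contrapT => hn; apply: hno; exists eta; split => // K.
  apply: contrapT => hK; apply: hn; exists K => // n /= Kn.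
  rewrite sub0r normrN ger0_norm ?EE_ge0// leNgt; apply/negP => h.
  by apply: hK; exists n.
have [psi [spsi hpsi]] := ssub_infinite heta.
have [phi [sphi hphi]] := hx _ spsi.
have : (fun j => EE P (q' (psi (phi j)))) @ \oo --> (0 : R).
  rewrite -[X in _ --> X](EE_cst P 0).
  apply: (@EE_dct_ae _ _ _ P _ _ 1) => //; [by move=> n w; rewrite ger0_norm|exact: bm_cst|].
  have xq' := ae_foralln xq.
  apply: filterS2 xq' hphi => w xqw xw.
  apply: (@squeeze_cvgr _ _ _ _ (fun=> 0) (fun j => e^-1 * x (psi (phi j)) w)).
  - apply: nearW => j; rewrite q'0 /= ge_min -xqw ger0_norm//.
    by rewrite mulrC lexx.
  - exact: cvg_cst.
  - by rewrite -[X in _ --> X](mulr0 e^-1); apply: cvgMr.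
move=> /cvgrPdist_le /(_ _ eta0) [K _ /(_ K (leqnn K))].
rewrite /= sub0r normrN ger0_norm ?EE_ge0// leNgt => /negP; apply; exact: hpsi.
Qed.

End ae_subsequences.

(** * Moments of conditionally Gaussian sums *)

Section moments.
Context {R : realType} {dO : measure_display} {Omega : measurableType dO}.
Variable P : probability Omega R.
Variables (A : choiceType) (z : A -> Omega -> R) (L : pred A).
Hypothesis mz : forall a, L a -> measurable_fun setT (z a).
Hypothesis lawz : forall a, L a -> forall B : set R, measurable B ->
  P (z a @^-1` B) = normal_prob 0 1 B.
Hypothesis indz : forall s : seq A, uniq s -> all L s -> forall B : A -> set R,
  (forall a, measurable (B a)) ->
  P (\bigcap_(a in [set` s]) (z a @^-1` B a)) = (\prod_(a <- s) P (z a @^-1` B a))%E.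
Local Notation zmeas I := (@measurable_fun _ _ (zalg z L I) R setT).

Variables (l : seq A) (I : pred A) (s : A -> Omega -> R).
Hypothesis ul : uniq l.
Hypothesis Ll : all L l.
Hypothesis Il : all (predC I) l.
Hypothesis ms : forall a, zmeas I (s a).

Let S w := \sum_(a <- l) s a w * z a w.
Let v w := \sum_(a <- l) s a w ^+ 2.

Lemma measurable_gauss_sum : measurable_fun setT S.
Proof.
have h a : a \in l -> measurable_fun setT (fun w => s a w * z a w).
  move=> al; apply: measurable_funM; first exact: (zalg_fun mz (ms a)).
  by apply: mz; exact: (allP Ll).
rewrite /S; have : {subset l <= l} by [].
elim: {-2}l => [|b l' IHl] sub.
  by under eq_fun do rewrite big_nil; exact: measurable_cst.
under eq_fun do rewrite big_cons.
apply: measurable_funD; first by apply: h; apply: sub; rewrite inE eqxx.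
by apply: IHl => c cl; apply: sub; rewrite inE cl orbT.
Qed.

Lemma zmeas_sum_sqr : zmeas I v.
Proof.
rewrite /v; elim: l => [|b l' IHl].
  by under eq_fun do rewrite big_nil; exact: measurable_cst.
under eq_fun do rewrite big_cons.
by apply: measurable_funD => //; exact: measurable_funX.
Qed.

Let v0 w : 0 <= v w. Proof. by apply: sumr_ge0 => a _; exact: sqr_ge0. Qed.

(* Normalised by its conditional variance, [S] has bounded exponential
   moments, and [x ^+ 2 <= 4 * (expR x + expR (- x))]; integrability of [S]
   itself is never needed. *)
Lemma second_moment (Z : Omega -> R) (eta : R) : zmeas I Z -> (forall w, 0 <= Z w) -> 0 < eta ->
  (\int[P]_w (Z w * S w ^+ 2)%:E <= 16%:E * \int[P]_w (Z w * (v w + eta))%:E)%E.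
Proof.
move=> mZ Z0 eta0; have mv := zmeas_sum_sqr.
have ve w : 0 < v w + eta by rewrite ltr_wpDl.
(* Inverse square root of the regularised variance, written so that measurability is evident; [eta]
   keeps it meaningful where [v] vanishes. *)
pose q w := expR (- (ln (v w + eta) / 2)).
have q2 w : q w ^+ 2 = (v w + eta)^-1.
  by rewrite expr2 -expRD -opprD -splitr expRN lnK// posrE.
have mq : zmeas I q.
  apply: measurableT_comp => //; apply: measurableT_comp => //; apply: measurable_funM => //.
  apply: measurableT_comp; first exact: measurable_ln.
  exact: measurable_funD.
pose Z' w := Z w * (v w + eta).
have mZ' : zmeas I Z' by apply: measurable_funM => //; exact: measurable_funD.
have Z'0 w : 0 <= Z' w by rewrite mulr_ge0// ltW.
have mZO := zalg_fun mz mZ'.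
have mqO := zalg_fun mz mq.
have mS := measurable_gauss_sum.
have mZO1 := zalg_fun mz mZ.
have mvO := zalg_fun mz mv.
(* The sum times [q] has conditional variance at most 1, so its exponential moment is at most exp
   (1/2) <= 2 for either sign [e]; together with the factor 4 of [bound] this gives 16 = 4 (2 +
   2). *)
have half (e : R) : e ^+ 2 = 1 ->
    (\int[P]_w (Z' w * expR (e * (q w * S w)))%:E <= 2%:E * \int[P]_w (Z' w)%:E)%E.
  move=> e1.
  have := exp_sum mz lawz indz ul Ll Il mZ' (s := fun a w => e * q w * s a w) _ Z'0.
  have -> : (fun w => (Z' w * expR (\sum_(a <- l) e * q w * s a w * z a w))%:E)
     = (fun w => (Z' w * expR (e * (q w * S w)))%:E).
    apply/funext => w; congr (_ * expR _)%:E.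
    by rewrite mulrA mulr_sumr; apply: eq_bigr => a _; rewrite mulrA.
  move=> ->; last by move=> a; apply: measurable_funM => //; exact: measurable_funM.
  rewrite -ge0_integralZl_EFin//; last 2 first.
  - by move=> w _; rewrite lee_fin.
  - exact/measurable_EFinP.
  apply: ge0_le_integral => //.
  - by move=> w _; rewrite lee_fin mulr_ge0// expR_ge0.
  - apply/measurable_EFinP; apply: measurable_funM => //; apply: measurableT_comp => //.
    apply: measurable_funM => //.
    rewrite (_ : (fun w => _) = fun w => (e * q w) ^+ 2 * v w).
      apply: measurable_funM; last exact: mvO.
      by apply: measurable_funX; exact: measurable_funM.
    by apply/funext => w; rewrite mulr_sumr; apply: eq_bigr => a _; rewrite exprMn.
  - by apply/measurable_EFinP; exact: measurable_funM.
  move=> w _; rewrite -EFinM lee_fin mulrC; apply: ler_wpM2r => //.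
  apply: (@le_trans _ _ (expR (1 / 2))).
    rewrite ler_expR ler_pM2r//.
    under eq_bigr do rewrite exprMn.
    rewrite -mulr_sumr exprMn e1 mul1r q2 ler_pdivrMl// mulr1.
    by rewrite -/(v w) lerDl ltW.
  have e12 : (1 / 2 : R) <= expR (- (1 / 2)).
    by rewrite (le_trans _ (expR_ge1Dx _))//; lra.
  have := expRxMexpNx_1 (1 / 2 : R); have := expR_gt0 (1 / 2 : R).
  by set E := expR (1 / 2) in e12 *; set F := expR _ in e12 *; nra.
have bound w : Z w * S w ^+ 2 <=
    4 * (Z' w * expR (1 * (q w * S w)) + Z' w * expR (- 1 * (q w * S w))).
  have -> : Z w * S w ^+ 2 = Z' w * (q w * S w) ^+ 2.
    by rewrite exprMn q2 /Z'; field; rewrite gt_eqF.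
  set x := q w * S w; rewrite mul1r mulN1r.
  have -> : 4 * (Z' w * expR x + Z' w * expR (- x)) = Z' w * (4 * (expR x + expR (- x))) by ring.
  apply: ler_wpM2l => //.
  have key (y : R) : 0 <= y -> y ^+ 2 <= 4 * expR y.
    move=> y0; have h := expR_ge1Dx (y / 2); rewrite [y in expR y]splitr expRD.
    have h2 : (1 + y / 2) ^+ 2 <= expR (y / 2) ^+ 2 by rewrite lerXn2r// nnegrE; lra.
    by rewrite -expr2; nra.
  have e1 := expR_ge0 x; have e2 := expR_ge0 (- x).
  have [x0|x0] := leP 0 x; first by have := key x x0; lra.
  have xN : 0 <= - x by lra.
  by have := key (- x) xN; rewrite sqrrN; lra.
have mE (e : R) : measurable_fun setT (fun w => (Z' w * expR (e * (q w * S w)))%:E : \bar R).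
  apply/measurable_EFinP; apply: measurable_funM => //; apply: measurableT_comp => //.
  by apply: measurable_funM => //; exact: measurable_funM.
have E0 (e : R) w : (0 <= (Z' w * expR (e * (q w * S w)))%:E)%E.
  by rewrite lee_fin mulr_ge0// expR_ge0.
apply: (@le_trans _ _ (\int[P]_w (4%:E *
    ((Z' w * expR (1 * (q w * S w)))%:E + (Z' w * expR (- 1 * (q w * S w)))%:E)))%E).
  apply: ge0_le_integral => //.
  - by move=> w _; rewrite lee_fin mulr_ge0// sqr_ge0.
  - apply/measurable_EFinP; apply: measurable_funM => //.
    exact: measurable_funX.
  - by apply: emeasurable_funM => //; exact: emeasurable_funD.
  - by move=> w _; rewrite -EFinD -EFinM lee_fin; exact: bound.
rewrite ge0_integralZl_EFin//; first last.
- exact: emeasurable_funD.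
- by move=> w _; exact: adde_ge0.
rewrite ge0_integralD// -/Z'.
have h1 := half 1 (expr1n _ _); have h2 := half (- 1) (_ : _ = 1).
have {}h2 := h2 (sqrr_sign _ 1).
apply: (@le_trans _ _ (4%:E * (2%:E * \int[P]_w (Z' w)%:E + 2%:E * \int[P]_w (Z' w)%:E))%E).
  by apply: lee_wpmul2l; rewrite ?lee_fin//; exact: leeD.
rewrite -ge0_muleDl ?lee_fin// -EFinD muleA -EFinM (_ : 4 * (2 + 2) = 16 :> R) ?lexx//.
by ring.
Qed.

(** The weight in [exp_sum] is chosen to cancel the conditional Laplace transform, so the mean is
    exactly 1 even though [v] is random and has no a priori bound. *)
Lemma exp_moment (a : R) :
  (\int[P]_w (expR (a * S w - a ^+ 2 * v w / 2))%:E = 1%:E)%E.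
Proof.
have mv := zmeas_sum_sqr.
pose Z w := expR (- (a ^+ 2 * v w / 2)).
have mZ : zmeas I Z.
  apply: measurableT_comp => //; apply: measurableT_comp => //; apply: measurable_funM => //.
  exact: measurable_funM.
have := exp_sum mz lawz indz ul Ll Il mZ (s := fun b w => a * s b w) _ (fun w => expR_ge0 _).
have -> : (fun w => (Z w * expR (\sum_(b <- l) a * s b w * z b w))%:E)
     = (fun w => (expR (a * S w - a ^+ 2 * v w / 2))%:E).
  apply/funext => w; rewrite /Z -expRD; congr (expR _)%:E; rewrite addrC; congr (_ - _).
  by rewrite mulr_sumr; apply: eq_bigr => b _; rewrite mulrA.
move=> ->; last by move=> b; exact: measurable_funM.
rewrite (_ : (fun w => _) = fun=> 1%:E); first by rewrite integral_cst//= probability_setT mul1e.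
apply/funext => w; rewrite /Z -expRD.
under eq_bigr do rewrite exprMn.
by rewrite -mulr_sumr addNr expR0.
Qed.

End moments.

(** * Powers of kappa and the discrete solution operator *)

Section kappa_powers.
Context {R : realType}.
Variables (kappa : R -> R) (c1 c2 a1 a2 : R).
Hypothesis kpos : forall t, 0 < kappa t.
Hypothesis kder : forall t, derivable kappa t 1.
Hypothesis c10 : 0 < c1.
Hypothesis c20 : 0 < c2.
Hypothesis a10 : 0 < a1.
Hypothesis a20 : 0 < a2.
Hypothesis klow : forall t, c1 * expR (- (a1 * `|t|)) <= kappa t.
Hypothesis kup : forall t, kappa t <= c2 * expR (a2 * `|t|).
Hypothesis kder_up : forall t, `|derive1 kappa t| <= c2 * expR (a2 * `|t|).

Definition kp (s t : R) : R := kappa t `^ s.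

Lemma kpE s t : kp s t = expR (s * ln (kappa t)).
Proof. by rewrite /kp /powR gt_eqF. Qed.

Lemma kp_gt0 s t : 0 < kp s t.
Proof. by rewrite kpE expR_gt0. Qed.

Lemma kpD s s' t : kp s t * kp s' t = kp (s + s') t.
Proof. by rewrite !kpE -expRD -mulrDl. Qed.

Lemma kp2E t : kp 2 t = kappa t ^+ 2.
Proof. by rewrite /kp powR_mulrn// ltW. Qed.

Lemma is_derive_kp s t :
  is_derive t (1 : R) (kp s) (kp s t * (s * ((kappa t)^-1 * derive1 kappa t))).
Proof.
rewrite (_ : kp s = expR \o (fun y => s * ln (kappa y))); last by apply/funext => y; rewrite kpE.
apply: is_derive1_comp.
have dk : is_derive t (1 : R) kappa (derive1 kappa t).
  by rewrite derive1E; apply: derivableP; exact: kder.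
have dl : is_derive t (1 : R) (fun y => ln (kappa y)) ((kappa t)^-1 * derive1 kappa t).
  by apply: (@is_derive1_comp _ (@ln R) kappa); exact: is_derive1_ln.
have := is_deriveZ s dl; exact.
Qed.

Lemma continuous_kp s : continuous (kp s).
Proof.
move=> t; apply: differentiable_continuous; apply/derivable1_diffP.
have h := is_derive_kp s t; exact: ex_derive.
Qed.

Lemma bm_kp {dT : measure_display} {T : measurableType dT} s (v : T -> R) :
  bm v -> bm (fun x => kp s (v x)).
Proof. by move=> bv; apply: bm_comp => //; exact: continuous_kp. Qed.

(** The lower bound is the upper bound for the power [- s], because the two powers multiply to 1. *)
Lemma kp_bounds {dT : measure_display} {T : measurableType dT} s (v : T -> R) : bm v ->
  exists dl K, [/\ 0 < dl, dl <= K, forall x, dl <= kp s (v x) & forall x, `|1 - kp s (v x)| <= K].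
Proof.
move=> bv.
have [_ [M hM]] := bm_kp (- s) bv.
have [_ [K hK]] := bm_kp s bv.
exists (1 + `|M|)^-1, (1 + `|K| + 1).
have M1 : 0 < 1 + `|M| by rewrite ltr_pwDl.
split.
- by rewrite invr_gt0.
- by apply: (@le_trans _ _ 1); [rewrite invf_le1// lerDl | rewrite lerDr addr_ge0].
- move=> x; rewrite -[_^-1]mul1r ler_pdivrMr//.
  have e : kp (- s) (v x) * kp s (v x) = 1 by rewrite kpD addNr /kp powRr0.
  have q : kp (- s) (v x) <= 1 + `|M|.
    have := hM x; have := ler_norm M; have := ler_norm (kp (- s) (v x)); lra.
  by have := ler_wpM2r (ltW (kp_gt0 s (v x))) q; rewrite e mulrC.
- move=> x; have := hK x; have := ler_norm K; have := ler_normB 1 (kp s (v x)).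
  rewrite normr1; lra.
Qed.

(** Mean value theorem for s kappa^s kappa' / kappa. In the exponent [b], [s * a2] comes from the
    power, [a2] from the derivative and [a1] from the lower bound in the denominator; [D] collects
    the prefactors. *)
Lemma kp_lip s : 0 <= s -> exists C b : R, [/\ 0 <= C, 0 <= b &
  forall x y, (kp s x - kp s y) ^+ 2 <= C * (x - y) ^+ 2 * expR (b * (`|x| + `|y|))].
Proof.
move=> s0.
pose D := s * expR (s * ln c2) * c2 / c1.
pose b := s * a2 + a2 + a1.
have D0 : 0 <= D by rewrite divr_ge0 ?(ltW c10)// mulr_ge0 ?(ltW c20)// mulr_ge0// expR_ge0.
have b0 : 0 <= b by rewrite /b !addr_ge0 ?mulr_ge0// ltW.
have hd t : `|kp s t * (s * ((kappa t)^-1 * derive1 kappa t))| <= D * expR (b * `|t|).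
  rewrite !normrM normfV (ger0_norm (ltW (kp_gt0 s t))) (ger0_norm s0) (gtr0_norm (kpos t)).
  have h1 : kp s t <= expR (s * ln c2) * expR (s * a2 * `|t|).
    rewrite kpE -expRD ler_expR -mulrA -mulrDr; apply: ler_wpM2l => //.
    rewrite -[X in _ <= _ + X]expRK -lnM ?posrE// ?expR_gt0//.
    by rewrite ler_ln ?posrE ?mulr_gt0 ?expR_gt0.
  have h2 : (kappa t)^-1 <= c1^-1 * expR (a1 * `|t|).
    rewrite -[X in _ <= X]invrK invfM invrK -expRN lef_pV2 ?posrE// mulr_gt0// ?expR_gt0//.
  have -> : D * expR (b * `|t|) = (expR (s * ln c2) * expR (s * a2 * `|t|)) *
     (s * (c1^-1 * expR (a1 * `|t|) * (c2 * expR (a2 * `|t|)))).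
    by rewrite /b !mulrDl !expRD /D; ring.
  apply: ler_pM => //; first exact/ltW/kp_gt0.
    by rewrite mulr_ge0// mulr_ge0// invr_ge0 ltW.
  apply: ler_wpM2l => //; apply: ler_pM => //.
  by rewrite invr_ge0 ltW.
have key x y : x <= y -> `|kp s y - kp s x| <= D * expR (b * (`|x| + `|y|)) * (y - x).
  move=> xy.
  have [||c cxy ->] := @MVT_segment _ (kp s) (fun t => kp s t * (s * ((kappa t)^-1 * derive1 kappa t))) x y xy.
  - by move=> t _; exact: is_derive_kp.
  - by apply: continuous_subspaceT; exact: continuous_kp.
  rewrite normrM [`|y - x|]ger0_norm ?subr_ge0//; apply: ler_wpM2r; first by rewrite subr_ge0.
  apply: (le_trans (hd c)); apply: ler_wpM2l => //; rewrite ler_expR; apply: ler_wpM2l => //.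
  move: cxy; rewrite in_itv /= => /andP[xc cy].
  rewrite ler_norml; have := ler_norm x; have := ler_norm y; have := ler_norm (- x).
  by have := ler_norm (- y); rewrite !normrN => ????; apply/andP; split; lra.
exists (D ^+ 2), (2 * b); split; rewrite ?sqr_ge0//; first by rewrite mulr_ge0.
move=> x y.
have gen x' y' : x' <= y' -> (kp s x' - kp s y') ^+ 2 <=
    D ^+ 2 * (x' - y') ^+ 2 * expR (2 * b * (`|x'| + `|y'|)).
  move=> xy; have h := key _ _ xy.
  have -> : D ^+ 2 * (x' - y') ^+ 2 * expR (2 * b * (`|x'| + `|y'|)) =
     (D * expR (b * (`|x'| + `|y'|)) * (y' - x')) ^+ 2.
    have -> : expR (2 * b * (`|x'| + `|y'|)) = expR (b * (`|x'| + `|y'|)) ^+ 2.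
      by rewrite expr2 -expRD; congr expR; ring.
    by ring.
  rewrite -normrN opprB in h; rewrite -(real_normK (num_real (kp s x' - kp s y'))).
  by rewrite lerXn2r// nnegrE ?normr_ge0// (le_trans _ h).
have [xy|yx] := leP x y; first exact: gen.
have e1 : (kp s x - kp s y) ^+ 2 = (kp s y - kp s x) ^+ 2 by ring.
have e2 : (x - y) ^+ 2 = (y - x) ^+ 2 by ring.
by rewrite e1 e2 [`|x| + _]addrC; apply: gen; exact: ltW.
Qed.

(** The order of quantifiers matters: exponential moments are controlled for an exponent [b] fixed
    in advance, while the sup bound [K] of the limit, and with it [C], depends on the sample
    point. *)
Lemma kp_L2_lip s : 0 <= s -> exists b : R, forall K : R, 0 <= K -> exists C : R, 0 <= C /\
  forall (dT : measure_display) (T : measurableType dT) (mu : probability T R) (u U : T -> R),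
  bm u -> bm U -> (forall x, `|U x| <= K) ->
  EE mu (fun x => (kp s (u x) - kp s (U x)) ^+ 2) ^+ 2 <=
    C * EE mu (fun x => (u x - U x) ^+ 2) *
    EE mu (fun x => expR (b * u x) + expR (- b * u x)).
Proof.
move=> s0; have [C [b [C0 b0 hC]]] := kp_lip s0.
exists (2 * b + 2) => K K0.
exists ((C * expR (b * K)) ^+ 2 * expR (2 * K)); split.
  by rewrite mulr_ge0// ?sqr_ge0// expR_ge0.
move=> dT T mu u U bu bU UK.
have cexp : continuous (@expR R) by exact: continuous_expR.
have bexp (f : T -> R) : bm f -> bm (fun x => expR (f x)) by move=> bf; apply: bm_comp.
(* One factor of the square stays small in L^2; the other, at most exp (|u| + K), joins the
   exponential weight, whence the exponent [2 * b + 2]. *)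
pose w x := `|u x - U x|; pose w' x := `|u x - U x| * expR (b * `|u x|).
have bw : bm w by rewrite /w; bm_tac.
have bw' : bm w' by apply: bmM; [bm_tac | apply: bexp; bm_tac].
have bk : bm (fun x => (kp s (u x) - kp s (U x)) ^+ 2).
  by apply: bmX; apply: bmD; [|apply: bmN]; exact: bm_kp.
have h1 : EE mu (fun x => (kp s (u x) - kp s (U x)) ^+ 2) <=
   (C * expR (b * K)) * EE mu (fun x => w x * w' x).
  rewrite -EEZ; last by bm_tac.
  apply: EE_le => //; first by bm_tac.
  move=> x; apply: (le_trans (hC _ _)).
  have -> : C * expR (b * K) * (w x * w' x) =
     C * (u x - U x) ^+ 2 * (expR (b * K) * expR (b * `|u x|)).
    by rewrite -(real_normK (num_real (u x - U x))) /w /w'; ring.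
  apply: ler_wpM2l; first by rewrite mulr_ge0// sqr_ge0.
  rewrite -expRD ler_expR -mulrDr; apply: ler_wpM2l => //.
  by have := UK x; lra.
have h2 := EE_CS mu bw bw'.
have ew : EE mu (fun x => w x ^+ 2) = EE mu (fun x => (u x - U x) ^+ 2).
  by apply: EE_ext => x; rewrite real_normK// num_real.
have h3 : EE mu (fun x => w' x ^+ 2) <=
  expR (2 * K) * EE mu (fun x => expR ((2 * b + 2) * u x) + expR (- (2 * b + 2) * u x)).
  have be (c : R) : bm (fun x => expR (c * u x)) by apply: bexp; bm_tac.
  rewrite -EEZ; last by apply: bmD; exact: be.
  apply: EE_le; [bm_tac | by apply: bmM; [bm_tac | apply: bmD; exact: be] |].
  move=> x; have t1 : w x <= expR (`|u x| + K).
    rewrite (le_trans _ (expR_ge1Dx _))//.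
    by have := ler_normB (u x) (U x); have := UK x; rewrite /w; lra.
  have t2 : w' x ^+ 2 <= expR (2 * K) * expR ((2 * b + 2) * `|u x|).
    have -> : expR (2 * K) * expR ((2 * b + 2) * `|u x|) = (expR (`|u x| + K) * expR (b * `|u x|)) ^+ 2.
      by rewrite expr2 -!expRD; congr expR; ring.
    rewrite lerXn2r ?nnegrE//; first by rewrite mulr_ge0// expR_ge0.
    by apply: ler_wpM2r => //; exact: expR_ge0.
  apply: (le_trans t2); apply: ler_wpM2l; first exact: expR_ge0.
  have [u0|u0] := leP 0 (u x).
    by rewrite ger0_norm// lerDl expR_ge0.
  by rewrite ltr0_norm// mulrN -mulNr lerDr expR_ge0.
have h0 : 0 <= EE mu (fun x => (kp s (u x) - kp s (U x)) ^+ 2) by exact: EE_sqr_ge0.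
have h4 : 0 <= EE mu (fun x => w x ^+ 2) by exact: EE_sqr_ge0.
set e1 := EE mu (fun x => _ ^+ 2) in h0 h1 *.
apply: (@le_trans _ _ ((C * expR (b * K)) ^+ 2 * EE mu (fun x => w x * w' x) ^+ 2)).
  by rewrite -exprMn lerXn2r// nnegrE// (le_trans h0).
set E1 := EE mu (fun x => expR _ + _) in h3 *; rewrite -ew; set E2 := EE mu (fun x => w x ^+ 2) in ew h2 h4 *.
have -> : (C * expR (b * K)) ^+ 2 * expR (2 * K) * E2 * E1 =
  (C * expR (b * K)) ^+ 2 * (E2 * (expR (2 * K) * E1)) by ring.
apply: ler_wpM2l; first exact: sqr_ge0.
by apply: (le_trans h2); apply: ler_wpM2l.
Qed.

End kappa_powers.

(** * Measurable inversion and the discrete solution operator *)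

Section measurable_inverse.
Context {R : realType} {dT : measure_display} {T : measurableType dT}.

Lemma measurable_invr (f : T -> R) : measurable_fun setT f ->
  measurable_fun setT (fun w => (f w)^-1).
Proof.
move=> mf.
(* An identity valid everywhere, also at 0 where the inverse is 0 by convention. *)
have -> : (fun w => (f w)^-1) = fun w => f w * expR (- ln (f w ^+ 2)).
  apply/funext => w; have [->|f0] := eqVneq (f w) 0; first by rewrite invr0 mul0r.
  by rewrite expRN lnK ?posrE ?exprn_even_gt0//; field.
apply: measurable_funM => //; apply: measurableT_comp => //; apply: measurableT_comp => //.
by apply: measurableT_comp; [exact: measurable_ln | exact: measurable_funX].
Qed.

Lemma measurable_det n (M : T -> 'M[R]_n) :
  (forall i j, measurable_fun setT (fun w => M w i j)) -> measurable_fun setT (fun w => \det (M w)).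
Proof.
move=> mM; apply: measurable_sum => s; apply: measurable_funM => //.
by apply: measurable_prod => i _; exact: mM.
Qed.

Lemma measurable_invmx n (M : T -> 'M[R]_n) : (forall w, M w \in unitmx) ->
  (forall i j, measurable_fun setT (fun w => M w i j)) ->
  forall i j, measurable_fun setT (fun w => invmx (M w) i j).
Proof.
move=> uM mM i j.
have -> : (fun w => invmx (M w) i j) = fun w => (\det (M w))^-1 * cofactor (M w) j i.
  by apply/funext => w; rewrite /invmx uM !mxE.
apply: measurable_funM; first by apply: measurable_invr; exact: measurable_det.
apply: measurable_funM => //; apply: measurable_det => k l.
by under eq_fun do rewrite !mxE; exact: mM.
Qed.

End measurable_inverse.

Section solver.
Context {R : realType} {dT : measure_display} {T : measurableType dT}.
Variable mu : probability T R.
Variables (I : finType) (e : I -> T -> R) (lam : I -> R).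
Hypothesis be : forall t, bm (e t).
Hypothesis e2 : forall t x, e t x ^+ 2 <= 2.
Hypothesis eo : forall s t, EE mu (fun x => e s x * e t x) = (s == t)%:R.
Hypothesis lam0 : forall t, 0 <= lam t.
Local Notation E := (EE mu).

Definition gmx (a : T -> R) : 'M[R]_#|I| := \matrix_(i, j)
  ((i == j)%:R * lam (enum_val i) + E (fun x => a x * e (enum_val i) x * e (enum_val j) x)).

(** An explicit inverse makes the discrete solution a rational function of the matrix entries, hence
    measurable in the sample point. *)
Definition ginv a (s t : I) : R := invmx (gmx a) (enum_rank s) (enum_rank t).

Lemma gmx_sym a : (gmx a)^T = gmx a.
Proof.
apply/matrixP => i j; rewrite !mxE; congr (_ + _).
  by rewrite eq_sym; case: eqP => [->|]; rewrite ?mul0r.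
by apply: EE_ext => x; ring.
Qed.

Lemma ginv_sym a s t : ginv a s t = ginv a t s.
Proof. by rewrite /ginv -[in RHS]gmx_sym -trmx_inv mxE. Qed.

Lemma gmx_row a (c : I -> R) t : bm a ->
  \sum_j c (enum_val j) * gmx a j (enum_rank t) = lam t * c t + E (fun x => a x * comb e c x * e t x).
Proof.
move=> ba.
have -> : E (fun x => a x * comb e c x * e t x) = \sum_s c s * E (fun x => a x * e s x * e t x).
  rewrite -(EE_ext mu (f := fun x => (a x * e t x) * comb e c x)); last by move=> x; ring.
  rewrite (E_comb mu be); last by bm_tac.
  by apply: eq_bigr => s _; congr (_ * _); apply: EE_ext => x; ring.
under eq_bigr do rewrite mxE mulrDr.
rewrite big_split /=; congr (_ + _).
  rewrite (bigD1 (enum_rank t))//= big1 ?addr0; last by move=> i /negPf ->; rewrite mul0r mulr0.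
  by rewrite eqxx enum_rankK mul1r mulrC.
rewrite (reindex (@enum_val I predT)) /=; last first.
  by apply: onW_bij; exact: enum_val_bij.
by apply: eq_bigr => j _; rewrite enum_rankK.
Qed.

Lemma gmx_unit a (dl : R) : bm a -> 0 < dl -> (forall x, dl <= a x) -> gmx a \in unitmx.
Proof.
move=> ba dl0 hdl; rewrite -row_free_unit; apply: inj_row_free => c c0.
pose c' (t : I) : R := c 0 (enum_rank t).
have h t : lam t * c' t + E (fun x => a x * comb e c' x * e t x) = 0.
  have e0 : \sum_j c 0 j * gmx a j (enum_rank t) = 0.
    have h := congr1 (fun M : 'rV[R]_#|I| => M 0 (enum_rank t)) c0.
    by rewrite [LHS]mxE [RHS]mxE in h.
  rewrite -gmx_row// -[RHS]e0; apply: eq_bigr => j _.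
  by rewrite /c' enum_valK.
have bc : bm (comb e c') by exact: bm_comb.
have h2 : \sum_t c' t * (lam t * c' t + E (fun x => a x * comb e c' x * e t x)) = 0.
  by rewrite big1// => t _; rewrite h mulr0.
have h3 : \sum_t c' t * E (fun x => a x * comb e c' x * e t x) = E (fun x => a x * comb e c' x ^+ 2).
  rewrite -(E_comb mu be); last by bm_tac.
  by apply: EE_ext => x; ring.
have h4 : dl * \sum_t c' t ^+ 2 <= E (fun x => a x * comb e c' x ^+ 2).
  rewrite -(comb_sqr be eo) -EEZ; last by bm_tac.
  by apply: EE_le; [bm_tac..|] => x; apply: ler_wpM2r; rewrite ?sqr_ge0.
have h5 : 0 <= \sum_t c' t * (lam t * c' t).
  by apply: sumr_ge0 => t _; rewrite mulrCA mulr_ge0// -expr2 sqr_ge0.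
have h6 : \sum_t c' t ^+ 2 = 0.
  apply/eqP; rewrite eq_le sumr_ge0 ?andbT; last by move=> t _; exact: sqr_ge0.
  rewrite -(pmulr_rle0 _ dl0); apply: (le_trans h4).
  rewrite -h3.
  have : \sum_t (c' t * (lam t * c' t) + c' t * E (fun x => a x * comb e c' x * e t x)) = 0.
    by rewrite -[RHS]h2; apply: eq_bigr => t _; rewrite mulrDr.
  rewrite big_split /=; set X := \sum_t _ in h5 *; set Y := \sum_t _; lra.
apply/rowP => j; rewrite mxE.
have /eqP := h6; rewrite psumr_eq0; last by move=> t _; exact: sqr_ge0.
move=> /allP /(_ (enum_val j)); rewrite mem_index_enum => /(_ isT).
by rewrite sqrf_eq0 /c' enum_valK => /eqP.
Qed.

(** Both directions are used: existence provides the solutions [galc] and [galg], uniqueness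
    identifies a given Galerkin solution with the explicit one. *)
Lemma ginv_solve a (dl : R) (c F : I -> R) : bm a -> 0 < dl -> (forall x, dl <= a x) ->
  (forall t, lam t * c t + E (fun x => a x * comb e c x * e t x) = F t) <->
  c = fun t => \sum_s ginv a t s * F s.
Proof.
move=> ba dl0 hdl; have u := gmx_unit ba dl0 hdl.
pose rc (f : I -> R) : 'rV[R]_#|I| := \row_j f (enum_val j).
have rcE f t : rc f 0 (enum_rank t) = f t by rewrite mxE enum_rankK.
have solE : rc (fun t => \sum_s ginv a t s * F s) = rc F *m invmx (gmx a).
  apply/rowP => j; rewrite !mxE (reindex (@enum_val I predT)) /=; last first.
    by apply: onW_bij; exact: enum_val_bij.
  apply: eq_bigr => i _; rewrite mxE mulrC; congr (_ * _).
  by rewrite ginv_sym /ginv !enum_valK.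
have eqE c' : (forall t, lam t * c' t + E (fun x => a x * comb e c' x * e t x) = F t) <->
    rc c' *m gmx a = rc F.
  split=> [h|h t].
    apply/rowP => j; rewrite !mxE -h -gmx_row// enum_valK.
    by apply: eq_bigr => i _; rewrite mxE.
  by rewrite -gmx_row// -(rcE F t) -h [RHS]mxE; apply: eq_bigr => i _; rewrite [rc _ _ _]mxE.
rewrite eqE; split=> [h|->]; last by rewrite solE mulmxKV.
have h2 : rc c = rc (fun t => \sum_s ginv a t s * F s) by rewrite solE -h mulmxK.
apply/funext => t; by rewrite -[LHS]rcE h2 rcE.
Qed.

End solver.

Section tannery.
Context {R : realType}.

(** Dominated convergence for series over nested lists: beyond a fixed list the weights leave at
    most eps/2, and within it the sum is finite. *)
Lemma tannery (K : eqType) (c : nat -> seq K) (wt : K -> R) (r : nat -> K -> R) (W B : R) :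
  (forall n m, (n <= m)%N -> forall F : K -> R,
     \sum_(k <- c m) F k = \sum_(k <- c n) F k + \sum_(k <- c m | k \notin c n) F k) ->
  (forall k, 0 <= wt k) -> (forall n, \sum_(k <- c n) wt k <= W) ->
  (forall n k, 0 <= r n k <= B) -> (forall k, r ^~ k @ \oo --> (0 : R)) ->
  (fun n => \sum_(k <- c n) wt k * r n k) @ \oo --> (0 : R).
Proof.
move=> split_c wt0 wtW rB r0.
have B0 : 0 <= B \/ forall n, c n = [::].
  have [B0|B0] := leP 0 B; first by left.
  right=> n; case: (c n) => // k l; have /andP[h1 h2] := rB 0%N k.
  by have := le_trans h1 h2; rewrite leNgt B0.
case: B0 => [B0|c0]; last first.
  rewrite (_ : (fun n => _) = fun=> 0); first exact: cvg_cst.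
  by apply/funext => n; rewrite c0 big_nil.
pose w n := \sum_(k <- c n) wt k.
have w_nd : {homo w : n m / (n <= m)%N >-> n <= m}.
  move=> n m nm; rewrite /w (split_c n m nm) lerDl.
  by apply: sumr_ge0 => k _.
have wc : cvgn w.
  apply: nondecreasing_is_cvgn => //; exists W => _ [n _ <-]; exact: wtW.
apply/cvgrPdist_le => eps eps0.
have e0 : 0 < eps / (2 * (B + 1)) by rewrite divr_gt0// mulr_gt0// ltr_pwDr.
have /cvgrPdist_le/(_ _ e0) [N _ hN] := wc.
have wlim n : w n <= limn w by exact: nondecreasing_cvgn_le.
have fin : (fun n => \sum_(k <- c N) wt k * r n k) @ \oo --> (0 : R).
  elim: (c N) => [|k l IH].
    by under eq_fun do rewrite big_nil; exact: cvg_cst.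
  under eq_fun do rewrite big_cons.
  have h1 : (fun n => wt k * r n k) @ \oo --> (0 : R).
    by rewrite -[X in _ --> X](mulr0 (wt k)); apply: cvgMr.
  by have h := cvgD h1 IH; rewrite addr0 in h; exact: h.
have e2 : 0 < eps / 2 by rewrite divr_gt0.
have /cvgrPdist_le/(_ _ e2) [M _ hM] := fin.
exists (maxn N M) => // n /=; rewrite geq_max => /andP[Nn Mn].
rewrite sub0r normrN ger0_norm; last first.
  by apply: sumr_ge0 => k _; rewrite mulr_ge0//; have /andP[] := rB n k.
rewrite (split_c N n Nn).
have h1 := hM n Mn; rewrite /= sub0r normrN in h1.
have h2 : \sum_(k <- c n | k \notin c N) wt k * r n k <= (w n - w N) * B.
  have -> : w n - w N = \sum_(k <- c n | k \notin c N) wt k by rewrite /w (split_c N n Nn); ring.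
  rewrite mulr_suml; apply: ler_sum => k _; apply: ler_wpM2l => //.
  by have /andP[] := rB n k.
have h3 : w n - w N <= eps / (2 * (B + 1)).
  have := hN N (leqnn N); rewrite /= ger0_norm ?subr_ge0//.
  by have := wlim n; lra.
have h4 : (w n - w N) * B <= eps / 2.
  apply: (le_trans (ler_wpM2r B0 h3)).
  have B1 : 0 < B + 1 by rewrite ltr_pwDr.
  have -> : eps / (2 * (B + 1)) * B = eps / 2 * (B / (B + 1)) by field; rewrite gt_eqF.
  rewrite ler_piMr//; first exact: ltW.
  by rewrite ler_pdivrMr//; lra.
rewrite [X in _ <= X]splitr; apply: lerD; last exact: le_trans h2 h4.
by rewrite (le_trans (ler_norm _)).
Qed.

End tannery.

(** * Galerkin solutions on the torus *)

Lemma sqr_cvg0 {R : realType} (u : nat -> R) :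
  (fun j => u j ^+ 2) @ \oo --> (0 : R) -> u @ \oo --> (0 : R).
Proof.
move=> h; apply/cvgr0Pnorm_lt => e e0.
have e20 : 0 < e ^+ 2 by rewrite exprn_gt0.
have h' := cvgr0_norm_lt _ h _ e20.
near=> j.
have : `|u j ^+ 2| < e ^+ 2 by near: j; exact: h'.
by rewrite normrX ltr_pXn2r// nnegrE//; exact: ltW.
Unshelve. all: by end_near.
Qed.

Section torus_galerkin.
Context {R : realType} {d : nat}.
Hypothesis d3 : (d <= 3)%N.
Local Notation T := (d.-tuple R).
Local Notation mu := (cubeP d : probability T R).
Local Notation E := (EE mu).
Local Notation n2 f := (E (fun x => f x ^+ 2)).
Implicit Types (a m A M U : T -> R) (z : d.-tuple int -> R).

Definition lamt n (t : cubeI n) : R := lamk (cubek t : d.-tuple int).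
Definition ent m (k l : d.-tuple int) : R := E (fun x => m x * Fe k x * Fe l x).
Definition galF n m z (t : cubeI n) : R :=
  \sum_(s : cubeI n) z (cubek s) * ent m (cubek s) (cubek t).
Definition galc n a m z (t : cubeI n) : R :=
  \sum_(s : cubeI n) ginv mu (@Ft R d n) (@lamt n) a t s * galF m z s.
Definition galu n a m z : T -> R := comb (@Ft R d n) (galc a m z).
(** Coefficients of the discrete Green function with pole [x]. *)
Definition galg n a x (s : cubeI n) : R :=
  \sum_(r : cubeI n) ginv mu (@Ft R d n) (@lamt n) a s r * Ft r x.
Definition galh n a m (k : d.-tuple int) (x : T) : R :=
  E (fun y => m y * comb (@Ft R d n) (galg a x) y * Fe k y).
Definition wt (k : d.-tuple int) : R := (1 + lamk k) ^- 2.

Lemma lamt_ge0 n (t : cubeI n) : 0 <= lamt t. Proof. exact: lamk_ge0. Qed.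

Lemma wt_ge0 k : 0 <= wt k.
Proof. by rewrite invr_ge0 exprn_ge0// addr_ge0// lamk_ge0. Qed.

Lemma sum_wt n : \sum_(k <- cubes n) wt k <= 1024.
Proof.
rewrite -sum_cubes; apply: (le_trans (sum_weights d3 n)).
by rewrite -natrM ler_nat.
Qed.

Lemma bounded_weights : exists2 W : R, 0 < W & forall n, \sum_(k <- cubes n) wt k <= W.
Proof. by exists 1024; [lra | exact: sum_wt]. Qed.

Lemma summable_weights : exists S : R, 0 < S /\ forall n, \sum_(t : cubeI n) (1 + lamt t) ^- 2 <= S.
Proof. by exists (512 * 2); split; [lra | exact: sum_weights]. Qed.

Lemma level_card : exists nb, forall n j : nat, (#|[pred t : @cubeI d n | lev (cubek t) == j]| <= nb * 8 ^ j)%N.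
Proof. by exists 512%N; exact: lev_card. Qed.

Lemma bm_galu n a m z : bm (galu n a m z).
Proof. by apply: bm_comb => t; exact: bm_Ft. Qed.

Lemma galhE n a m k x : bm m ->
  galh n a m k x = \sum_(s : cubeI n) galg a x s * ent m k (cubek s).
Proof.
move=> bmm; rewrite /galh (EE_ext mu (g := fun y => (m y * Fe k y) * comb (@Ft R d n) (galg a x) y)); last first.
  by move=> y; ring.
rewrite E_comb//; first by move=> t; exact: bm_Ft.
by apply: bmM => //; exact: bm_Fe.
Qed.

(** By the symmetry of the inverse matrix, the point value of the solution pairs the noise with [m]
    times the Green function at that point. The coefficients [galh] depend on [a] and [m] only, so
    given the previous level the value is Gaussian. *)
Lemma galu_gauss n a m z x : bm m ->
  galu n a m z x = \sum_(t : cubeI n) z (cubek t) * galh n a m (cubek t) x.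
Proof.
move=> bmm.
under [RHS]eq_bigr do rewrite galhE// mulr_sumr.
rewrite /galu /comb /galc.
under [LHS]eq_bigr do rewrite mulr_suml.
rewrite exchange_big /= [RHS]exchange_big /=; apply: eq_bigr => s _.
rewrite /galF /galg.
transitivity (\sum_(r : cubeI n) (z (cubek r) * ent m (cubek r) (cubek s)) *
   (\sum_(t : cubeI n) ginv mu (@Ft R d n) (@lamt n) a s t * Ft t x)).
  rewrite -mulr_suml mulr_sumr; apply: eq_bigr => t _.
  by rewrite (ginv_sym mu _ _ _ t s); ring.
by apply: eq_bigr => r _; rewrite -mulrA [_ * ent _ _ _]mulrC.
Qed.

Lemma galh_bessel n a m x : bm m ->
  \sum_(t : cubeI n) galh n a m (cubek t) x ^+ 2 <= n2 (fun y => m y * comb (@Ft R d n) (galg a x) y).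
Proof.
move=> bmm; apply: (bessel (@bm_Ft R d n) (@Ft_ortho R d n)).
by apply: bmM => //; apply: bm_comb => t; exact: bm_Ft.
Qed.

(** Uniform in [n], [x], [a] and [m]: the constants come from the limit coefficient [A] and from
    [X], and the lower bound [dl'] only serves to invert the matrix. [del] makes the perturbation
    [A - a] absorbable and keeps it at most 1 in squared L^2 norm. *)
Lemma galh_bounded A (dl K X : R) : bm A -> 0 < dl -> (forall x, dl <= A x) ->
  (forall x, `|1 - A x| <= K) ->
  exists B del : R, 0 < del /\ forall n a m dl', bm a -> bm m -> 0 < dl' -> (forall x, dl' <= a x) ->
    n2 (fun x => A x - a x) <= del -> E (fun x => m x ^+ 8) <= X ->
    forall x, \sum_(t : cubeI n) galh n a m (cubek t) x ^+ 2 <= B.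
Proof.
move=> bA dl0 hA hK.
have [S [S0 hS]] := summable_weights; have [nb hnb] := level_card.
pose C8 : R := 8 * (2 * (1 + (K / dl) ^+ 2)) * S.
have C80 : 0 < C8.
  by rewrite /C8 !mulr_gt0// ltr_pwDl// sqr_ge0.
pose G : R := 4 * (1 + (2 * n2 (fun x => 1 - A x) + 2) * C8).
have n2A : 0 <= n2 (fun x => 1 - A x) by exact: EE_sqr_ge0.
have G0 : 0 <= G by rewrite mulr_ge0// addr_ge0// mulr_ge0 ?(ltW C80)// addr_ge0// mulr_ge0.
exists (Num.sqrt (Num.sqrt (2 * nb%:R ^+ 5 * G ^+ 4 * X)) /
  (1 - Num.sqrt (Num.sqrt (Num.sqrt (1 / 2)))) ^+ 2).
exists (Num.min 1 C8^-1); split; first by rewrite lt_min ltr01 invr_gt0.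
move=> n a m dl' ba bmm dl'0 hdl'; rewrite le_min => /andP[h1 h2] hX x.
have hc : C8 * n2 (fun x => A x - a x) <= 1 by rewrite -ler_pdivlMl// mulr1.
have gE := (ginv_solve (@bm_Ft R d n) (@Ft_ortho R d n) (@lamt_ge0 n) (galg a x)
  (fun t => Ft t x) ba dl'0 hdl').2 erefl.
have g1 := green_coef (@bm_Ft R d n) (@Ft2 R d n) (@Ft_ortho R d n) (@lamt_ge0 n) (hS n)
  bA dl0 hA hK ba hc gE.
have g2 (t : cubeI n) : galg a x t ^+ 2 <= G / (1 + lamt t) ^+ 2.
  apply: (le_trans (g1 t)); apply: ler_wpM2r.
    by rewrite invr_ge0 exprn_ge0// addr_ge0// lamt_ge0.
  apply: ler_wpM2l => //; apply: lerD => //; apply: ler_wpM2r; first exact: ltW.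
  have b1 : bm (fun x => 1 - A x) by bm_tac.
  have b2 : bm (fun x => A x - a x) by bm_tac.
  have := EE_sqrD mu b1 b2; rewrite (EE_ext mu (g := fun x => (1 - a x) ^+ 2)); last by move=> y; ring.
  by move=> h; apply: (le_trans h); apply: lerD => //; lra.
apply: (le_trans (galh_bessel n a x bmm)).
exact: (green_mul (@bm_Ft R d n) (@Ft2 R d n) (@Ft_ortho R d n) (@lamt_ge0 n)
   (fun t => lev_lam (cubek t)) (hnb n) bmm g2 G0 hX).
Qed.

(** By Parseval, the sum of [ent M k t ^+ 2] over the modes [t] outside the cube, that is, the share
    of the noise discarded by the truncation. *)
Definition rest M N (k : d.-tuple int) : R :=
  E (fun x => (M x * Fe k x - comb (@Ft R d N) (fun t => Fcoef (fun y => M y * Fe k y) (cubek t)) x) ^+ 2).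

Lemma n2_mulFe m k : bm m -> n2 (fun x => m x * Fe k x) <= 2 * n2 m.
Proof.
move=> bmm; rewrite -EEZ; last by bm_tac.
apply: EE_le; [apply: bmX; apply: bmM => //; exact: bm_Fe | bm_tac |] => x.
by rewrite exprMn mulrC; apply: ler_wpM2r; [exact: sqr_ge0 | exact: Fe2].
Qed.

Lemma restE M N k : bm M ->
  rest M N k = n2 (fun x => M x * Fe k x) - \sum_(t <- cubes N) ent M k t ^+ 2.
Proof.
move=> bM; rewrite -sum_cubes.
have b : bm (fun x => M x * Fe k x) by apply: bmM => //; exact: bm_Fe.
exact: (bessel_eq (@bm_Ft R d N) (@Ft_ortho R d N) b).
Qed.

Lemma ent_bessel M n k : bm M -> \sum_(t <- cubes n) ent M k t ^+ 2 <= n2 (fun x => M x * Fe k x).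
Proof.
move=> bM; have := restE n k bM.
have : 0 <= rest M n k by exact: EE_sqr_ge0.
lra.
Qed.

Lemma rest_bound M N k : bm M -> 0 <= rest M N k <= 2 * n2 M.
Proof.
move=> bM; apply/andP; split; first exact: EE_sqr_ge0.
rewrite restE//; have := n2_mulFe k bM.
have : 0 <= \sum_(t <- cubes N) ent M k t ^+ 2 by apply: sumr_ge0 => t _; exact: sqr_ge0.
lra.
Qed.

Lemma rest_cvg M k : bm M -> (fun N => rest M N k) @ \oo --> (0 : R).
Proof. by move=> bM; apply: parseval; apply: bmM => //; exact: bm_Fe. Qed.

Lemma ent_sym M k l : ent M k l = ent M l k.
Proof. by apply: EE_ext => x; ring. Qed.

Lemma entB M m k l : bm M -> bm m -> ent (fun x => M x - m x) k l = ent M k l - ent m k l.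
Proof.
move=> bM bmm; have bf k' := @bm_Fe R d k'.
rewrite /ent -EEB; [|bm_tac; apply: bf..].
by apply: EE_ext => x; ring.
Qed.

(* Conditional variance of the error in the data when the noise matrix [p] is
   replaced by the Galerkin truncation of [q]; [n] truncates the noise. *)
Definition noise_gap (p q : d.-tuple int -> d.-tuple int -> R) N n : R :=
  \sum_(k <- cubes N) wt k * \sum_(t <- cubes n) (p t k - (t \in cubes N)%:R * q t k) ^+ 2.

Lemma noise_gap_ge0 p q N n : 0 <= noise_gap p q N n.
Proof.
apply: sumr_ge0 => k _; rewrite mulr_ge0 ?wt_ge0//.
by apply: sumr_ge0 => t _; exact: sqr_ge0.
Qed.

Lemma noise_gap_mono p q N : {homo noise_gap p q N : n m / (n <= m)%N >-> n <= m}.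
Proof.
move=> n m nm; apply: ler_sum => k _; apply: ler_wpM2l; first exact: wt_ge0.
by rewrite (sum_cubes_split _ nm) lerDl; apply: sumr_ge0 => t _; exact: sqr_ge0.
Qed.

(** Modes inside the cube see the multiplier [M - m] and are summed by Bessel, modes outside see [M]
    alone and give [rest]. The constant is 2, from [Fe2], times the total weight 1024; uniformity in
    [n] allows the limit over the noise truncation. *)
Lemma noise_gap_bound M m N n : bm M -> bm m -> noise_gap (ent M) (ent m) N n <=
  2048 * n2 (fun x => M x - m x) + \sum_(k <- cubes N) wt k * rest M N k.
Proof.
move=> bM bmm.
have bMm : bm (fun x => M x - m x) by bm_tac.
have n20 : 0 <= n2 (fun x => M x - m x) by exact: EE_sqr_ge0.
wlog Nn : n / (N <= n)%N.
  move=> h; apply: (le_trans _ (h (maxn N n) _)); last exact: leq_maxl.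
  by apply: noise_gap_mono; exact: leq_maxr.
apply: (@le_trans _ _ (\sum_(k <- cubes N) (wt k * (2 * n2 (fun x => M x - m x)) + wt k * rest M N k))).
  apply: ler_sum => k _; rewrite -mulrDr; apply: ler_wpM2l; first exact: wt_ge0.
  rewrite (sum_cubes_split _ Nn); apply: lerD.
    have -> : \sum_(t <- cubes N) (ent M t k - (t \in cubes N)%:R * ent m t k) ^+ 2 =
       \sum_(t <- cubes N) ent (fun x => M x - m x) k t ^+ 2.
      rewrite [LHS]big_seq [RHS]big_seq; apply: eq_bigr => t tN.
      by rewrite tN mul1r entB// ![ent _ k t]ent_sym.
    by apply: (le_trans (ent_bessel N k bMm)); exact: n2_mulFe.
  have -> : \sum_(t <- cubes n | t \notin cubes N) (ent M t k - (t \in cubes N)%:R * ent m t k) ^+ 2 =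
       \sum_(t <- cubes n | t \notin cubes N) ent M k t ^+ 2.
    by apply: eq_bigr => t /negPf ->; rewrite mul0r subr0 ent_sym.
  rewrite restE//; have := ent_bessel n k bM; rewrite (sum_cubes_split _ Nn); lra.
rewrite big_split /= -mulr_suml; apply: lerD => //.
rewrite mulrA; apply: ler_wpM2r => //.
have := sum_wt N; lra.
Qed.

Lemma tail_rest M : bm M -> (fun N => \sum_(k <- cubes N) wt k * rest M N k) @ \oo --> (0 : R).
Proof.
move=> bM; apply: (@tannery _ _ _ wt (rest M) 1024 (2 * n2 M)).
- by move=> n m nm F; exact: sum_cubes_split.
- exact: wt_ge0.
- exact: sum_wt.
- by move=> n k; exact: rest_bound.
- by move=> k; exact: rest_cvg.
Qed.

Lemma ent_cvg M (m : nat -> T -> R) k l : bm M -> (forall j, bm (m j)) ->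
  (fun j => n2 (fun x => m j x - M x)) @ \oo --> (0 : R) ->
  (fun j => ent (m j) k l) @ \oo --> ent M k l.
Proof.
move=> bM bmm h.
have key j : (ent (m j) k l - ent M k l) ^+ 2 <= 4 * n2 (fun x => m j x - M x).
  rewrite -entB//.
  have b1 : bm (fun x => (m j x - M x) * Fe k x).
    by apply: bmM; [by apply: bmD => //; exact: bmN | exact: bm_Fe].
  have b2 := @bm_Fe R d l.
  apply: (le_trans (EE_CS mu b1 b2)).
  have h1 := n2_mulFe k (bmD (bmm j) (bmN bM)).
  have -> : n2 (@Fe R d l) = 1.
    by have := @Fe_ortho R d l l; rewrite eqxx => h2; rewrite -[RHS]h2; apply: EE_ext => x; rewrite expr2.
  rewrite mulr1; apply: (le_trans h1).
  have : 0 <= n2 (fun x => m j x - M x) by exact: EE_sqr_ge0.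
  lra.
have h4 : (fun j => 4 * n2 (fun x => m j x - M x)) @ \oo --> (0 : R).
  by rewrite -[X in _ --> X](mulr0 4); apply: cvgMr.
have h5 : (fun j => (ent (m j) k l - ent M k l) ^+ 2) @ \oo --> (0 : R).
  apply: (@squeeze_cvgr _ _ _ _ (fun=> 0) _ _ _ _ _ h4); last exact: cvg_cst.
  by apply: nearW => j; rewrite sqr_ge0 key.
by apply/subr_cvg0; exact: sqr_cvg0.
Qed.

Definition bcoef A U (k : d.-tuple int) : R := lamk k * Fcoef U k + E (fun x => A x * U x * Fe k x).

(** The terms of [galerkin_error] vanish one by one: the data gap by assumption, the coefficient gap
    with [ha], the projection error of [U] by [parseval]. The smallness condition of the estimate
    holds eventually. *)
Lemma galu_cvg A U (theta : nat -> nat) (a m : nat -> T -> R) (z : nat -> d.-tuple int -> R) :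
  ssub theta -> bm A -> (exists2 dl, 0 < dl & forall x, dl <= A x) -> bm U ->
  (forall j, bm (a j)) -> (forall j, exists2 dl, 0 < dl & forall x, dl <= a j x) ->
  (fun j => n2 (fun x => A x - a j x)) @ \oo --> (0 : R) ->
  (fun j => \sum_(t : cubeI (theta j)) (bcoef A U (cubek t) - galF (m j) (z j) t) ^+ 2
     / (1 + lamt t) ^+ 2) @ \oo --> (0 : R) ->
  (fun j => n2 (fun x => galu (theta j) (a j) (m j) (z j) x - U x)) @ \oo --> (0 : R).
Proof.
move=> stheta bA [dl dl0 hdl] bU ba hdla ha hD.
have [_ [K0 hK0]] := bA.
pose K := 1 + `|K0|.
have hK x : `|1 - A x| <= K.
  by have := ler_normB 1 (A x); have := hK0 x; have := ler_norm K0; rewrite /K normr1; lra.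
pose C := 2 * (1 + (K / dl) ^+ 2).
have C0 : 0 <= C by rewrite mulr_ge0// addr_ge0// sqr_ge0.
have [S [/ltW S0 hS]] := summable_weights.
pose D j := \sum_(t : cubeI (theta j)) (bcoef A U (cubek t) - galF (m j) (z j) t) ^+ 2
     / (1 + lamt t) ^+ 2.
pose rU N := E (fun x => (U x - comb (@Ft R d N) (fun t => Fcoef U (cubek t)) x) ^+ 2).
pose dA j := n2 (fun x => A x - a j x).
have rU0 : (fun j => rU (theta j)) @ \oo --> (0 : R).
  by apply: ssub_cvg => //; exact: parseval.
pose B j := rU (theta j) + 12 * C * (D j + 2 * S * dA j * n2 U +
   2 * S * (2 * n2 A + 2 * dA j) * rU (theta j)).
have B0 : B @ \oo --> (0 : R).
  have -> : (0 : R) = 0 + 12 * C * (0 + 2 * S * 0 * n2 U + 2 * S * (2 * n2 A + 2 * 0) * 0) by ring.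
  apply: cvgD => //; apply: cvgMr; apply: cvgD; first apply: cvgD => //.
    by apply: cvgMl; apply: cvgMr.
  apply: cvgM => //; apply: cvgMr; apply: cvgD; first exact: cvg_cst.
  exact: cvgMr.
have small : \forall j \near \oo, 8 * C * S * dA j <= 1.
  have h : (fun j => 8 * C * S * dA j) @ \oo --> (0 : R).
    by rewrite -[X in _ --> X](mulr0 (8 * C * S)); apply: cvgMr.
  have := cvgr0_norm_lt _ h _ (ltr01 : 0 < 1 :> R) => h'.
  by near=> j; apply: (le_trans (ler_norm _)); apply: ltW; near: j; exact: h'.
apply: (@squeeze_cvgr _ _ _ _ (fun=> 0) _ _ _ _ _ B0); last exact: cvg_cst.
apply: filterS small => j hj; rewrite EE_sqr_ge0 /=.
have [dl' dl'0 hdl'] := hdla j.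
have bFt := @bm_Ft R d (theta j).
have gal := (ginv_solve bFt (@Ft_ortho R d (theta j)) (@lamt_ge0 (theta j))
   (galc (a j) (m j) (z j)) (galF (m j) (z j)) (ba j) dl'0 hdl').2 erefl.
have err := galerkin_error bFt (@Ft2 R d (theta j)) (@Ft_ortho R d (theta j)) (@lamt_ge0 (theta j))
  (hS (theta j)) bA dl0 hdl hK (ba j) bU hj gal.
have -> : n2 (fun x => galu (theta j) (a j) (m j) (z j) x - U x) =
   n2 (fun x => U x - comb (@Ft R d (theta j)) (galc (a j) (m j) (z j)) x).
  by apply: EE_ext => x; rewrite /galu; ring.
rewrite (pythagoras bFt (@Ft_ortho R d (theta j)))//.
apply: lerD; first exact: lexx.
apply: (le_trans err); apply: ler_wpM2l; first by rewrite mulr_ge0.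
apply: lerD; first exact: lexx.
apply: ler_wpM2r; first exact: EE_sqr_ge0.
apply: ler_wpM2l; first by rewrite mulr_ge0.
have bd : bm (fun x => a j x - A x) by apply: bmD => //; exact: bmN.
have := EE_sqrD mu bA bd.
rewrite (EE_ext mu (g := fun x => a j x ^+ 2)); last by move=> x; ring.
by rewrite (EE_ext mu (f := fun x => (a j x - A x) ^+ 2) (g := fun x => (A x - a j x) ^+ 2)) // => x; ring.
Unshelve. all: by end_near.
Qed.

End torus_galerkin.

(** * Joint measurability *)

Section joint_measurability.
Context {R : realType} {dG dT : measure_display} {G : measurableType dG} {T : measurableType dT}.
Implicit Types f g : G -> T -> R.

Definition jm f : Prop := measurable_fun setT (fun p : G * T => f p.1 p.2).

Lemma jm_left (h : G -> R) : measurable_fun setT h -> jm (fun w _ => h w).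
Proof. by move=> mh; apply: measurableT_comp mh _; exact: measurable_fst. Qed.

Lemma jm_right (h : T -> R) : measurable_fun setT h -> jm (fun _ x => h x).
Proof. by move=> mh; apply: measurableT_comp mh _; exact: measurable_snd. Qed.

Lemma jmM f g : jm f -> jm g -> jm (fun w x => f w x * g w x).
Proof. by move=> mf mg; exact: measurable_funM. Qed.

Lemma jmB f g : jm f -> jm g -> jm (fun w x => f w x - g w x).
Proof. by move=> mf mg; exact: measurable_funB. Qed.

Lemma jm_comp (k : R -> R) f : measurable_fun setT k -> jm f -> jm (fun w x => k (f w x)).
Proof. by move=> mk mf; exact: measurableT_comp mk mf. Qed.

Lemma jm_sum (I : Type) (s : seq I) (F : I -> G -> T -> R) : (forall i, jm (F i)) ->
  jm (fun w x => \sum_(i <- s) F i w x).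
Proof.
by move=> mF; rewrite /jm; apply: (@measurable_sum _ _ _ _ _ s (fun i (p : G * T) => F i p.1 p.2)).
Qed.

Lemma jm_slice f x : jm f -> measurable_fun setT (f ^~ x).
Proof. by move=> mf; exact: (measurableT_comp mf (measurable_pair2 x)). Qed.

End joint_measurability.

(** Applied to the identity from a finer to a coarser sigma-algebra on the same sample space. *)
Lemma jm_reparam {R : realType} {dG dG' dT : measure_display} {G : measurableType dG}
    {G' : measurableType dG'} {T : measurableType dT} (h : G' -> G) (f : G -> T -> R) :
  measurable_fun setT h -> jm f -> jm (fun w x => f (h w) x).
Proof.
move=> mh mf; rewrite /jm.
apply: (@measurableT_comp _ _ _ _ _ _ (fun p : G * T => f p.1 p.2) _ (fun p : G' * T => (h p.1, p.2))).
  exact: mf.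
apply: measurable_fun_pair; last exact: measurable_snd.
by apply: measurableT_comp mh _; exact: measurable_fst.
Qed.

Lemma cvg_sum_seq {R : realType} (K : Type) (s : seq K) (f : K -> nat -> R) (l : K -> R) :
  (forall k, f k @ \oo --> l k) -> (fun n => \sum_(k <- s) f k n) @ \oo --> \sum_(k <- s) l k.
Proof.
move=> h; elim: s => [|k s IH].
  by rewrite big_nil; under eq_fun do rewrite big_nil; exact: cvg_cst.
rewrite big_cons; under eq_fun do rewrite big_cons.
exact: cvgD.
Qed.

(** Expansion of the square around [g], with the cross term handled by Cauchy-Schwarz. It presents
    an error against the limit as a limit of errors between discrete functions, which are
    measurable. *)
Lemma n2_cvg {R : realType} {dT : measure_display} {T : measurableType dT} (mu : probability T R)
    (f g : T -> R) (h : nat -> T -> R) : bm f -> bm g -> (forall j, bm (h j)) ->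
  (fun j => EE mu (fun x => (h j x - g x) ^+ 2)) @ \oo --> (0 : R) ->
  (fun j => EE mu (fun x => (f x - h j x) ^+ 2)) @ \oo --> EE mu (fun x => (f x - g x) ^+ 2).
Proof.
move=> bf bg bh h0.
have bd j : bm (fun x => h j x - g x) by apply: bmD => //; exact: bmN.
have bfg : bm (fun x => f x - g x) by bm_tac.
have cross : (fun j => EE mu (fun x => (f x - g x) * (h j x - g x))) @ \oo --> (0 : R).
  apply: sqr_cvg0.
  have c0 : (fun j => EE mu (fun x => (f x - g x) ^+ 2) * EE mu (fun x => (h j x - g x) ^+ 2)) @ \oo --> (0 : R).
    by rewrite -[X in _ --> X](mulr0 (EE mu (fun x => (f x - g x) ^+ 2))); apply: cvgMr.
  apply: (@squeeze_cvgr _ _ _ _ (fun=> 0) _ _ _ _ _ c0); last exact: cvg_cst.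
  by apply: nearW => j; rewrite sqr_ge0; exact: EE_CS.
have -> : (fun j => EE mu (fun x => (f x - h j x) ^+ 2)) = (fun j => EE mu (fun x => (f x - g x) ^+ 2)
    + (EE mu (fun x => (h j x - g x) ^+ 2) - 2 * EE mu (fun x => (f x - g x) * (h j x - g x)))).
  apply/funext => j; have b1 := bmX 2 (bd j); have b2 := bmM bfg (bd j); have b3 := bmX 2 bfg.
  rewrite -EEZ// -EEB//; last by bm_tac.
  rewrite -EED//; last by bm_tac.
  by apply: EE_ext => x; ring.
have -> : EE mu (fun x => (f x - g x) ^+ 2) = EE mu (fun x => (f x - g x) ^+ 2) + (0 - 2 * 0) by ring.
apply: cvgD; first by rewrite mulr0 subr0 addr0; exact: cvg_cst.
by apply: cvgB => //; apply: cvgMr.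
Qed.

Section galerkin_measurability.
Context {R : realType} {d : nat} {dG : measure_display} {G : measurableType dG}.
Local Notation T := (d.-tuple R).
Local Notation mu := (cubeP d : probability T R).
Variables (a m : G -> T -> R).
Hypothesis ja : jm a.
Hypothesis jmm : jm m.
Hypothesis ba : forall w, bm (a w).
Hypothesis bmm : forall w, bm (m w).
Hypothesis apos : forall w, exists2 dl, 0 < dl & forall x, dl <= a w x.

Lemma measurable_ent k l : measurable_fun setT (fun w => ent (m w) k l).
Proof.
apply: measurable_EE.
  change (jm (fun w x => m w x * Fe k x * Fe l x)).
  by apply: jmM; [apply: jmM => // |]; apply: jm_right; exact: (@bm_Fe R d _).1.
by move=> w; apply: bmM; [apply: bmM|] => //; exact: bm_Fe.
Qed.

Lemma measurable_ginv n (s t : cubeI n) :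
  measurable_fun setT (fun w => ginv mu (@Ft R d n) (@lamt R d n) (a w) s t).
Proof.
apply: measurable_invmx.
  move=> w; have [dl dl0 hdl] := apos w.
  exact: (gmx_unit (@bm_Ft R d n) (@Ft_ortho R d n) (@lamt_ge0 R d n) (ba w) dl0 hdl).
move=> i j; rewrite (_ : (fun w => _) = fun w => (i == j)%:R * lamt (enum_val i) +
  EE mu (fun x => a w x * Ft (enum_val i) x * Ft (enum_val j) x)).
  apply: measurable_funD => //; apply: measurable_EE.
    change (jm (fun w x => a w x * Ft (enum_val i) x * Ft (enum_val j) x)).
    by apply: jmM; [apply: jmM => // |]; apply: jm_right; exact: (bm_Ft _).1.
  by move=> w; apply: bmM; [apply: bmM|] => //; exact: bm_Ft.
by apply/funext => w; rewrite mxE.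
Qed.

Lemma bm_galh n w k : bm (galh n (a w) (m w) k).
Proof.
rewrite (_ : galh _ _ _ _ = fun x => \sum_(s : cubeI n) galg (a w) x s * ent (m w) k (cubek s)).
  apply: bm_sum => s; apply: bmM; last exact: bm_cst.
  by apply: bm_sum => t; apply: bmM; [exact: bm_cst | exact: bm_Ft].
by apply/funext => x; rewrite galhE.
Qed.

Lemma jm_galh n k : jm (fun w => galh n (a w) (m w) k).
Proof.
rewrite (_ : (fun w => _) = fun w x => \sum_(s : cubeI n) galg (a w) x s * ent (m w) k (cubek s)).
  apply: jm_sum => s; apply: jmM; last by apply: jm_left; exact: measurable_ent.
  apply: jm_sum => t; apply: jmM; last by apply: jm_right; exact: (bm_Ft _).1.
  by apply: jm_left; exact: measurable_ginv.
by apply/funext => w; apply/funext => x; rewrite galhE.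
Qed.

Lemma jm_galu n (z : G -> d.-tuple int -> R) : (forall t : cubeI n, measurable_fun setT (fun w => z w (cubek t))) ->
  jm (fun w => galu n (a w) (m w) (z w)).
Proof.
move=> mz.
rewrite (_ : (fun w => _) = fun w x => \sum_(t : cubeI n) z w (cubek t) * galh n (a w) (m w) (cubek t) x).
  by apply: jm_sum => t; apply: jmM; [exact: jm_left | exact: jm_galh].
by apply/funext => w; apply/funext => x; rewrite galu_gauss.
Qed.

End galerkin_measurability.

Section einf.
Context {R : realType}.

Lemma limn_einf_le_cst (u : (\bar R)^nat) (c : \bar R) : (forall n, u n <= c)%E -> (limn_einf u <= c)%E.
Proof.
move=> uc; rewrite limn_einf_lim; apply: lime_le; first exact: is_cvg_einfs.
apply: nearW => n; apply: le_trans (uc n).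
by apply: ereal_inf_lbound; exists n => /=.
Qed.

Lemma measurable_limn_einf {dG : measure_display} {G : measurableType dG} (f : nat -> G -> \bar R) :
  (forall n, measurable_fun setT (f n)) -> measurable_fun setT (fun w => limn_einf (f ^~ w)).
Proof.
move=> mf; rewrite /limn_einf.
apply: measurableT_comp; first exact: oppe_measurable.
apply: (measurable_fun_limn_esup (f := fun n w => (- f n w)%E)) => n.
by apply: measurableT_comp; first exact: oppe_measurable.
Qed.

End einf.

(** * From one level to the next *)

Lemma ae_and {R : realType} {dO : measure_display} {Omega : measurableType dO}
    {P : probability Omega R} {A B : Omega -> Prop} :
  {ae P, forall w, A w} -> {ae P, forall w, B w} -> {ae P, forall w, A w /\ B w}.
Proof. by apply: filterS2 => w. Qed.

Lemma sqr_cvg {R : realType} (u : nat -> R) (l : R) : u @ \oo --> l ->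
  (fun n => u n ^+ 2) @ \oo --> l ^+ 2.
Proof. by move=> h; rewrite expr2; under eq_fun do rewrite expr2; exact: cvgM. Qed.

Section step.
Context {R : realType} {d : nat} {dO : measure_display} {Omega : measurableType dO}.
Hypothesis d3 : (d <= 3)%N.
Local Notation T := (d.-tuple R).
Local Notation mu := (cubeP d : probability T R).
Local Notation E := (EE mu).
Local Notation n2 f := (E (fun x => f x ^+ 2)).
Variable P : probability Omega R.
Variables (kappa : R -> R) (c1 c2 a1 a2 nu : R).
Hypothesis kpos : forall t, 0 < kappa t.
Hypothesis kder : forall t, derivable kappa t 1.
Hypothesis c10 : 0 < c1.
Hypothesis c20 : 0 < c2.
Hypothesis a10 : 0 < a1.
Hypothesis a20 : 0 < a2.
Hypothesis klow : forall t, c1 * expR (- (a1 * `|t|)) <= kappa t.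
Hypothesis kup : forall t, kappa t <= c2 * expR (a2 * `|t|).
Hypothesis kder_up : forall t, `|derive1 kappa t| <= c2 * expR (a2 * `|t|).
Hypothesis nu0 : 0 < nu.
Local Notation kps := (kp kappa).

Variables (A : choiceType) (z : A -> Omega -> R) (L : pred A).
Hypothesis mz : forall a, L a -> measurable_fun setT (z a).
Hypothesis lawz : forall a, L a -> forall B : set R, measurable B ->
  P (z a @^-1` B) = normal_prob 0 1 B.
Hypothesis indz : forall s : seq A, uniq s -> all L s -> forall B : A -> set R,
  (forall a, measurable (B a)) ->
  P (\bigcap_(a in [set` s]) (z a @^-1` B a)) = (\prod_(a <- s) P (z a @^-1` B a))%E.
Variables (I : pred A) (iota : d.-tuple int -> A) (iotaV : A -> d.-tuple int).
Hypothesis iotaK : cancel iota iotaV.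
Hypothesis Liota : forall k, L (iota k).
Hypothesis Iiota : forall k, ~~ I (iota k).
Local Notation zmeas f := (@measurable_fun _ _ (zalg z L I) R setT f).

Variable v : nat -> Omega -> T -> R.
Hypothesis jv : forall n, @jm R _ _ (zalg z L I) T (v n).
Hypothesis bv : forall n w, bm (v n w).

Definition noise w k := z (iota k) w.
Definition vm n w x := kps nu (v n w x).
Definition va n w x := kps 2 (v n w x).
Definition uN n w := galu n (va n w) (vm n w) (noise w).

Let bva n w : bm (va n w). Proof. exact: bm_kp. Qed.
Let bvm n w : bm (vm n w). Proof. exact: bm_kp. Qed.

Lemma measurable_kp s : measurable_fun setT (kps s).
Proof. by apply: continuous_measurable_fun; exact: continuous_kp. Qed.

Let jva n : @jm R _ _ (zalg z L I) T (va n).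
Proof. by apply: jm_comp => //; exact: measurable_kp. Qed.

Let jvm n : @jm R _ _ (zalg z L I) T (vm n).
Proof. by apply: jm_comp => //; exact: measurable_kp. Qed.

Let va_pos n w : exists2 dl, 0 < dl & forall x, dl <= va n w x.
Proof. by have [dl [_ [dl0 _ h _]]] := kp_bounds kpos kder 2 (bv n w); exists dl. Qed.

Lemma bm_uN n w : bm (uN n w).
Proof. exact: bm_galu. Qed.

Lemma jm_uN (I' : pred A) n : {subset I <= I'} -> (forall k, I' (iota k)) ->
  @jm R _ _ (zalg z L I') T (uN n).
Proof.
move=> II' Ii.
have mid : @measurable_fun _ _ (zalg z L I') (zalg z L I) setT id by exact: zalg_widen II' _.
have ja' := jm_reparam mid (jva n); have jm' := jm_reparam mid (jvm n).
apply: (jm_galu ja' jm' (bva n) (bvm n) (va_pos n) (z := noise)) => t.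
by apply: zalg_z.
Qed.

Let measurable_idO : @measurable_fun _ _ Omega (zalg z L I) setT id.
Proof. exact: measurable_to_zalg. Qed.

Lemma jm_uNO n : @jm R _ _ Omega T (uN n).
Proof.
have ja' := jm_reparam measurable_idO (jva n); have jm' := jm_reparam measurable_idO (jvm n).
apply: (jm_galu ja' jm' (bva n) (bvm n) (va_pos n) (z := noise)) => t.
exact: mz.
Qed.

Lemma uN_unique n w (c : cubeI n -> R) :
  (forall t, lamt t * c t + E (fun x => va n w x * comb (@Ft R d n) c x * Ft t x) =
     galF (vm n w) (noise w) t) -> comb (@Ft R d n) c = uN n w.
Proof.
have [dl dl0 hdl] := va_pos n w.
by move=> /(ginv_solve (@bm_Ft R d n) (@Ft_ortho R d n) (@lamt_ge0 R d n) _ _ (bva n w) dl0 hdl) ->.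
Qed.

Variables V U : Omega -> T -> R.
Hypothesis bV : {ae P, forall w, bm (V w)}.
Hypothesis bU : {ae P, forall w, bm (U w)}.
Hypothesis vV : forall s, 0 < s -> asub P (fun n w => n2 (fun x => kps s (v n w x) - kps s (V w x))).
Hypothesis spde : {ae P, forall w, forall k,
  (fun n => \sum_(t <- cubes n) noise w t * ent (fun x => kps nu (V w x)) t k) @ \oo -->
  bcoef (fun x => kps 2 (V w x)) (U w) k}.

Definition data_gap n w : R := \sum_(t : cubeI n)
  (bcoef (fun x => kps 2 (V w x)) (U w) (cubek t) - galF (vm n w) (noise w) t) ^+ 2 / (1 + lamt t) ^+ 2.

Let iota_l n := [seq iota t | t <- cubes n].

Let uniq_l n : uniq (iota_l n).
Proof. by rewrite map_inj_uniq ?cubes_uniq//; exact: can_inj iotaK. Qed.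

Let L_l n : all L (iota_l n).
Proof. by apply/allP => _ /mapP[t _ ->]; exact: Liota. Qed.

Let I_l n : all (predC I) (iota_l n).
Proof. by apply/allP => _ /mapP[t _ ->]; exact: Iiota. Qed.

Section gap.
(* [p t k] stands for a version of <kappa^nu(V) e_t, e_k> measurable with
   respect to the earlier noises. *)
Variable p : d.-tuple int -> d.-tuple int -> Omega -> R.
Hypothesis mp : forall t k, zmeas (p t k).

Let q N t k w := ent (vm N w) t k.
Let s N t k w := p t k w - (t \in cubes N)%:R * q N t k w.
Let gp N n w := noise_gap (fun t k => p t k w) (fun t k => q N t k w) N n.
(** Allows division by a conditional variance that may vanish, and tends to 0 with it. *)
Let eta N : R := N.+1%:R^-1.
Let Sk N n k w := \sum_(t <- cubes n) s N t k w * noise w t.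
(** The data gap with the noise of the limit equation truncated at [n]; given the earlier noises its
    mean is [gp N n]. *)
Let Q N n w := \sum_(k <- cubes N) wt k * Sk N n k w ^+ 2.

Let eta0 N : 0 < eta N. Proof. by rewrite invr_gt0 ltr0n. Qed.

Let ms N t k : zmeas (s N t k).
Proof.
apply: measurable_funB => //; apply: measurable_funM => //.
exact: (measurable_ent (jvm N) (bvm N)).
Qed.

Let gpE N n w : gp N n w = \sum_(k <- cubes N) wt k * \sum_(t <- cubes n) s N t k w ^+ 2.
Proof. by []. Qed.

Let mgp N n : zmeas (gp N n).
Proof.
apply: measurable_sum => k; apply: measurable_funM => //.
by apply: measurable_sum => t; apply: measurable_funX; exact: ms.
Qed.

Let moment N n k (Z : Omega -> R) (e : R) : zmeas Z -> (forall w, 0 <= Z w) -> 0 < e ->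
  (\int[P]_w (Z w * Sk N n k w ^+ 2)%:E <=
   16%:E * \int[P]_w (Z w * (\sum_(t <- cubes n) s N t k w ^+ 2 + e))%:E)%E.
Proof.
move=> mZ Z0 e0.
have e1 : (fun w => (Z w * (\sum_(a <- iota_l n) s N (iotaV a) k w * z a w) ^+ 2)%:E) =
    (fun w => (Z w * Sk N n k w ^+ 2)%:E).
  apply/funext => w; rewrite big_map; congr (_ * _ ^+ 2)%:E.
  by apply: eq_bigr => t _; rewrite iotaK.
have e2 : (fun w => (Z w * (\sum_(a <- iota_l n) s N (iotaV a) k w ^+ 2 + e))%:E) =
    (fun w => (Z w * (\sum_(t <- cubes n) s N t k w ^+ 2 + e))%:E).
  apply/funext => w; rewrite big_map; congr (_ * (_ + _))%:E.
  by apply: eq_bigr => t _; rewrite iotaK.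
rewrite -e1 -e2; exact: (second_moment mz lawz indz (uniq_l n) (L_l n) (I_l n)
  (s := fun a => s N (iotaV a) k) (fun a => ms N (iotaV a) k) mZ Z0 e0).
Qed.

Let mSk N n k : measurable_fun setT (Sk N n k).
Proof.
apply: measurable_sum => t; apply: measurable_funM; last exact: mz.
exact: (zalg_fun mz (ms N t k)).
Qed.

Let ratio N n w : R := Q N n w / (gp N n w + eta N).

Let gpe N n w : 0 < gp N n w + eta N.
Proof. by rewrite ltr_wpDl// noise_gap_ge0. Qed.

Let ratio0 N n w : 0 <= ratio N n w.
Proof.
rewrite divr_ge0 ?(ltW (gpe N n w))//.
by apply: sumr_ge0 => k _; rewrite mulr_ge0 ?wt_ge0// sqr_ge0.
Qed.

Let mQ N n : measurable_fun setT (Q N n).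
Proof.
by apply: measurable_sum => k; apply: measurable_funM => //; apply: measurable_funX; exact: mSk.
Qed.

Let mratio N n : measurable_fun setT (ratio N n).
Proof.
apply: measurable_funM; first exact: mQ.
apply: measurable_invr; apply: measurable_funD => //.
exact: (zalg_fun mz (mgp N n)).
Qed.

(** The denominator depends on the earlier noises only, so it serves as the weight in
    [second_moment], and summation over [k] reproduces it: the bound is uniform in [N] and [n]. *)
Let int_ratio N n : (\int[P]_w (ratio N n w)%:E <= 16%:E)%E.
Proof.
pose Z w := (gp N n w + eta N)^-1.
have mZ : zmeas Z by apply: measurable_invr; exact: measurable_funD.
have mZO := zalg_fun mz mZ.
have Z0 w : 0 <= Z w by rewrite invr_ge0 ltW.
have [W W0 hW] := @bounded_weights R d d3.
(* Distributes [eta N] over the frequencies: their total weight is at most [W], so the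
   regularisations add up to at most [eta N]. *)
pose e := eta N / W.
have e0 : 0 < e by apply: divr_gt0.
pose g k w := wt k * (\sum_(t <- cubes n) s N t k w ^+ 2 + e).
have mg k : measurable_fun setT (g k).
  apply: measurable_funM => //; apply: measurable_funD => //.
  by apply: measurable_sum => t; apply: measurable_funX; exact: (zalg_fun mz (ms N t k)).
have g0 k w : 0 <= g k w.
  rewrite mulr_ge0 ?wt_ge0// addr_ge0 ?(ltW e0)//.
  by apply: sumr_ge0 => t _; exact: sqr_ge0.
have step1 : (\int[P]_w (ratio N n w)%:E =
    \sum_(k <- cubes N) (wt k)%:E * \int[P]_w (Z w * Sk N n k w ^+ 2)%:E)%E.
  transitivity (\int[P]_w (\sum_(k <- cubes N) ((wt k)%:E * (Z w * Sk N n k w ^+ 2)%:E)))%E.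
    apply: eq_integral => w _; rewrite /ratio /Q mulr_suml -sumEFin; apply: eq_bigr => k _.
    by rewrite -EFinM; congr EFin; rewrite /Z; ring.
  rewrite ge0_integral_sum//; first last.
  - by move=> k w _; rewrite -EFinM lee_fin mulr_ge0 ?wt_ge0// mulr_ge0// sqr_ge0.
  - move=> k; apply: emeasurable_funM => //; apply/measurable_EFinP.
    by apply: measurable_funM => //; apply: measurable_funX; exact: mSk.
  apply: eq_bigr => k _; rewrite ge0_integralZl_EFin//.
  - by move=> w _; rewrite lee_fin mulr_ge0// sqr_ge0.
  - by apply/measurable_EFinP; apply: measurable_funM => //; apply: measurable_funX; exact: mSk.
  - exact: wt_ge0.
have step2 : (\sum_(k <- cubes N) (wt k)%:E * \int[P]_w (Z w * Sk N n k w ^+ 2)%:E <=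
    \sum_(k <- cubes N) 16%:E * \int[P]_w (Z w * g k w)%:E)%E.
  apply: lee_sum => k _.
  have h := moment N n k mZ Z0 e0.
  apply: (@le_trans _ _ ((wt k)%:E * (16%:E * \int[P]_w (Z w * (\sum_(t <- cubes n) s N t k w ^+ 2 + e))%:E))%E).
    by apply: lee_wpmul2l => //; rewrite lee_fin wt_ge0.
  rewrite muleCA -ge0_integralZl_EFin//; last 3 first.
  - move=> w _; rewrite lee_fin mulr_ge0// addr_ge0 ?(ltW e0)//.
    by apply: sumr_ge0 => t _; exact: sqr_ge0.
  - apply/measurable_EFinP; apply: measurable_funM => //; apply: measurable_funD => //.
    by apply: measurable_sum => t; apply: measurable_funX; exact: (zalg_fun mz (ms N t k)).
  - exact: wt_ge0.
  rewrite (_ : (fun w => _) = (fun w => (Z w * g k w)%:E)) ?lexx//.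
  by apply/funext => w; rewrite -EFinM; congr EFin; rewrite /g; ring.
rewrite step1; apply: (le_trans step2).
rewrite (_ : (\sum_(k <- cubes N) 16%:E * \int[P]_w (Z w * g k w)%:E)%E =
   (\int[P]_w (\sum_(k <- cubes N) (16%:E * (Z w * g k w)%:E)))%E); last first.
  rewrite ge0_integral_sum//; first last.
  - by move=> k w _; rewrite -EFinM lee_fin mulr_ge0// mulr_ge0.
  - by move=> k; apply: emeasurable_funM => //; apply/measurable_EFinP; exact: measurable_funM.
  apply: eq_bigr => k _; rewrite ge0_integralZl_EFin//.
  - by move=> w _; rewrite lee_fin mulr_ge0.
  - by apply/measurable_EFinP; exact: measurable_funM.
apply: (@le_trans _ _ (\int[P]_w (16%:E))%E); last first.
  by rewrite integral_cst//= probability_setT mule1.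
apply: ge0_le_integral => //.
- by move=> w _; apply: sume_ge0 => k _; rewrite -EFinM lee_fin mulr_ge0// mulr_ge0.
- apply: emeasurable_sum => k; apply: emeasurable_funM => //; apply/measurable_EFinP.
  exact: measurable_funM.
move=> w _; under eq_bigr do rewrite -EFinM.
rewrite sumEFin lee_fin -mulr_sumr -[X in _ <= X]mulr1; apply: ler_wpM2l => //.
rewrite -mulr_sumr ler_pdivrMl ?mulr1//.
under eq_bigr do rewrite /g mulrDr.
rewrite big_split /= -gpE lerD2l -mulr_suml /e mulrA ler_pdivrMr//.
by rewrite mulrC; apply: ler_wpM2l => //; exact: ltW.
Qed.

Definition gap_tau N w : R := rlim (fun n => gp N n w) + eta N.
(** A lower limit, so that Fatou preserves the mean bound 16 without any convergence; where the data
    series converges it is the data gap divided by [gap_tau]. *)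
Definition gap_X N w : \bar R := limn_einf (fun n => (ratio N n w)%:E).

Lemma measurable_gap_tau N : measurable_fun setT (gap_tau N).
Proof.
apply: measurable_funD => //; apply: measurable_rlim => n.
exact: (zalg_fun mz (mgp N n)).
Qed.

Lemma measurable_gap_X N : measurable_fun setT (gap_X N).
Proof. by apply: measurable_limn_einf => n; exact/measurable_EFinP. Qed.

Lemma gap_X_ge0 N w : (0 <= gap_X N w)%E.
Proof.
rewrite /gap_X limn_einf_lim; apply: lime_ge; first exact: is_cvg_einfs.
apply: nearW => n; apply: le_ereal_inf_tmp => _ [m _ <-].
by rewrite lee_fin.
Qed.

Lemma int_gap_X N : (\int[P]_w gap_X N w <= 16%:E)%E.
Proof.
apply: le_trans (fatou P measurableT (f := fun n w => (ratio N n w)%:E) _ _) _.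
- by move=> n; exact/measurable_EFinP.
- by move=> n w _; rewrite lee_fin.
- by apply: limn_einf_le_cst => n; exact: int_ratio.
Qed.

(** The deterministic part. For [n] past [N] the sums [Sk] are the partial sums of the limit data
    minus the Galerkin data, so [Q] converges to the data gap, while [gp] is monotone and bounded in
    [n]. The positive [eta N] makes the quotient of the limits legitimate. *)
Lemma gap_path w : bm (V w) -> (forall t k, p t k w = ent (fun x => kps nu (V w x)) t k) ->
  (forall k, (fun n => \sum_(t <- cubes n) noise w t * ent (fun x => kps nu (V w x)) t k) @ \oo -->
    bcoef (fun x => kps 2 (V w x)) (U w) k) ->
  forall N, [/\ gap_tau N w * fine (gap_X N w) = data_gap N w, 0 <= gap_tau N w &
    gap_tau N w <= 2048 * n2 (fun x => kps nu (V w x) - vm N w x) +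
      \sum_(k <- cubes N) wt k * rest (fun x => kps nu (V w x)) N k + N.+1%:R^-1].
Proof.
move=> bVw hp hb N.
pose M x := kps nu (V w x).
have bM : bm M by exact: bm_kp.
have gpM n : gp N n w = noise_gap (ent M) (ent (vm N w)) N n.
  by apply: eq_bigr => k _; congr (_ * _); apply: eq_bigr => t _; rewrite hp.
pose B := 2048 * n2 (fun x => M x - vm N w x) + \sum_(k <- cubes N) wt k * rest M N k.
have gpB n : gp N n w <= B by rewrite gpM; exact: noise_gap_bound.
have cg : cvgn (fun n => gp N n w).
  apply: nondecreasing_is_cvgn; first by move=> n m nm; exact: noise_gap_mono.
  by exists B => _ [n _ <-].
have tauE : gap_tau N w = limn (fun n => gp N n w) + eta N.
  by rewrite /gap_tau (@rlimE _ _ (limn (fun n => gp N n w))).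
have tau0 : 0 < gap_tau N w.
  rewrite tauE ltr_wpDl//; apply: limr_ge => //; apply: nearW => n; exact: noise_gap_ge0.
have cQ : (fun n => Q N n w) @ \oo --> data_gap N w.
  rewrite /data_gap.
  rewrite (_ : \sum_(t : cubeI N) _ = \sum_(k <- cubes N) wt k * (bcoef (fun x => kps 2 (V w x)) (U w) k -
    \sum_(r <- cubes N) noise w r * ent (vm N w) r k) ^+ 2); last first.
    rewrite -sum_cubes; apply: eq_bigr => t _; rewrite mulrC; congr (_ * (_ - _) ^+ 2).
    by rewrite /galF -(sum_cubes N (fun r => noise w r * ent (vm N w) r (cubek t))).
  apply: cvg_sum_seq => k; apply: cvgMr; apply: sqr_cvg.
  apply: (@cvg_trans _ ((fun n => \sum_(t <- cubes n) noise w t * ent M t k -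
     \sum_(r <- cubes N) noise w r * ent (vm N w) r k) @ \oo)); last first.
    by apply: cvgB; [exact: hb | exact: cvg_cst].
  apply: near_eq_cvg; exists N => // n /= Nn.
  rewrite /Sk (sum_cubes_split (fun t => noise w t * ent M t k) Nn).
  rewrite [RHS](sum_cubes_split (fun t => s N t k w * noise w t) Nn).
  have -> : \sum_(t <- cubes N) s N t k w * noise w t =
     \sum_(t <- cubes N) noise w t * ent M t k - \sum_(t <- cubes N) noise w t * ent (vm N w) t k.
    rewrite -sumrB big_seq [RHS]big_seq; apply: eq_bigr => t tN.
    by rewrite /s tN mul1r hp mulrBl; congr (_ - _); exact: mulrC.
  have -> : \sum_(t <- cubes n | t \notin cubes N) s N t k w * noise w t =
     \sum_(t <- cubes n | t \notin cubes N) noise w t * ent M t k.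
    by apply: eq_bigr => t /negPf tN; rewrite /s tN hp mul0r subr0 mulrC.
  by rewrite addrAC.
have cr : (fun n => ratio N n w) @ \oo --> data_gap N w / gap_tau N w.
  apply: cvgM => //; apply: cvgV; first by rewrite gt_eqF.
  by rewrite tauE; apply: cvgD => //; exact: cvg_cst.
have XE : gap_X N w = (data_gap N w / gap_tau N w)%:E.
  rewrite /gap_X; have := @cvg_limn_einf_sup R (fun n => (ratio N n w)%:E) (data_gap N w / gap_tau N w)%:E.
  by case; [apply: cvg_EFin; [exact: nearW | exact: cr] | move=> ->].
split; last 2 first.
- exact: ltW.
- rewrite tauE lerD2r; apply: limr_le => //; exact: nearW.
by rewrite XE /=; field; rewrite gt_eqF.
Qed.

End gap.

Lemma asub_data_gap : asub P data_gap.
Proof.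
move=> psi spsi; have [f [sf hf]] := vV nu0 spsi.
pose th j := psi (f j); have sth : ssub th by exact: ssub_comp.
(* [V] is not assumed to depend on the earlier noises only. The discrete entries do, hence so does
   their limit, which almost surely gives the entries of kappa^nu(V). *)
pose p t k w := rlim (fun j => ent (vm (th j) w) t k).
have mp t k : zmeas (p t k).
  by apply: measurable_rlim => j; exact: (measurable_ent (jvm (th j)) (bvm (th j))).
have good : {ae P, forall w, [/\ bm (V w),
    (fun j => n2 (fun x => kps nu (v (th j) w x) - kps nu (V w x))) @ \oo --> (0 : R) &
    forall N, [/\ gap_tau p N w * fine (gap_X p N w) = data_gap N w, 0 <= gap_tau p N w &
    gap_tau p N w <= 2048 * n2 (fun x => kps nu (V w x) - vm N w x) +
      \sum_(k <- cubes N) wt k * rest (fun x => kps nu (V w x)) N k + N.+1%:R^-1]]}.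
  have h3 := ae_and bV (ae_and hf spde); apply: filterS h3 => w [bVw [hw sw]].
  split => //; apply: gap_path => // t k.
  apply: rlimE; apply: ent_cvg => //; exact: bm_kp.
have y0 : {ae P, forall w, (fun j => gap_tau p (th j) w) @ \oo --> (0 : R)}.
  apply: filterS good => w [bVw hw gw].
  have cb : (fun j => 2048 * n2 (fun x => kps nu (V w x) - vm (th j) w x) +
      \sum_(k <- cubes (th j)) wt k * rest (fun x => kps nu (V w x)) (th j) k + (th j).+1%:R^-1) @ \oo --> (2048 * 0 + 0 + 0 : R).
    apply: cvgD; first apply: cvgD.
    - apply: cvgMr; apply: cvg_trans hw; apply: near_eq_cvg; apply: nearW => j.
      by apply: EE_ext => x; rewrite /vm; ring.
    - have bM : bm (fun x => kps nu (V w x)) by exact: bm_kp.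
      exact: (ssub_cvg sth (tail_rest d3 bM)).
    - exact: (ssub_cvg sth (@cvg_harmonic R)).
  rewrite mulr0 !addr0 in cb.
  apply: (@squeeze_cvgr _ _ _ _ (fun=> 0) _ _ _ _ _ cb); last exact: cvg_cst.
  by apply: nearW => j; have [_ -> ->] := gw (th j).
have [g [sg hg]] := tight_product (fun j => measurable_gap_tau mp (th j))
  (fun j => measurable_gap_X mp (th j)) (fun j w => gap_X_ge0 p (th j) w)
  (fun j => int_gap_X mp (th j)) y0.
exists (f \o g); split; first exact: ssub_comp.
apply: filterS2 good hg => w [_ _ gw] [_].
apply: cvg_trans; apply: near_eq_cvg; apply: nearW => j /=.
by have [-> _ _] := gw (th (g j)).
Qed.

Lemma asub_uN : asub P (fun n w => n2 (fun x => uN n w x - U w x)).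
Proof.
move=> psi spsi.
have [f [sf h1 h2]] := asub2 asub_data_gap (vV (ltr0n _ 2)) spsi.
exists f; split => //.
have h3 := ae_and bV (ae_and bU (ae_and h1 h2)); apply: filterS h3 => w [bVw [bUw [hD ha]]].
have bA : bm (fun x => kps 2 (V w x)) by exact: bm_kp.
have hdl : exists2 dl, 0 < dl & forall x, dl <= kps 2 (V w x).
  by have [dl [_ [dl0 _ hdl _]]] := kp_bounds kpos kder 2 bVw; exists dl.
have ha' : (fun j => n2 (fun x => kps 2 (V w x) - va (psi (f j)) w x)) @ \oo --> (0 : R).
  move: ha; apply: cvg_trans; apply: near_eq_cvg; apply: nearW => j.
  by apply: EE_ext => x; rewrite /va; ring.
exact: (galu_cvg d3 (theta := psi \o f) (a := fun j => va (psi (f j)) w)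
  (m := fun j => vm (psi (f j)) w) (z := fun=> noise w) (ssub_comp spsi sf) bA hdl bUw
  (fun j => bva _ w) (fun j => va_pos _ w) ha' hD).
Qed.

Let gvar n w x : R := \sum_(t <- cubes n) galh n (va n w) (vm n w) t x ^+ 2.

(* Normalised to have mean 2 whatever the conditional variance [gvar]. *)
Definition exp_pair (b : R) n w x : R :=
  expR (b * uN n w x - b ^+ 2 * gvar n w x / 2) + expR (- b * uN n w x - (- b) ^+ 2 * gvar n w x / 2).

Let uN_sum n w x : uN n w x = \sum_(t <- cubes n) galh n (va n w) (vm n w) t x * noise w t.
Proof.
rewrite /uN galu_gauss// (sum_cubes n (fun t => noise w t * galh n (va n w) (vm n w) t x)).
by apply: eq_bigr => t _; exact: mulrC.
Qed.

Let jm_galhO n k : @jm R _ _ Omega T (fun w => galh n (va n w) (vm n w) k).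
Proof.
have ja' := jm_reparam measurable_idO (jva n); have jm' := jm_reparam measurable_idO (jvm n).
exact: (jm_galh ja' jm' (bva n) (bvm n) (va_pos n)).
Qed.

Let jm_gvar n : @jm R _ _ Omega T (gvar n).
Proof.
apply: jm_sum => t; apply: (jm_comp (k := fun y => y ^+ 2)); last exact: jm_galhO.
exact: measurable_funX.
Qed.

Let jm_exp b n : @jm R _ _ Omega T (fun w x => expR (b * uN n w x - b ^+ 2 * gvar n w x / 2)).
Proof.
apply: (jm_comp (k := @expR R)) => //; apply: jmB.
  by apply: jmM; [apply: jm_left; exact: measurable_cst | exact: jm_uNO].
apply: jmM; last by apply: jm_left; exact: measurable_cst.
by apply: jmM; [apply: jm_left; exact: measurable_cst | exact: jm_gvar].
Qed.

Let jm_exp_pair b n : @jm R _ _ Omega T (exp_pair b n).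
Proof. exact: (measurable_realfun.measurable_funD (jm_exp b n) (jm_exp (- b) n)). Qed.

Let exp_pair_ge0 b n w x : 0 <= exp_pair b n w x.
Proof. by rewrite addr_ge0// expR_ge0. Qed.

Let int_exp b n x : (\int[P]_w (expR (b * uN n w x - b ^+ 2 * gvar n w x / 2))%:E = 1%:E)%E.
Proof.
have ms a : zmeas (fun w => galh n (va n w) (vm n w) (iotaV a) x).
  exact: (jm_slice x (jm_galh (jva n) (jvm n) (bva n) (bvm n) (va_pos n) n (iotaV a))).
have := exp_moment mz lawz indz (uniq_l n) (L_l n) (I_l n) ms b.
have -> // : (fun w => (expR (b * (\sum_(a <- iota_l n) galh n (va n w) (vm n w) (iotaV a) x * z a w)
    - b ^+ 2 * (\sum_(a <- iota_l n) galh n (va n w) (vm n w) (iotaV a) x ^+ 2) / 2))%:E) =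
    (fun w => (expR (b * uN n w x - b ^+ 2 * gvar n w x / 2))%:E).
apply/funext => w.
have -> : \sum_(a <- iota_l n) galh n (va n w) (vm n w) (iotaV a) x * z a w = uN n w x.
  by rewrite uN_sum big_map; apply: eq_bigr => t _; rewrite iotaK.
have -> // : \sum_(a <- iota_l n) galh n (va n w) (vm n w) (iotaV a) x ^+ 2 = gvar n w x.
by rewrite big_map; apply: eq_bigr => t _; rewrite iotaK.
Qed.

Definition exp_X b n w : \bar R := (\int[mu]_x (exp_pair b n w x)%:E)%E.

Let exp_X_ge0 b n w : (0 <= exp_X b n w)%E.
Proof. by apply: integral_ge0 => x _; rewrite lee_fin. Qed.

Let measurable_exp_X b n : measurable_fun setT (exp_X b n).
Proof.
apply: (measurable_fun_fubini_tonelli_F (m2 := mu) (fun p : Omega * T => (exp_pair b n p.1 p.2)%:E)).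
  by apply/measurable_EFinP; exact: jm_exp_pair.
by move=> p; rewrite lee_fin.
Qed.

Let int_exp_X b n : (\int[P]_w exp_X b n w <= 2%:E)%E.
Proof.
have mf : measurable_fun setT (fun p : Omega * T => (exp_pair b n p.1 p.2)%:E : \bar R).
  by apply/measurable_EFinP; exact: jm_exp_pair.
rewrite /exp_X.
rewrite (fubini_tonelli (m1 := P) (m2 := mu) (fun p : Omega * T => (exp_pair b n p.1 p.2)%:E) mf); last first.
  by move=> p; rewrite lee_fin.
rewrite (eq_integral (fun=> 2%:E)).
  by rewrite integral_cst//= probability_setT mule1.
move=> x _ /=; under eq_integral do rewrite EFinD.
rewrite ge0_integralD//.
- by rewrite !int_exp -EFinD.
- by apply/measurable_EFinP; exact: (jm_slice x (jm_exp b n)).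
- by apply/measurable_EFinP; exact: (jm_slice x (jm_exp (- b) n)).
Qed.

Let bm_expR (f : T -> R) : bm f -> bm (fun x => expR (f x)).
Proof. by move=> bf; apply: bm_comp => //; exact: continuous_expR. Qed.

Let bm_exp_pair b n w : bm (exp_pair b n w).
Proof.
have bg : bm (gvar n w) by apply: bm_sum => t; apply: bmX; exact: bm_galh.
have bu := bm_uN n w.
by apply: bmD; apply: bm_expR; bm_tac.
Qed.

Let exp_bound b n w (B : R) : (forall x, gvar n w x <= B) ->
  E (fun x => expR (b * uN n w x) + expR (- b * uN n w x)) <=
  expR (b ^+ 2 * B / 2) * fine (exp_X b n w).
Proof.
move=> hB; rewrite /exp_X EE_EFin//= -EEZ//.
have bu := bm_uN n w.
apply: EE_le.
- by apply: bmD; apply: bm_expR; bm_tac.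
- by apply: bmM => //; exact: bm_cst.
move=> x; rewrite /exp_pair mulrDr -!expRD sqrrN.
have h : b ^+ 2 * gvar n w x / 2 <= b ^+ 2 * B / 2.
  by rewrite ler_pM2r//; apply: ler_wpM2l => //; exact: sqr_ge0.
by apply: lerD; rewrite ler_expR; lra.
Qed.

(** [kp_L2_lip] bounds the squared error by the L^2 error of [uN] times an exponential moment. The
    first tends to 0; the second is [exp_X], of mean at most 2, times a factor bounded through
    [galh_bounded]; [tight_product] makes their product vanish. *)
Lemma asub_kp_uN s : 0 < s -> asub P (fun n w => n2 (fun x => kps s (uN n w x) - kps s (U w x))).
Proof.
move=> s0 psi spsi.
have [b hb] := kp_L2_lip kpos kder c10 c20 a10 a20 klow kup kder_up (ltW s0).
have [f [sf h1 h2]] := asub2 asub_uN (vV (ltr0n _ 2)) spsi.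
(* [vm ^+ 8] is the square of [kps (4 * nu)], so L^2 convergence of this power bounds the eighth
   moment that [galh_bounded] requires. *)
have nu4 : 0 < 4 * nu by rewrite mulr_gt0.
have [g [sg h3]] := vV nu4 (ssub_comp spsi sf).
pose th j := psi (f (g j)); have sth : ssub th by apply: ssub_comp => //; exact: ssub_comp.
have {}h1 : {ae P, forall w, (fun j => n2 (fun x => uN (th j) w x - U w x)) @ \oo --> (0 : R)}.
  exact: (ae_ssub (Q := fun j w => n2 (fun x => uN (psi (f j)) w x - U w x)) sg h1).
have {}h2 : {ae P, forall w, (fun j => n2 (fun x => kps 2 (v (th j) w x) - kps 2 (V w x))) @ \oo --> (0 : R)}.
  exact: (ae_ssub (Q := fun j w => n2 (fun x => kps 2 (v (psi (f j)) w x) - kps 2 (V w x))) sg h2).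
(* A measurable stand-in for the error against [U], as [tight_product] demands. *)
pose y N w := rlim (fun j => n2 (fun x => uN N w x - uN (th j) w x)).
have my N : measurable_fun setT (y N).
  apply: measurable_rlim => j; apply: measurable_EE.
    change (@jm R _ _ Omega T (fun w x => (uN N w x - uN (th j) w x) ^+ 2)).
    apply: (jm_comp (k := fun t => t ^+ 2)); first exact: measurable_funX.
    by apply: jmB; exact: jm_uNO.
  by move=> w; apply: bmX; apply: bmD; [|apply: bmN]; exact: bm_uN.
have yE : {ae P, forall w, forall N, y N w = n2 (fun x => uN N w x - U w x)}.
  apply: filterS2 bU h1 => w bUw h1w N; apply: rlimE.
  by apply: n2_cvg => //; [exact: bm_uN | move=> j; exact: bm_uN].
have y0 : {ae P, forall w, (fun j => y (th j) w) @ \oo --> (0 : R)}.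
  apply: filterS2 yE h1 => w yw; apply: cvg_trans; apply: near_eq_cvg; apply: nearW => j.
  by rewrite yw.
have [e [se he]] := tight_product (fun j => my (th j)) (fun j => measurable_exp_X b (th j))
  (fun j w => exp_X_ge0 b (th j) w) (fun j => int_exp_X b (th j)) y0.
exists (f \o (g \o e)); split; first by apply: ssub_comp => //; exact: ssub_comp.
have good := ae_and bV (ae_and bU (ae_and h2 (ae_and h3 (ae_and yE he)))).
apply: filterS good => w [bVw [bUw [h2w [h3w [yw [_ hew]]]]]].
have {}h2w := ssub_cvg se h2w; have {}h3w := ssub_cvg se h3w.
pose q j := th (e j).
apply: sqr_cvg0.
(* From here the sample point is fixed, so [B], [del] and [C] may depend on it; only [b] had to be
   chosen before. *)
have bA : bm (fun x => kps 2 (V w x)) by exact: bm_kp.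
have [dl [K [dl0 _ hdl hK]]] := kp_bounds kpos kder 2 bVw.
have b4 : bm (fun x => kps (4 * nu) (V w x)) by exact: bm_kp.
pose X8 := 2 * n2 (fun x => kps (4 * nu) (V w x)) + 2.
have [B [del [del0 hB]]] := galh_bounded d3 X8 bA dl0 hdl hK.
have [_ [KU hKU]] := bUw.
have hKU' x : `|U w x| <= `|KU| by rewrite (le_trans (hKU x))// ler_norm.
have [C [C0 hC]] := hb `|KU| (normr_ge0 _).
have ev1 := cvgr0_norm_lt _ h2w _ del0.
have ev2 := cvgr0_norm_lt _ h3w _ (ltr01 : 0 < 1 :> R).
pose D := C * expR (b ^+ 2 * B / 2).
have lim : (fun j => D * (y (q j) w * fine (exp_X b (q j) w))) @ \oo --> (0 : R).
  by rewrite -[X in _ --> X](mulr0 D); apply: cvgMr.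
apply: (@squeeze_cvgr _ _ _ _ (fun=> 0) _ _ _ _ _ lim); last exact: cvg_cst.
near=> j.
rewrite sqr_ge0 /=.
have e1 : n2 (fun x => kps 2 (V w x) - va (q j) w x) <= del.
  rewrite (EE_ext mu (g := fun x => (kps 2 (v (q j) w x) - kps 2 (V w x)) ^+ 2)); last first.
    by move=> x; rewrite /va -sqrrN opprB.
  by apply: (le_trans (ler_norm _)); apply: ltW; near: j; exact: ev1.
have e2 : n2 (fun x => kps (4 * nu) (v (q j) w x) - kps (4 * nu) (V w x)) <= 1.
  by apply: (le_trans (ler_norm _)); apply: ltW; near: j; exact: ev2.
have e3 : E (fun x => vm (q j) w x ^+ 8) <= X8.
  have bd : bm (fun x => kps (4 * nu) (v (q j) w x) - kps (4 * nu) (V w x)).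
    by apply: bmD; [|apply: bmN]; exact: bm_kp.
  have := EE_sqrD mu b4 bd.
  rewrite (EE_ext mu (f := fun x => (kps (4 * nu) (V w x) + _) ^+ 2) (g := fun x => vm (q j) w x ^+ 8)).
    move=> h; apply: (le_trans h); rewrite /X8; apply: lerD; first exact: lexx.
    by rewrite -[X in _ <= X]mulr1; apply: ler_wpM2l.
  move=> x; rewrite addrC subrK /vm !kpE//.
  by rewrite -!expRM_natl; congr expR; ring.
have [dl' dl'0 hdl'] := va_pos (q j) w.
have hv x : gvar (q j) w x <= B.
  rewrite /gvar -(sum_cubes (q j) (fun t => galh (q j) (va (q j) w) (vm (q j) w) t x ^+ 2)).
  exact: (hB (q j) _ _ dl' (bva (q j) w) (bvm (q j) w) dl'0 hdl' e1 e3 x).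
have h := hC _ _ mu _ _ (bm_uN (q j) w) bUw hKU'.
apply: (le_trans h); rewrite /D yw.
set Y := n2 (fun x => uN (q j) w x - U w x).
have Y0 : 0 <= Y by exact: EE_sqr_ge0.
rewrite -mulrA -[X in _ <= X]mulrA; apply: ler_wpM2l => //.
rewrite mulrCA; apply: ler_wpM2l => //.
exact: exp_bound.
Unshelve. all: by end_near.
Qed.

End step.

(** * Induction on the levels *)

Section subsequence_criteria.
Context {R : realType} {dO : measure_display} {Omega : measurableType dO}.
Variable P : probability Omega R.

Lemma asub_sum (Q : nat -> nat -> Omega -> R) k : (forall i, (i < k)%N -> asub P (Q i)) ->
  asub P (fun n w => \sum_(i < k) Q i n w).
Proof.
elim: k => [|k IH] hQ.
  move=> psi _; exists id; split => //; apply: aeW => w.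
  by under eq_fun do rewrite big_ord0; exact: cvg_cst.
have hk : asub P (fun n w => \sum_(i < k) Q i n w).
  by apply: IH => i ik; apply: hQ; exact: ltnW.
move=> psi spsi; have [phi [sphi h1 h2]] := asub2 hk (hQ k (ltnSn k)) spsi.
exists phi; split => //; apply: filterS2 h1 h2 => w h1 h2.
under eq_fun do rewrite big_ord_recr /=.
by have h := cvgD h1 h2; rewrite addr0 in h; exact: h.
Qed.

Lemma ae_all_countable (K : countType) (Q : Omega -> K -> Prop) :
  (forall k, {ae P, forall w, Q w k}) -> {ae P, forall w, forall k, Q w k}.
Proof.
move=> hQ.
have h n : {ae P, forall w, if (unpickle n : option K) is Some k then Q w k else True}.
  by case: (unpickle n) => [k|]; [exact: hQ | exact: aeW].
by apply: filterS (ae_foralln h) => w hw k; have := hw (pickle k); rewrite pickleK.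
Qed.

(* [U] is not assumed measurable in [w]: the version of [n2 (u n - U)] is the
   limit of [n2 (u n - u (phi j))]. *)
Lemma measurable_version {dT : measure_display} {T : measurableType dT} (mu : probability T R)
    (u : nat -> Omega -> T -> R) (U : Omega -> T -> R) :
  (forall n, jm (u n)) -> (forall n w, bm (u n w)) -> {ae P, forall w, bm (U w)} ->
  asub P (fun n w => EE mu (fun x => (u n w x - U w x) ^+ 2)) ->
  exists q : nat -> Omega -> R, (forall n, measurable_fun setT (q n)) /\
    forall n, {ae P, forall w, EE mu (fun x => (u n w x - U w x) ^+ 2) = q n w}.
Proof.
move=> ju bu bU hu; have [phi [sphi h]] := hu _ ssub_id.
exists (fun n w => rlim (fun j => EE mu (fun x => (u n w x - u (phi j) w x) ^+ 2))); split.
  move=> n; apply: measurable_rlim => j; apply: measurable_EE.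
    change (jm (fun w x => (u n w x - u (phi j) w x) ^+ 2)).
    by apply: (jm_comp (k := fun t => t ^+ 2)); [exact: measurable_funX | exact: jmB].
  by move=> w; apply: bmX; apply: bmD => //; exact: bmN.
by move=> n; apply: filterS2 bU h => w bUw hw; apply/esym/rlimE; exact: n2_cvg.
Qed.

End subsequence_criteria.

Section levels.
Context {R : realType} {d : nat} {dO : measure_display} {Omega : measurableType dO}.
Hypothesis d3 : (d <= 3)%N.
Local Notation T := (d.-tuple R).
Local Notation mu := (cubeP d : probability T R).
Local Notation E := (EE mu).
Local Notation n2 f := (E (fun x => f x ^+ 2)).
Variable P : probability Omega R.
Variables (kappa : R -> R) (c1 c2 a1 a2 nu um1 : R) (J : nat).
Variables (zeta : nat -> d.-tuple int -> Omega -> R).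
Variables (U : nat -> Omega -> 'rV[R]_d -> R) (UN : nat -> nat -> Omega -> 'rV[R]_d -> R).
Hypothesis nu0 : 0 < nu.
Hypothesis kpos : forall t, 0 < kappa t.
Hypothesis kder : forall t, derivable kappa t 1.
Hypothesis c10 : 0 < c1.
Hypothesis c20 : 0 < c2.
Hypothesis a10 : 0 < a1.
Hypothesis a20 : 0 < a2.
Hypothesis klow : forall t, c1 * expR (- (a1 * `|t|)) <= kappa t.
Hypothesis kup : forall t, kappa t <= c2 * expR (a2 * `|t|).
Hypothesis kder_up : forall t, `|derive1 kappa t| <= c2 * expR (a2 * `|t|).
Hypothesis wn : white_noises P J zeta.
Hypothesis hspde : spde_solution P kappa nu um1 J zeta U.
Hypothesis hgal : galerkin_solution P kappa nu um1 J zeta UN.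
Local Notation kps := (kp kappa).
Local Notation A := (nat * d.-tuple int)%type.

Definition zetaA (a : A) : Omega -> R := zeta a.1 a.2.
Let L : pred A := fun a => (a.1 <= J)%N.
(** The noises that determine the coefficient of the equation at level [i], all independent of the
    [i]-th one. *)
Definition below (i : nat) : pred A := fun a => (a.1 < i)%N.

(** Indices are shifted by one: [vlev i.+1] stands for the Galerkin solution at level [i]. Unlike
    [UN], it is given by a formula at every sample point, hence measurable with respect to the
    noises it uses. *)
Fixpoint vlev (i : nat) : nat -> Omega -> T -> R :=
  if i is i'.+1 then uN kappa nu zetaA (pair i') (vlev i') else fun _ _ _ => um1.

Definition Vlev (i : nat) (w : Omega) : T -> R := prevf um1 (fun j => U j w) i \o fromT.

Let mz a : L a -> measurable_fun setT (zetaA a).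
Proof. by have [h _ _] := wn; exact: h. Qed.

Let lawz a : L a -> forall B : set R, measurable B -> P (zetaA a @^-1` B) = normal_prob 0 1 B.
Proof. by have [_ h _] := wn; exact: h. Qed.

Let indz : forall s : seq A, uniq s -> all L s -> forall B : A -> set R,
  (forall a, measurable (B a)) ->
  P (\bigcap_(a in [set` s]) (zetaA a @^-1` B a)) = (\prod_(a <- s) P (zetaA a @^-1` B a))%E.
Proof. by have [_ _ h] := wn; exact: h. Qed.

Lemma bm_vlev i n w : bm (vlev i n w).
Proof. by case: i => [|i]; [exact: bm_cst | exact: bm_uN]. Qed.

Lemma jm_vlev i n : (i <= J.+1)%N -> @jm R _ _ (zalg zetaA L (below i)) T (vlev i n).
Proof.
elim: i n => [|i IH] n iJ; first exact: measurable_cst.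
apply: (jm_uN nu kpos kder (L := L) (I := below i)).
- by move=> k; rewrite /L.
- by move=> m; apply: IH; exact: ltnW.
- exact: bm_vlev.
- by move=> a; rewrite !unfold_in /below => /ltnW.
- by move=> k; rewrite /below /=.
Qed.

Lemma bm_Vlev i : (i <= J.+1)%N -> {ae P, forall w, bm (Vlev i w)}.
Proof.
case: i => [|i] iJ; first by apply: aeW => w; exact: bm_cst.
have [h _] := hspde; apply: filterS (h i iJ) => w [mU _ [M hM]].
by split => //; exists M => x; exact: hM.
Qed.

Let bm_fourier k : bm ((fourier k : 'rV[R]_d -> R) \o fromT).
Proof. exact: bm_Fe. Qed.

(** In the SPDE the exceptional null set depends on the test function; testing with the countably
    many basis functions yields a common one. *)
Lemma spde_coef i : (i <= J)%N -> {ae P, forall w, forall k,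
  (fun n => \sum_(t <- cubes n) noise zetaA (pair i) w t * ent (fun x => kps nu (Vlev i w x)) t k) @ \oo -->
  bcoef (fun x => kps 2 (Vlev i w x)) (Vlev i.+1 w) k}.
Proof.
move=> iJ; apply: ae_all_countable => k.
have [_ h] := hspde; have hk := h i iJ (fourier k) (C2_fourier k).
have hb := ae_and (bm_Vlev (leqW iJ)) (bm_Vlev (iJ : (i.+1 <= J.+1)%N)).
apply: filterS2 hb hk => w [bV bU] /=.
set vw := prevf um1 (fun j => U j w) i => hw.
have bk s : bm (fun x => kps s (Vlev i w x)) by exact: bm_kp.
have -> : (fun n => \sum_(t <- cubes n) noise zetaA (pair i) w t * ent (fun x => kps nu (Vlev i w x)) t k) =
  (fun n => \sum_(t : d.-tuple 'I_(2 * n).+1) zeta i (cubek t) w *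
     inner (fun x => kappa (vw x) `^ nu * fourier (cubek t) x) (fourier k)).
  apply/funext => n.
  rewrite -(sum_cubes n (fun t => noise zetaA (pair i) w t * ent (fun x => kps nu (Vlev i w x)) t k)).
  apply: eq_bigr => t _; congr (_ * _); rewrite innerE//.
  by apply: (bmM (bk nu)); exact: bm_Fe.
have -> // : bcoef (fun x => kps 2 (Vlev i w x)) (Vlev i.+1 w) k =
  - inner (U i w) (lap (fourier k)) + inner (fun x => kappa (vw x) ^+ 2 * U i w x) (fourier k).
rewrite /bcoef; congr (_ + _).
  rewrite lap_fourier innerE//; last by apply: bmM; [exact: bm_cst | exact: bm_fourier].
  rewrite (EE_ext mu (g := fun x => - lamk k * (Vlev i.+1 w x * Fe k x))); last first.
    by move=> x; rewrite /Vlev /= /Fe; ring.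
  by rewrite EEZ ?mulNr ?opprK//; apply: bmM => //; exact: bm_Fe.
rewrite innerE//; first by apply: EE_ext => x; rewrite kp2E.
have := bmM (bk 2) bU; congr bm.
by apply/funext => x; rewrite /= kp2E.
Qed.

(** Induction on the level: the coefficient is already identified with [vlev i], and testing with
    the basis functions puts the given solution under [uN_unique]. *)
Lemma galerkin_vlev : {ae P, forall w, forall n i, (i <= J)%N -> UN n i w \o fromT = vlev i.+1 n w}.
Proof.
apply: ae_foralln => n; apply: filterS (hgal n) => w hw.
suff H i : (i <= J.+1)%N -> prevf um1 (fun j => UN n j w) i \o fromT = vlev i n w.
  by move=> i iJ; exact: (H i.+1).
elim: i => [|i IH] iJ; first by [].
have {}IH := IH (ltnW iJ).
have /= [[c cE] hc] := hw i iJ.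
set vw := prevf um1 (fun j => UN n j w) i in hc IH.
have vE x : vw (fromT x) = vlev i n w x by rewrite -IH.
have bv := bm_vlev i n w.
have uE : UN n i w \o fromT = comb (@Ft R d n) c by rewrite cE.
have bu : bm (UN n i w \o fromT).
  by rewrite uE; apply: bm_comb => t; exact: bm_Ft.
rewrite /= uE; apply: (uN_unique kpos kder (fun n w => bm_vlev i n w)) => t.
have ht : in_H n (fourier (cubek t) : 'rV[R]_d -> R).
  exists (fun s => (s == t)%:R); apply/funext => x.
  rewrite (bigD1 t)//= eqxx mul1r big1 ?addr0// => s /negPf ->; exact: mul0r.
have := hc _ ht.
rewrite {1}cE (grad_inner_fourier c t (@cubek_inj d n)).
have b2 : bm ((fun x => kappa (vw x) ^+ 2 * UN n i w x) \o fromT).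
  have := bmM (bm_kp kpos kder 2 bv) bu; congr bm.
  by apply/funext => x; rewrite /= kp2E// vE.
have bn : bm (fun x => noiseN zeta i n w (fromT x)).
  by apply: bm_sum => s; apply: bmM; [exact: bm_cst | exact: bm_Fe].
have b3 : bm ((fun x => kappa (vw x) `^ nu * noiseN zeta i n w x) \o fromT).
  have := bmM (bm_kp kpos kder nu bv) bn; congr bm.
  by apply/funext => x; rewrite /= vE.
rewrite !innerE// => h.
transitivity (E (fun x => kappa (vw (fromT x)) `^ nu * noiseN zeta i n w (fromT x) * fourier (cubek t) (fromT x))).
  rewrite -h; congr (_ + _); apply: EE_ext => x.
  by rewrite /va kp2E// vE -uE.
rewrite (EE_ext mu (g := fun x => \sum_(s : cubeI n) zeta i (cubek s) w * (vm kappa nu (vlev i) n w x * Fe (cubek s) x * Fe (cubek t) x))).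
  rewrite EE_sum; last first.
    move=> s; apply: bmM; first exact: bm_cst.
    by apply: bmM; [apply: bmM; [exact: bm_kp|]|]; exact: bm_Fe.
  apply: eq_bigr => s _; rewrite EEZ//.
  by apply: bmM; [apply: bmM; [exact: bm_kp|]|]; exact: bm_Fe.
move=> x; rewrite /noiseN vE mulr_sumr mulr_suml; apply: eq_bigr => s _.
by rewrite /vm /kp /Fe; ring.
Qed.

(** An invariant for all powers together: the step to the next level needs 2, [nu] and [4 * nu],
    whatever the power to be proved. *)
Let good_level i := forall s, 0 < s ->
  asub P (fun n w => n2 (fun x => kps s (vlev i n w x) - kps s (Vlev i w x))).

Lemma level_step i : (i <= J)%N -> good_level i ->
  good_level i.+1 /\ asub P (fun n w => n2 (fun x => vlev i.+1 n w x - Vlev i.+1 w x)).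
Proof.
move=> iJ gi.
have jv n : @jm R _ _ (zalg zetaA L (below i)) T (vlev i n) by apply: jm_vlev; exact: leqW.
have iK : cancel (pair i : d.-tuple int -> A) snd by [].
have Li k : L (i, k) by [].
have Ii k : ~~ below i (i, k) by rewrite /below /= ltnn.
have bV := bm_Vlev (leqW iJ); have bU := bm_Vlev (iJ : (i.+1 <= J.+1)%N).
split; last exact: (asub_uN d3 kpos kder nu0 mz lawz indz iK Li Ii jv (bm_vlev i) bV bU gi (spde_coef iJ)).
exact: (asub_kp_uN d3 kpos kder c10 c20 a10 a20 klow kup kder_up nu0 mz lawz indz iK Li Ii jv
  (bm_vlev i) bV bU gi (spde_coef iJ)).
Qed.

Lemma level_good i : (i <= J.+1)%N -> good_level i.
Proof.
elim: i => [|i IH] iJ; last by have [] := level_step iJ (IH (ltnW iJ)).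
move=> s s0 psi spsi; exists id; split => //; apply: aeW => w.
have -> : (fun j => n2 (fun x => kps s (vlev 0 (psi j) w x) - kps s (Vlev 0 w x))) = (fun=> 0).
  apply/funext => j; rewrite -[RHS](EE_cst mu); apply: EE_ext => x.
  by rewrite /Vlev /= subrr expr0n.
exact: cvg_cst.
Qed.

Lemma L2dist2E n w : (forall i, (i <= J)%N -> UN n i w \o fromT = vlev i.+1 n w) ->
  (forall i, (i <= J)%N -> bm (Vlev i.+1 w)) ->
  L2dist2 J (fun i => UN n i w) (fun i => U i w) =
  (\sum_(i < J.+1) n2 (fun x => vlev i.+1 n w x - Vlev i.+1 w x))%:E.
Proof.
move=> hv hb; rewrite /L2dist2 -sumEFin; apply: eq_bigr => i _.
have iJ : (i <= J)%N by rewrite -ltnS.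
rewrite -cube_intE; last by apply: bmX; apply: bmD; [exact: bm_vlev | apply: bmN; exact: hb].
rewrite /tint; congr cube_int; apply/funext => x /=.
by have := congr1 (fun f => f x) (hv i iJ) => /= ->.
Qed.

Lemma cvg_levels : cvg_in_prob_L2 P J UN U.
Proof.
move=> eps eps0.
pose x n w : R := \sum_(i < J.+1) n2 (fun x => vlev i.+1 n w x - Vlev i.+1 w x).
have hi i : (i < J.+1)%N -> asub P (fun n w => n2 (fun x => vlev i.+1 n w x - Vlev i.+1 w x)).
  by move=> iJ; have [] := level_step iJ (level_good (ltnW iJ)).
have hx : asub P x by exact: (asub_sum hi).
have x0 n w : 0 <= x n w by apply: sumr_ge0 => i _; exact: EE_sqr_ge0.
have hq (i : 'I_J.+1) : exists q : nat -> Omega -> R, (forall n, measurable_fun setT (q n)) /\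
    forall n, {ae P, forall w, n2 (fun x => vlev i.+1 n w x - Vlev i.+1 w x) = q n w}.
  have ju n : @jm R _ _ Omega T (vlev i.+1 n).
    have mid : @measurable_fun _ _ Omega (zalg zetaA L (below i.+1)) setT id.
      exact: (measurable_to_zalg mz).
    exact: (jm_reparam mid (jm_vlev n (ltn_ord i))).
  exact: (measurable_version ju (bm_vlev i.+1) (bm_Vlev (ltn_ord i)) (hi i (ltn_ord i))).
have [q hq'] := choice hq.
pose qs n w := \sum_(i < J.+1) q i n w.
have mqs n : measurable_fun setT (qs n).
  by apply: measurable_sum => i; have [] := hq' i.
have xq n : {ae P, forall w, x n w = qs n w}.
  have h : {ae P, forall w, forall i : 'I_J.+1, n2 (fun x => vlev i.+1 n w x - Vlev i.+1 w x) = q i n w}.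
    by apply: ae_all_countable => i; have [_] := hq' i.
  by apply: filterS h => w hw; apply: eq_bigr => i _.
have e2 : 0 < eps ^+ 2 by rewrite exprn_gt0.
have [A0 [mA sA cA]] := asub_prob e2 x0 mqs xq hx.
have hU : {ae P, forall w, forall i : 'I_J.+1, bm (Vlev i.+1 w)}.
  by apply: ae_all_countable => i; exact: bm_Vlev.
have [N [mN PN sN]] := ae_and galerkin_vlev hU.
(* A single null set [N] serves all [n]: outside it [UN] agrees with [vlev] and the limits are
   bounded and measurable on the torus. *)
exists (fun n => A0 n `|` N); split.
- by move=> n; exact: measurableU.
- move=> n w /= hw.
  have [[g1 g2]|ng] := pselect ((forall n i, (i <= J)%N -> UN n i w \o fromT = vlev i.+1 n w) /\
     forall i : 'I_J.+1, bm (Vlev i.+1 w)); last by right; apply: sN.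
  left; apply: sA => /=; move: hw; rewrite L2dist2E ?lte_fin//; first exact: g1.
  by move=> i iJ; exact: (g2 (Ordinal (iJ : (i < J.+1)%N))).
- have PU n : P (A0 n `|` N) = P (A0 n).
    apply/eqP; rewrite eq_le; apply/andP; split; last first.
      have mU : measurable (A0 n `|` N) by exact: measurableU.
      by apply: le_measure; rewrite ?inE//; left.
    have h : (P (A0 n `|` N) <= P (A0 n) + P N)%E by exact: measureU2.
    by rewrite (le_trans h)// PN adde0.
  by under eq_fun do rewrite PU.
Qed.

End levels.

Theorem theorem3p6 (R : realType) (d : nat) (dO : measure_display)
  (Omega : measurableType dO) (P : probability Omega R)
  (nu : R) (J : nat) (um1 : R) (kappa : R -> R) (c1 c2 a1 a2 : R)
  (zeta : nat -> d.-tuple int -> Omega -> R)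
  (U : nat -> Omega -> 'rV[R]_d -> R)
  (UN : nat -> nat -> Omega -> 'rV[R]_d -> R) :
  (1 <= d <= 3)%N -> 0 < nu ->
  (forall t, 0 < kappa t) ->
  (forall t, derivable kappa t 1) -> continuous (derive1 kappa) ->
  0 < c1 -> 0 < c2 -> 0 < a1 -> 0 < a2 ->
  (forall t, c1 * expR (- (a1 * `|t|)) <= kappa t) ->
  (forall t, kappa t <= c2 * expR (a2 * `|t|)) ->
  (forall t, `|derive1 kappa t| <= c2 * expR (a2 * `|t|)) ->
  white_noises P J zeta ->
  spde_solution P kappa nu um1 J zeta U ->
  galerkin_solution P kappa nu um1 J zeta UN ->
  cvg_in_prob_L2 P J UN U.
Proof.
move=> /andP[_ d3] nu0 kpos kder _ c10 c20 a10 a20 klow kup kder_up wn hspde hgal.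
exact: (cvg_levels d3 nu0 kpos kder c10 c20 a10 a20 klow kup kder_up wn hspde hgal).
Qed.
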